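(* Let $0<p,q<\infty$ and $\psi\in\mathcal{SR}(\mathbb H)$. Fix $I,J\in\mathbb S$ with $J\perp I$, and write the splitting of $\psi$ on $\mathbb C_I$ as $\psi_I=P+QJ$ with $P,Q:\mathbb C_I\to\mathbb C_I$ entire and $Q\not\equiv0$. Put $\tau:=P+P^\#$ and $\Delta:=(P-P^\#)^2-4QQ^\#$, and for $w\in\mathbb C_I$ $$\mathcal B_{\psi,I}(w):=\int_{\mathbb C_I}\left|(k_w\bullet\psi)_I(z)\right|^q e^{-\frac{\alpha q}{2}|z|^2}\,dm_{2,I}(z).$$ Suppose that either $\sup_{w\in\mathbb C_I}\mathcal B_{\psi,I}(w)<\infty$, or $0<q<p$ and, with $s=p/(p-q)$, $\int_{\mathbb C_I}\mathcal B_{\psi,I}(w)^s\,dm_{2,I}(w)<\infty$. Then the following assertions hold. (i) $\Delta$ is a polynomial of degree at most two: $\Delta(z)=d_2z^2+d_1z+d_0$ with $d_0,d_1,d_2\in\mathbb R$. Moreover, either $\Delta$ is a nonzero constant, or $d_2<0$. (ii) $\tau$ is affine: $\tau(z)=t_1z+t_0$ with $t_0,t_1\in\mathbb R$. (iii) If $\Delta$ is nonconstant, then there exists an unbounded simply connected region $U\subset\mathbb C_I$ satisfying $U=U^\#$ on which one may choose a holomorphic function $\rho$ with $\rho^2=\Delta$, so that $$\lambda_\pm(z):=\frac{\tau(z)\pm\rho(z)}{2}=a_\pm z+b_\pm+O(1/z),\qquad z\to\infty,$$ where $a_\pm,b_\pm\in\mathbb C_I$, $0<|a_\pm|\le1$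 and $|a_+|=|a_-|$. (iv) If $\Delta$ has no zeros on $\mathbb C_I$, then $\Delta\equiv\Delta_0\ne0$ is constant. After choosing a constant square root $\rho$ of $\Delta_0$, the global eigenvalue functions $\lambda_\pm=(\tau\pm\rho)/2$ are affine: $$\lambda_\pm(z)=az+b_\pm,\qquad a,b_\pm\in\mathbb C_I,\qquad |a|\le1.$$
   Context: $\mathbb H$ denotes the quaternions, $\mathbb S=\{I\in\mathbb H: I^2=-1\}$, and for $I\in\mathbb S$, $\mathbb C_I=\{x+yI: x,y\in\mathbb R\}$. $J\perp I$ means orthogonality of imaginary units (so $IJ=-JI$). A real differentiable $f:\mathbb H\to\mathbb H$ is slice regular if for every $I\in\mathbb S$ the restriction $f_I:=f|_{\mathbb C_I}$ satisfies $\frac12(\partial_x+I\partial_y)f_I(x+yI)=0$; $\mathcal{SR}(\mathbb H)$ is the class of such functions. For $J\perp I$, each $f\in\mathcal{SR}(\mathbb H)$ splits uniquely as $f_I=F+GJ$ with $F,G:\mathbb C_I\to\mathbb C_I$ entire. Every $f\in\mathcal{SR}(\mathbb H)$ has a power series $f(\xi)=\sum_{n\ge0}\xi^na_n$, $a_n\in\mathbb H$. For $f=\sum\xi^na_n$, $g=\sum\xi^nb_n$ the $\star$-product is $(f\star g)(\xi)=\sum_n\xi^n\sum_{k=0}^na_kb_{n-k}$. The slice regular composition is $(f\bullet\psi)(\xi)=\sum_{n\ge0}\psi^{\star n}(\xi)a_n$, where $\psi^{\star n}$ is the $n$-th $\star$-power and $\psi^{\star0}\equiv1$. For holomorphic $D$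 put $D^\#(z)=\overline{D(\overline z)}$; for a set $E\subset\mathbb C_I$, $E^\#=\{\overline z:z\in E\}$. The functions $\tau$ and $\Delta$ are the trace and the discriminant ($\tau^2-4\det$) of the matrix symbol $\begin{pmatrix}P&Q\\-Q^\#&P^\#\end{pmatrix}$, and $\lambda_\pm$ are its eigenvalues. Fix $\alpha>0$; $dm_{2,I}$ is planar Lebesgue measure on $\mathbb C_I$; for $w\in\mathbb C_I$, $k_w(z)=e^{-\frac\alpha2|w|^2}\sum_{n\ge0}\frac{\alpha^nz^n\overline w^{\,n}}{n!}$. *)

(* Defs.v *)
From HB Require Import structures.
From mathcomp Require Import all_boot all_order all_algebra.
From mathcomp Require Import complex.
From mathcomp Require Import all_classical all_reals all_analysis.
From mathcomp Require Import ring lra.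
Set Implicit Arguments.
Unset Strict Implicit.
Unset Printing Implicit Defensive.
Import Order.TTheory GRing.Theory Num.Theory.
Import numFieldNormedType.Exports.
Local Open Scope classical_set_scope.
Local Open Scope ring_scope.

(* Coordinates with respect to the basis 1, i, j, k = ij. *)
Record quat (R : realType) := Quat { q0 : R; q1 : R; q2 : R; q3 : R }.

Section QuatAlgebra.
Variable R : realType.
Local Notation H := (quat R).
Implicit Types x y z : H.

Definition quat_to_prod x : R * R * R * R := (q0 x, q1 x, q2 x, q3 x).
Definition quat_of_prod (u : R * R * R * R) : H :=
  Quat u.1.1.1 u.1.1.2 u.1.2 u.2.

Lemma quat_to_prodK : cancel quat_to_prod quat_of_prod.
Proof. by case. Qed.

HB.instance Definition _ := Equality.copy H (can_type quat_to_prodK).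
HB.instance Definition _ := Choice.copy H (can_type quat_to_prodK).

Definition quat_zero : H := Quat 0 0 0 0.
Definition quat_one : H := Quat 1 0 0 0.
Definition quat_opp x := Quat (- q0 x) (- q1 x) (- q2 x) (- q3 x).
Definition quat_add x y :=
  Quat (q0 x + q0 y) (q1 x + q1 y) (q2 x + q2 y) (q3 x + q3 y).
Definition quat_mul x y := Quat
  (q0 x * q0 y - q1 x * q1 y - q2 x * q2 y - q3 x * q3 y)
  (q0 x * q1 y + q1 x * q0 y + q2 x * q3 y - q3 x * q2 y)
  (q0 x * q2 y - q1 x * q3 y + q2 x * q0 y + q3 x * q1 y)
  (q0 x * q3 y + q1 x * q2 y - q2 x * q1 y + q3 x * q0 y).
Definition quat_scale (a : R) x := Quat (a * q0 x) (a * q1 x) (a * q2 x) (a * q3 x).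

Lemma quat_addA : associative quat_add.
Proof. by move=> [????] [????] [????]; congr Quat => /=; ring. Qed.
Lemma quat_addC : commutative quat_add.
Proof. by move=> [????] [????]; congr Quat => /=; ring. Qed.
Lemma quat_add0 : left_id quat_zero quat_add.
Proof. by move=> [????]; congr Quat => /=; ring. Qed.
Lemma quat_addN : left_inverse quat_zero quat_opp quat_add.
Proof. by move=> [????]; congr Quat => /=; ring. Qed.

HB.instance Definition _ :=
  GRing.isZmodule.Build H quat_addA quat_addC quat_add0 quat_addN.

Lemma quat_mulA : associative quat_mul.
Proof. by move=> [????] [????] [????]; congr Quat => /=; ring. Qed.
Lemma quat_mul1l : left_id quat_one quat_mul.
Proof. by move=> [????]; congr Quat => /=; ring. Qed.
Lemma quat_mul1r : right_id quat_one quat_mul.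
Proof. by move=> [????]; congr Quat => /=; ring. Qed.
Lemma quat_mulDl : left_distributive quat_mul +%R.
Proof. by move=> [????] [????] [????]; congr Quat => /=; ring. Qed.
Lemma quat_mulDr : right_distributive quat_mul +%R.
Proof. by move=> [????] [????] [????]; congr Quat => /=; ring. Qed.
Lemma quat_one_neq0 : quat_one != 0.
Proof. by apply/eqP => -[] /eqP; rewrite oner_eq0. Qed.

HB.instance Definition _ := GRing.Zmodule_isNzRing.Build H
  quat_mulA quat_mul1l quat_mul1r quat_mulDl quat_mulDr quat_one_neq0.

Lemma quat_scaleA a b x : quat_scale a (quat_scale b x) = quat_scale (a * b) x.
Proof. by case: x => ????; congr Quat => /=; ring. Qed.
Lemma quat_scale1 : left_id 1 quat_scale.
Proof. by move=> [????]; congr Quat => /=; ring. Qed.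
Lemma quat_scaleDr : right_distributive quat_scale +%R.
Proof. by move=> a [????] [????]; congr Quat => /=; ring. Qed.
Lemma quat_scaleDl x : {morph quat_scale^~ x : a b / a + b}.
Proof. by move=> a b; case: x => ????; congr Quat => /=; ring. Qed.

HB.instance Definition _ := GRing.Zmodule_isLmodule.Build R H
  quat_scaleA quat_scale1 quat_scaleDr quat_scaleDl.

Lemma quat_scaleAl a x y : a *: (x * y) = (a *: x) * y.
Proof. by case: x y => ???? [????]; congr Quat => /=; ring. Qed.
Lemma quat_scaleAr a x y : a *: (x * y) = x * (a *: y).
Proof. by case: x y => ???? [????]; congr Quat => /=; ring. Qed.

HB.instance Definition _ := GRing.Lmodule_isLalgebra.Build R H quat_scaleAl.
HB.instance Definition _ := GRing.Lalgebra_isAlgebra.Build R H quat_scaleAr.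

Definition quat_conj x : H := Quat (q0 x) (- q1 x) (- q2 x) (- q3 x).

Definition quat_dot x y : R :=
  q0 x * q0 y + q1 x * q1 y + q2 x * q2 y + q3 x * q3 y.

Definition quat_norm x : R := Num.sqrt (quat_dot x x).

Lemma quat_dot_ge0 x : 0 <= quat_dot x x.
Proof. by rewrite /quat_dot -!expr2 !addr_ge0 ?sqr_ge0. Qed.

Lemma quat_normD x y : quat_norm (x + y) <= quat_norm x + quat_norm y.
Proof.
have n_ge0 z : 0 <= quat_norm z by exact: sqrtr_ge0.
rewrite -(@ler_pXn2r _ 2)// ?nnegrE ?addr_ge0//.
rewrite sqrrD !sqr_sqrtr ?quat_dot_ge0//.
have -> : quat_dot (x + y) (x + y) =
    quat_dot x x + quat_dot x y *+ 2 + quat_dot y y.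
  by case: x y => ???? [????]; rewrite /quat_dot /=; ring.
rewrite lerD2r lerD2l ler_pMn2r//.
apply: (le_trans (ler_norm _)).
rewrite -(@ler_pXn2r _ 2)// ?nnegrE ?mulr_ge0//.
rewrite exprMn !sqr_sqrtr ?quat_dot_ge0// real_normK ?num_real//.
case: x y => a b c d [a' b' c' d']; rewrite /quat_dot /= -subr_ge0.
set e := (X in 0 <= X); have -> : e =
    (a * b' - b * a') ^+ 2 + (a * c' - c * a') ^+ 2 + (a * d' - d * a') ^+ 2 +
    (b * c' - c * b') ^+ 2 + (b * d' - d * b') ^+ 2 + (c * d' - d * c') ^+ 2.
  by rewrite /e; ring.
by rewrite !addr_ge0 ?sqr_ge0.
Qed.

Lemma quat_normZ (a : R) x : quat_norm (a *: x) = `|a| * quat_norm x.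
Proof.
rewrite /quat_norm -sqrtr_sqr -sqrtrM ?sqr_ge0//; congr Num.sqrt.
by case: x => ????; rewrite /quat_dot /=; ring.
Qed.

Lemma quat_norm0_eq0 x : quat_norm x = 0 -> x = 0.
Proof.
move/eqP; rewrite sqrtr_eq0 => xx.
have /eqP : quat_dot x x = 0 by apply/le_anti; rewrite xx quat_dot_ge0.
rewrite /quat_dot -!expr2 !paddr_eq0 ?addr_ge0 ?sqr_ge0// !sqrf_eq0.
by case: x {xx} => ???? /= /andP[/andP[/andP[/eqP-> /eqP->] /eqP->] /eqP->].
Qed.

HB.instance Definition _ := @Lmodule_isNormed.Build R H
  quat_norm quat_normD quat_normZ quat_norm0_eq0.

End QuatAlgebra.

Section SliceRegular.
Variable R : realType.
Local Notation H := (quat R).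
Implicit Types (f g psi : H -> H) (I xi : H) (a b : nat -> H).

Definition imaginary_unit I : Prop := I ^+ 2 = - 1.

Definition quat_orthogonal I J : Prop := quat_dot I J = 0.

(* The plane C_I is identified with R[i] through x + iy |-> x + yI. *)
Definition slice I (z : R[i]) : H :=
  complex.Re z *: 1 + complex.Im z *: I.

Definition slice_regular f : Prop :=
  (forall xi, differentiable f xi) /\
  forall I, imaginary_unit I -> forall x y : R,
    2^-1 *: (derive1 (fun t : R => f (slice I (Complex t y))) x +
             I * derive1 (fun t : R => f (slice I (Complex x t))) y) = 0.

Definition has_power_series f a : Prop :=
  forall xi, series (fun n => xi ^+ n * a n) @ \oo --> f xi.

(* Coefficients are unique, being determined by the values on the real axis. *)
Definition coefs f : nat -> H := get [set a | has_power_series f a].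

(* Star products and compositions are total; for slice regular arguments the
   series below converge everywhere. *)
Definition star f g : H -> H := fun xi =>
  limn (series (fun n => xi ^+ n *
    \sum_(k < n.+1) coefs f k * coefs g (n - k)%N)).

Definition star_exp psi (n : nat) : H -> H := iter n (star psi) (cst 1).

Definition slice_comp f psi : H -> H := fun xi =>
  limn (series (fun n => star_exp psi n xi * coefs f n)).

Definition fock_kernel (alpha : R) (w : H) : H -> H := fun z =>
  expR (- (alpha / 2) * `|w| ^+ 2) *:
  limn (series (fun n => (alpha ^+ n / n`!%:R) *: (z ^+ n * quat_conj w ^+ n))).

(* Integral against planar Lebesgue measure, through x + iy <-> (x, y). *)
Definition plane_integral (F : R[i] -> \bar R) : \bar R :=
  (\int[(@lebesgue_measure R \x @lebesgue_measure R)%E]_u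
     F (Complex u.1 u.2))%E.

Definition berezin (alpha q : R) psi I (w : R[i]) : \bar R :=
  plane_integral (fun z =>
    (`|slice_comp (fock_kernel alpha (slice I w)) psi (slice I z)| `^ q *
     expR (- (alpha * q / 2) * `|slice I z| ^+ 2))%:E).

End SliceRegular.

(* R[i] as a normed space over itself, so that [derivable F z 1] is complex
   differentiability. *)
HB.instance Definition _ (R : realType) := NormedModule.copy R[i] R[i]^o.

Section ComplexPlane.
Variable R : realType.
Local Notation C := R[i].
Implicit Types (F P Q : C -> C) (U : set C).

Definition holomorphic_on U F : Prop := forall z, U z -> derivable F z 1.

Definition entire F : Prop := holomorphic_on setT F.

Definition sharp F : C -> C := fun z => (F z^*)^*.

Definition sharp_set U : set C := [set z^* | z in U].

Definition symbol_trace P : C -> C := fun z => P z + sharp P z.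

Definition symbol_discr P Q : C -> C := fun z =>
  (P z - sharp P z) ^+ 2 - 4 * Q z * sharp Q z.

Definition is_constant F : Prop := exists c, forall z, F z = c.

Definition region U : Prop := [/\ open U, connected U & U !=set0].

Definition path_in U (g : R -> C) : Prop :=
  {within `[0, 1]%classic, continuous g} /\ forall t : R, 0 <= t <= 1 -> U (g t).

Definition simply_connected U : Prop :=
  (forall x y, U x -> U y -> exists g, [/\ path_in U g, g 0 = x & g 1 = y]) /\
  forall g, path_in U g -> g 0 = g 1 ->
    exists h : R * R -> C,
      [/\ {within `[0, 1]%classic `*` `[0, 1]%classic, continuous h},
          forall s t : R, 0 <= s <= 1 -> 0 <= t <= 1 -> U (h (s, t)),
          forall t : R, 0 <= t <= 1 -> h (0, t) = g t,
          forall t : R, 0 <= t <= 1 -> h (1, t) = g 0 &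
          forall s : R, 0 <= s <= 1 -> h (s, 0) = g 0 /\ h (s, 1) = g 0].

(* F(z) = a z + b + O(1/z) as z tends to infinity in U. *)
Definition affine_asymptotic U F (a b : C) : Prop :=
  exists K r : R, 0 < r /\ forall z, U z -> (r%:C)%C <= `|z| ->
    `|F z - (a * z + b)| <= (K%:C)%C / `|z|.

End ComplexPlane.

(* Main.v *)
(* On C_I let A be the matrix symbol with rows (P, Q) and (-Q#, P#). The star powers of psi are
   governed by the first rows of the powers of A, so (k_w o psi)_I is, up to the factor
   exp(-alpha |w|^2 / 2), given by the first row (E1, E2) of exp(alpha conj(w) A). A sub-mean value
   inequality for |f|^q, f entire, turns either hypothesis on the Berezin-type integral into
     |E1(z, w)| <= C exp(alpha/2 ((|z| + 2)^2 + (|w| + 2)^2)).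
   The lower right entry of exp(alpha w A) is conj(E1(conj z, conj w)), so the same bound, up to a
   constant, holds for the trace exp(alpha w l+) + exp(alpha w l-), l+ and l- being the eigenvalues.
   Taking w of size |z| with a suitable argument gives tau = O(|z|) and Delta = O(|z|^2), so tau and
   Delta are polynomials by Liouville's theorem. On the real axis tau is real and
   Delta = -4 ((Im P)^2 + |Q|^2) <= 0, whence (i), (ii); comparing the quadratic exponents along the
   real axis bounds the slopes of the eigenvalues by 1. *)
Require Import Defs.
From mathcomp Require Import all_boot all_order all_algebra.
From mathcomp Require Import complex.
From mathcomp Require Import all_classical all_reals all_analysis.
From mathcomp Require Import measurable_realfun ring lra.
Import Order.TTheory GRing.Theory Num.Theory.
Import numFieldNormedType.Exports.
Local Open Scope classical_set_scope.
Local Open Scope ring_scope.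
Set Implicit Arguments.
Unset Strict Implicit.
Unset Printing Implicit Defensive.

(** The weights fix the constants. The normalisation of [k_w] and the Gaussian weight each
    contribute alpha/2 times a squared modulus, so for |w| = |z| = r the exponent is alpha r^2 up to
    O(r). Aligning w with an eigenvalue l gives |exp(alpha w l)| = exp(alpha r |l|), hence |l| <= r
    + O(1): this is the origin of the slope bound 1. Each shift by 2 comes from a square of
    half-side 1, whose points lie within 2 of its centre; one square is used in z and, under the
    integral hypothesis, another one in w. The obstacle is cancellation: an upper bound for a sum of
    two exponentials bounds neither of them, as the sum may vanish. Each estimate of tau, of Delta
    and of the slopes therefore chooses w, or the point z, so that the sum is comparable to its
    larger term. Eigenvalues are never chosen continuously before the very end: every bound is
    pointwise in z, with an arbitrary square root of Delta(z), and only tau and Delta, which are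
    entire, enter Liouville's theorem. *)

Lemma eq_ler {R : realType} (x y : R) : x = y -> x <= y.
Proof. by move=> ->. Qed.

(** * Complex moduli, series and the exponential *)

Notation cRe := complex.Re.
Notation cIm := complex.Im.

Section Modulus.
Context {R : realType}.
Implicit Types (z w : R[i]) (r : R).

(* Real-valued, whereas [`|z|] is an element of [R[i]]. *)
Definition cmod z : R := Num.sqrt (cRe z ^+ 2 + cIm z ^+ 2).

Lemma cmodE z : `|z| = (cmod z)%:C%C.
Proof. exact: normc_def. Qed.

Lemma conjE z : z^* = conjc z.
Proof. by []. Qed.

Lemma cmod_ge0 z : 0 <= cmod z.
Proof. exact: sqrtr_ge0. Qed.

Lemma rcI : injective (real_complex R).
Proof. exact: complexI. Qed.

Lemma cmodM z w : cmod (z * w) = cmod z * cmod w.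
Proof. by apply: rcI; rewrite rmorphM/= -!cmodE normrM. Qed.

Lemma cmodD z w : cmod (z + w) <= cmod z + cmod w.
Proof. by rewrite -lecR rmorphD/= -!cmodE ler_normD. Qed.

Lemma cmodN z : cmod (- z) = cmod z.
Proof. by apply: rcI; rewrite -!cmodE normrN. Qed.

Lemma cmodB z w : cmod (z - w) <= cmod z + cmod w.
Proof. by rewrite -(cmodN w) cmodD. Qed.

Lemma cmodBC z w : cmod (z - w) = cmod (w - z).
Proof. by rewrite -cmodN opprB. Qed.

Lemma cmodBr z w : cmod z - cmod w <= cmod (z - w).
Proof. by rewrite lerBlDr -{1}(subrK w z) cmodD. Qed.

Lemma cmod_lip z w : `|cmod z - cmod w| <= cmod (z - w).
Proof. by rewrite ler_norml lerNl opprB {1}cmodBC !cmodBr. Qed.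

Lemma cmod0 : cmod 0 = 0.
Proof. by apply: rcI; rewrite -cmodE normr0. Qed.

Lemma cmod1 : cmod 1 = 1.
Proof. by apply: rcI; rewrite -cmodE normr1. Qed.

Lemma cmod_eq0 z : (cmod z == 0) = (z == 0).
Proof. by rewrite -(inj_eq rcI) -cmodE normr_eq0. Qed.

Lemma cmod_gt0 z : (0 < cmod z) = (z != 0).
Proof. by rewrite lt_def cmod_ge0 andbT cmod_eq0. Qed.

Lemma cmodX z n : cmod (z ^+ n) = cmod z ^+ n.
Proof. by apply: rcI; rewrite rmorphXn/= -!cmodE normrX. Qed.

Lemma cmodV z : cmod z^-1 = (cmod z)^-1.
Proof. by apply: rcI; rewrite fmorphV/= -!cmodE normfV. Qed.

Lemma cmod_real r : cmod r%:C%C = `|r|.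
Proof. by rewrite /cmod/= expr0n/= addr0 sqrtr_sqr. Qed.

Lemma cmod_conj z : cmod z^* = cmod z.
Proof. by apply: rcI; rewrite -!cmodE norm_conjC. Qed.

Lemma cmod_i : cmod ('i)%C = 1.
Proof. by rewrite /cmod/= expr0n/= add0r expr1n sqrtr1. Qed.

Lemma cmod_nat n : cmod n%:R = n%:R.
Proof. by apply: rcI; rewrite -cmodE normr_nat rmorph_nat. Qed.

Lemma sqr_cmod z : cmod z ^+ 2 = cRe z ^+ 2 + cIm z ^+ 2.
Proof. by rewrite sqr_sqrtr// addr_ge0// sqr_ge0. Qed.

Lemma mul_conj z : z * z^* = (cmod z ^+ 2)%:C%C.
Proof. by rewrite rmorphXn/= -cmodE sqr_normc conjE. Qed.

Lemma ler_Re_cmod z : `|cRe z| <= cmod z.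
Proof.
by rewrite -sqrtr_sqr ler_wsqrtr// lerDl sqr_ge0.
Qed.

Lemma ler_Im_cmod z : `|cIm z| <= cmod z.
Proof.
by rewrite -sqrtr_sqr ler_wsqrtr// lerDr sqr_ge0.
Qed.

Lemma cmod_le z : cmod z <= `|cRe z| + `|cIm z|.
Proof.
rewrite -[leLHS]ger0_norm ?cmod_ge0// -ler_sqr ?nnegrE ?addr_ge0//.
rewrite real_normK ?num_real// sqr_cmod sqrrD !real_normK ?num_real//.
by rewrite lerD2r lerDl mulrn_wge0// mulr_ge0.
Qed.

Lemma cmod_sum (I : Type) (s : seq I) (P : pred I) (F : I -> R[i]) :
  cmod (\sum_(i <- s | P i) F i) <= \sum_(i <- s | P i) cmod (F i).
Proof.
elim/big_rec2: _ => [|i y x _ le]; first by rewrite cmod0.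
by rewrite (le_trans (cmodD _ _))// lerD2l.
Qed.

Lemma cReD z w : cRe (z + w) = cRe z + cRe w.
Proof. by case: z w => ? ? []. Qed.
Lemma cImD z w : cIm (z + w) = cIm z + cIm w.
Proof. by case: z w => ? ? []. Qed.
Lemma cReB z w : cRe (z - w) = cRe z - cRe w.
Proof. by case: z w => ? ? []. Qed.
Lemma cImB z w : cIm (z - w) = cIm z - cIm w.
Proof. by case: z w => ? ? []. Qed.
Lemma cReM z w : cRe (z * w) =
  cRe z * cRe w - cIm z * cIm w.
Proof. by case: z w => ? ? []. Qed.
Lemma cImM z w : cIm (z * w) =
  cRe z * cIm w + cIm z * cRe w.
Proof. by case: z w => ? ? []. Qed.
Lemma cRe_sum n (F : nat -> R[i]) :
  cRe (\sum_(k < n) F k) = \sum_(k < n) cRe (F k).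
Proof. by elim: n => [|n IH]; rewrite ?big_ord0// !big_ord_recr/= cReD IH. Qed.
Lemma cIm_sum n (F : nat -> R[i]) :
  cIm (\sum_(k < n) F k) = \sum_(k < n) cIm (F k).
Proof. by elim: n => [|n IH]; rewrite ?big_ord0// !big_ord_recr/= cImD IH. Qed.

Lemma small_eq0 z : (forall e : R, 0 < e -> cmod z <= e) -> z = 0.
Proof.
move=> h; apply/eqP; rewrite -cmod_eq0 eq_le cmod_ge0 andbT.
by apply/ler_addgt0Pr => e e0; rewrite add0r; exact: h.
Qed.

End Modulus.

(** * Geometrically dominated complex series and their Cauchy products *)

Section GeometricSeries.
Context {R : realType}.
Implicit Types (x y : nat -> R[i]) (s t : R[i]).

Lemma half_pow_small (e : R) : 0 < e ->
  exists N, forall n, (N <= n)%N -> 2^-1 ^+ n <= e.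
Proof.
move=> e0.
have := @cvg_geometric R 1 2^-1; rewrite ger0_norm ?invr_ge0// invf_lt1// ltr1n.
move=> /(_ isT) /cvgrPdist_le/(_ _ e0)[N _ h]; exists N => n /h /=.
by rewrite sub0r normrN/= mul1r ger0_norm// exprn_ge0.
Qed.

Lemma half_sum_tail m n :
  \sum_(m <= k < m + n) (2^-1 : R) ^+ k <= 2 * 2^-1 ^+ m.
Proof.
suff -> : \sum_(m <= k < m + n) (2^-1 : R) ^+ k =
    2 * 2^-1 ^+ m - 2 * 2^-1 ^+ (m + n).
  by rewrite gerBl mulr_ge0// exprn_ge0.
elim: n => [|n IH]; first by rewrite addn0 big_geq// subrr.
by rewrite addnS big_nat_recr ?leq_addr//= IH exprS; field.
Qed.

Lemma real_geo_series (a : nat -> R) (K : R) :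
  (forall n, `|a n| <= K * 2^-1 ^+ n) ->
  forall N, `|limn (series a) - \sum_(k < N) a k| <= 2 * K * 2^-1 ^+ N.
Proof.
move=> aK.
have cva : cvgn (series a).
  apply: normed_cvg.
  apply: (@series_le_cvg _ _ (geometric K 2^-1)) => /=.
  - by move=> n; exact: normr_ge0.
  - by move=> n; apply: le_trans (aK n); exact: normr_ge0.
  - by move=> n; exact: aK.
  - by apply: is_cvg_geometric_series; rewrite ger0_norm ?invr_ge0// invf_lt1// ltr1n.
have K0 : 0 <= K by have := aK 0; rewrite expr0 mulr1; apply: le_trans.
move=> N.
have h : (fun n => `|series a n - \sum_(k < N) a k|) @ \oo -->
     `|limn (series a) - \sum_(k < N) a k|.
  by apply: cvg_norm; apply: cvgB => //; exact: cvg_cst.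
rewrite -(cvg_lim _ h)//; apply: limr_le; first by apply/cvg_ex; eexists; exact: h.
near=> n.
have Nn : (N <= n)%N by near: n; exists N.
rewrite -(big_mkord xpredT a) sub_series_geq//.
apply: (le_trans (ler_norm_sum _ _ _)).
apply: (@le_trans _ _ (K * \sum_(N <= k < n) 2^-1 ^+ k)).
  by rewrite mulr_sumr; apply: ler_sum => i _; exact: aK.
rewrite -(subnKC Nn) -mulrA mulrCA ler_wpM2l//.
exact: half_sum_tail.
Unshelve. all: by end_near.
Qed.

(** Convergence in epsilon form, over the real modulus [cmod]; the power series calculus thus stays
    clear of the topology of [R[i]], whose radii are themselves complex. *)
Definition csums x s := forall e : R, 0 < e ->
  exists N, forall n, (N <= n)%N -> cmod (s - \sum_(k < n) x k) <= e.

(** A total sum, with an arbitrary value unless the series of real and of imaginary parts converge;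
    it is meaningful under a geometric bound, by [csum_geo]. *)
Definition csum x : R[i] :=
  Complex (limn (series (fun n => cRe (x n))))
          (limn (series (fun n => cIm (x n)))).

(** The 4 is a 2 for the tail of the geometric series times a 2 for adding real and imaginary
    parts. *)
Lemma csum_tail x (K : R) : (forall n, cmod (x n) <= K * 2^-1 ^+ n) ->
  forall N, cmod (csum x - \sum_(k < N) x k) <= 4 * K * 2^-1 ^+ N.
Proof.
move=> xK N; apply: (le_trans (cmod_le _)).
rewrite cReB cImB cRe_sum cIm_sum /=.
have -> : 4 * K * 2^-1 ^+ N = 2 * K * 2^-1 ^+ N + 2 * K * 2^-1 ^+ N.
  by ring.
apply: lerD.
  by apply: (@real_geo_series (fun n => cRe (x n))) => n; exact: le_trans (ler_Re_cmod _) (xK n).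
by apply: (@real_geo_series (fun n => cIm (x n))) => n; exact: le_trans (ler_Im_cmod _) (xK n).
Qed.

Lemma geo_le_csums x s (K : R) :
  (forall N, cmod (s - \sum_(k < N) x k) <= K * 2^-1 ^+ N) -> csums x s.
Proof.
move=> h e e0.
have K0 : 0 <= K by have := h 0%N; rewrite expr0 mulr1; apply: le_trans; exact: cmod_ge0.
have K1 : 0 < K + 1 by rewrite ltr_wpDl.
have [N hN] := @half_pow_small (e / (K + 1)) (divr_gt0 e0 K1).
exists N => n /hN; rewrite ler_pdivlMr// => hn.
apply: (le_trans (h n)); rewrite mulrC; apply: le_trans hn.
by rewrite ler_wpM2l ?exprn_ge0 ?invr_ge0// lerDl.
Qed.

Lemma csum_geo x (K : R) : (forall n, cmod (x n) <= K * 2^-1 ^+ n) ->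
  csums x (csum x).
Proof. by move=> /csum_tail/geo_le_csums. Qed.

Lemma csums_unique x s t : csums x s -> csums x t -> s = t.
Proof.
move=> xs xt; apply/eqP; rewrite -subr_eq0; apply/eqP/small_eq0 => e e0.
have e2 : 0 < e / 2 by rewrite divr_gt0.
have [N hN] := xs _ e2; have [M hM] := xt _ e2.
have := hN (maxn N M) (leq_maxl _ _); have := hM (maxn N M) (leq_maxr _ _).
set S := \sum_(_ < _) _ => h1 h2.
rewrite (_ : s - t = (s - S) - (t - S)); last by ring.
by apply: (le_trans (cmodB _ _)); lra.
Qed.

Lemma csums_tail x s (K : R) : csums x s ->
  (forall n, cmod (x n) <= K * 2^-1 ^+ n) ->
  forall N, cmod (s - \sum_(k < N) x k) <= 4 * K * 2^-1 ^+ N.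
Proof.
by move=> xs xK; rewrite (csums_unique xs (csum_geo xK)); exact: csum_tail.
Qed.

Lemma eq_csums x y s : x =1 y -> csums x s -> csums y s.
Proof. by move=> /funext ->. Qed.

Lemma csumsD x y s t : csums x s -> csums y t ->
  csums (fun n => x n + y n) (s + t).
Proof.
move=> xs yt e e0; have e2 : 0 < e / 2 by rewrite divr_gt0.
have [N hN] := xs _ e2; have [M hM] := yt _ e2.
exists (maxn N M) => n; rewrite geq_max => /andP[/hN h1 /hM h2].
rewrite big_split/= opprD addrACA; apply: (le_trans (cmodD _ _)); lra.
Qed.

Lemma csumsZ x s c : csums x s -> csums (fun n => c * x n) (c * s).
Proof.
move=> xs e e0; have c1 : 0 < cmod c + 1 by rewrite ltr_wpDl// cmod_ge0.
have [N hN] := xs _ (divr_gt0 e0 c1); exists N => n /hN.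
rewrite -mulr_sumr -mulrBr cmodM ler_pdivlMr// => h.
apply: le_trans h; rewrite mulrC ler_wpM2l ?cmod_ge0// lerDl//.
Qed.

Lemma csumsN x s : csums x s -> csums (fun n => - x n) (- s).
Proof.
by move=> /(csumsZ (-1)); rewrite mulN1r; apply: eq_csums => n; rewrite mulN1r.
Qed.

Lemma csums_conj x s : csums x s -> csums (fun n => (x n)^*) s^*.
Proof.
move=> xs e /xs[N hN]; exists N => n /hN.
by rewrite -rmorph_sum -rmorphB cmod_conj.
Qed.

Definition conv x y n : R[i] := \sum_(k < n.+1) x k * y (n - k)%N.

Lemma sum_conv x y N :
  \sum_(n < N) conv x y n = \sum_(k < N) x k * \sum_(j < N - k) y j.
Proof.
elim: N => [|N IH]; first by rewrite !big_ord0.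
rewrite big_ord_recr/= IH [RHS]big_ord_recr/= subSnn big_ord1.
rewrite /conv [in X in _ + X]big_ord_recr/= subnn addrA; congr +%R.
rewrite -big_split/=; apply: eq_bigr => k _.
by rewrite subSn ?(ltnW (ltn_ord k))// big_ord_recr/= -mulrDr.
Qed.

(** The error of the partial sums consists of the products of [x k] with the tail of [y] from N - k
    on. Ratio 1/4 against ratio 1/2 bounds them by a multiple of 2^-N 2^-k, summable in k; equal
    ratios would leave a factor N. *)
Lemma csums_conv x y s t (K L : R) :
  (forall n, cmod (x n) <= K * 4^-1 ^+ n) ->
  (forall n, cmod (y n) <= L * 2^-1 ^+ n) ->
  csums x s -> csums y t -> csums (conv x y) (s * t).
Proof.
move=> xK yL xs yt.
have K0 : 0 <= K by have := xK 0; rewrite expr0 mulr1; apply: le_trans; exact: cmod_ge0.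
have L0 : 0 <= L by have := yL 0; rewrite expr0 mulr1; apply: le_trans; exact: cmod_ge0.
have xK2 n : cmod (x n) <= K * 2^-1 ^+ n.
  apply: (le_trans (xK n)); rewrite ler_wpM2l//.
  by apply: lerXn2r; rewrite ?nnegrE ?invr_ge0// lef_pV2 ?posrE// ler_nat.
apply: (@geo_le_csums _ _ (4 * K * cmod t + 8 * K * L)) => N.
rewrite sum_conv.
have -> : s * t - \sum_(k < N) x k * (\sum_(j < N - k) y j) =
    (s - \sum_(k < N) x k) * t + \sum_(k < N) x k * (t - \sum_(j < N - k) y j).
  rewrite mulrBl -addrA; congr +%R.
  under [X in _ = _ + X]eq_bigr do rewrite mulrBr.
  by rewrite sumrB mulr_suml addKr.
apply: (le_trans (cmodD _ _)); rewrite [leRHS]mulrDl; apply: lerD.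
  rewrite cmodM -mulrA [cmod t * _]mulrC mulrA ler_wpM2r ?cmod_ge0//.
  exact: csums_tail.
apply: (le_trans (cmod_sum _ _ _)).
apply: (@le_trans _ _ (\sum_(k < N) 4 * K * L * 2^-1 ^+ N * 2^-1 ^+ k)).
  apply: ler_sum => k _; rewrite cmodM.
  apply: (@le_trans _ _ ((K * 4^-1 ^+ k) * (4 * L * 2^-1 ^+ (N - k)))).
    apply: ler_pM; rewrite ?cmod_ge0//.
    exact: csums_tail.
  have -> : (4 : R)^-1 = 2^-1 * 2^-1 by field.
  have -> : (2^-1 : R) ^+ N = 2^-1 ^+ (N - k) * 2^-1 ^+ k.
    by rewrite -exprD subnK// ltnW.
  by rewrite exprMn; apply: eq_ler; ring.
rewrite -mulr_sumr.
have := half_sum_tail 0 N; rewrite add0n expr0 mulr1 big_mkord => h.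
apply: le_trans (_ : _ <= 4 * K * L * 2^-1 ^+ N * 2) _.
  by rewrite ler_wpM2l// !mulr_ge0// exprn_ge0.
by apply: eq_ler; ring.
Qed.

End GeometricSeries.

(** * Power series of infinite radius of convergence *)

Section PowerSeries.
Context {R : realType}.
Implicit Types (a b x : nat -> R[i]) (s t z : R[i]).

Lemma csums_bounded x s : csums x s -> exists K : R, forall n, cmod (x n) <= K.
Proof.
move=> /(_ 1 ltr01)[N hN]; exists (\sum_(k < N) cmod (x k) + 2) => n.
have [Nn|nN] := leqP N n.
  have h1 := hN _ Nn; have := hN _ (leqW Nn).
  rewrite big_ord_recr/= => h2.
  have -> : x n = (s - \sum_(k < n) x k) - (s - (\sum_(k < n) x k + x n)) by ring.
  apply: (le_trans (cmodB _ _)).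
  have : 0 <= \sum_(k < N) cmod (x k) by apply: sumr_ge0 => k _; exact: cmod_ge0.
  by lra.
rewrite (bigD1 (Ordinal nN))//= -addrA lerDl addr_ge0//.
by apply: sumr_ge0 => k _; exact: cmod_ge0.
Qed.

(** Infinite radius of convergence in the form of Cauchy estimates. Enlarging [r] by a factor b
    turns boundedness into domination of ratio 1/b, see [entire_coef_geo]. *)
Definition entire_coef a := forall r : R, 0 < r ->
  exists K : R, forall n, cmod (a n) * r ^+ n <= K.

Lemma entire_coef_geo a z (b : R) : entire_coef a -> 0 < b ->
  exists K : R, forall n, cmod (z ^+ n * a n) <= K * b^-1 ^+ n.
Proof.
move=> ha b0; have r0 : 0 < b * (cmod z + 1) by rewrite mulr_gt0// ltr_wpDl// cmod_ge0.
have [K hK] := ha _ r0; exists K => n.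
rewrite exprVn ler_pdivlMr ?exprn_gt0//; apply: le_trans (hK n).
rewrite cmodM cmodX [cmod z ^+ _ * _]mulrC -mulrA ler_wpM2l ?cmod_ge0//.
rewrite exprMn mulrC ler_wpM2l ?exprn_ge0 ?(ltW b0)//.
by apply: lerXn2r; rewrite ?nnegrE ?addr_ge0 ?cmod_ge0// lerDl.
Qed.

Lemma entire_coef_csums a z : entire_coef a ->
  csums (fun n => z ^+ n * a n) (csum (fun n => z ^+ n * a n)).
Proof.
move=> ha; have [K hK] := @entire_coef_geo a z 2 ha (ltr0Sn _ _).
by apply: (@csum_geo _ _ K).
Qed.

Lemma csums_entire_coef a :
  (forall z, exists s, csums (fun n => z ^+ n * a n) s) -> entire_coef a.
Proof.
move=> ha r r0; have [s /csums_bounded[K hK]] := ha r%:C%C; exists K => n.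
by have /= := hK n; rewrite cmodM cmodX cmod_real ger0_norm ?(ltW r0)// [r ^+ n * _]mulrC.
Qed.

Lemma conv_pow a b z n :
  conv (fun n => z ^+ n * a n) (fun n => z ^+ n * b n) n = z ^+ n * conv a b n.
Proof.
rewrite /conv mulr_sumr; apply: eq_bigr => k _.
rewrite mulrACA -exprD subnKC ?mulrA//.
by rewrite -ltnS.
Qed.

Lemma csums_conv_pow a b s t z : entire_coef a -> entire_coef b ->
  csums (fun n => z ^+ n * a n) s -> csums (fun n => z ^+ n * b n) t ->
  csums (fun n => z ^+ n * conv a b n) (s * t).
Proof.
move=> ha hb hs ht.
have [K hK] := @entire_coef_geo a z 4 ha (ltr0Sn _ _).
have [L hL] := @entire_coef_geo b z 2 hb (ltr0Sn _ _).
by apply: eq_csums (csums_conv hK hL hs ht) => n; exact: conv_pow.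
Qed.

Lemma entire_coef_conv a b : entire_coef a -> entire_coef b -> entire_coef (conv a b).
Proof.
move=> ha hb; apply: csums_entire_coef => z; eexists.
by apply: csums_conv_pow => //; exact: entire_coef_csums.
Qed.

(** Identity theorem on a real interval, by strong induction: once the lower coefficients vanish,
    the term of degree n is the sum of the later ones, up to the sign. Boundedness of the terms at
    one point x0 shows that at x0 t these are smaller by a factor t, and t tends to 0. *)
Lemma csums_real_eq0 a (r : R) : 0 < r ->
  (forall x : R, 0 < x < r -> csums (fun n => x%:C%C ^+ n * a n) 0) ->
  forall n, a n = 0.
Proof.
move=> r0 h; have [x0 x0r] : exists x0 : R, 0 < x0 < r by exists (r / 2); lra.
have x00 : 0 < x0 by case/andP: x0r.
have [M hM] := csums_bounded (h _ x0r).
have M0 : 0 <= M by apply: le_trans (hM 0%N); exact: cmod_ge0.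
have {}hM k : cmod (a k) * x0 ^+ k <= M.
  by have /= := hM k; rewrite cmodM cmodX cmod_real ger0_norm ?(ltW x00)// [x0 ^+ k * _]mulrC.
elim/ltn_ind => n IH.
suff H (t : R) : 0 < t <= 2^-1 -> cmod (a n) * x0 ^+ n <= 2 * M * t.
  apply/eqP; rewrite -cmod_eq0 eq_le cmod_ge0 andbT.
  rewrite -(@pmulr_lle0 _ (x0 ^+ n)) ?exprn_gt0//.
  apply/ler_addgt0Pr => e e0; rewrite add0r.
  (* The bound 1/2 keeps the geometric tail below 2; the added 1 keeps the denominator positive when
     [M = 0]. *)
  pose t := Num.min 2^-1 (e / (2 * M + 1)).
  have d0 : 0 < 2 * M + 1 by rewrite ltr_wpDl// mulr_ge0.
  have t1 : t <= e / (2 * M + 1) by rewrite ge_min lexx orbT.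
  have t0 : 0 < t by rewrite lt_min invr_gt0 ltr0n/= divr_gt0.
  apply: (le_trans (H t _)); first by rewrite t0/= ge_min lexx.
  move: t1; rewrite ler_pdivlMr// => t1; apply: le_trans t1.
  by rewrite mulrC ler_wpM2l ?(ltW t0)// lerDl.
move=> /andP[t0 t2].
have xr : 0 < x0 * t < r.
  rewrite mulr_gt0//=; apply: (@le_lt_trans _ _ x0); last by case/andP: x0r.
  by rewrite ger_pMr// (le_trans t2)// invf_le1// ler1n.
rewrite -(@ler_pM2r _ (t ^+ n)) ?exprn_gt0//.
apply/ler_addgt0Pl => e e0.
have [N hN] := h _ xr _ e0.
pose m := maxn N n.+1.
have := hN m (leq_maxl _ _); rewrite sub0r cmodN.
rewrite -(big_mkord xpredT (fun k => (x0 * t)%:C%C ^+ k * a k)) (@big_cat_nat _ _ _ n)//=; last first.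
  by rewrite ltnW// leq_maxr.
rewrite big1_seq; last first.
  by move=> k /=; rewrite mem_index_iota => /andP[_ /IH ->]; rewrite mulr0.
rewrite add0r big_ltn ?leq_maxr//.
set S := \sum_(_ <= _ < _) _ => hS.
have SM : cmod S <= 2 * M * t * t ^+ n.
  apply: (le_trans (cmod_sum _ _ _)).
  apply: (@le_trans _ _ (\sum_(n.+1 <= k < m) M * (t ^+ n.+1 * 2^-1 ^+ (k - n.+1)))).
    apply: ler_sum_nat => k /andP[nk _].
    rewrite cmodM cmodX cmod_real ger0_norm; last by rewrite mulr_ge0 ?ltW.
    rewrite exprMn [leLHS](_ : _ = cmod (a k) * x0 ^+ k * t ^+ k); last by ring.
    apply: ler_pM; rewrite ?hM//.
    - by rewrite mulr_ge0 ?cmod_ge0// exprn_ge0// ltW.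
    - by rewrite exprn_ge0// ltW.
    have -> : t ^+ k = t ^+ n.+1 * t ^+ (k - n.+1) by rewrite -exprD subnKC.
    rewrite ler_wpM2l ?exprn_ge0 ?(ltW t0)//.
    by apply: lerXn2r; rewrite ?nnegrE ?(ltW t0).
  rewrite -mulr_sumr -mulr_sumr.
  have -> : \sum_(n.+1 <= i < m) (2^-1 : R) ^+ (i - n.+1) =
            \sum_(0 <= i < 0 + (m - n.+1)) 2^-1 ^+ i.
    by rewrite add0n -{1}[n.+1]add0n big_addn; apply: eq_bigr => i _; rewrite addnK.
  apply: (@le_trans _ _ (M * (t ^+ n.+1 * (2 * 2^-1 ^+ 0)))).
    by rewrite !ler_wpM2l ?exprn_ge0 ?(ltW t0)//; exact: half_sum_tail.
  by apply: eq_ler; rewrite exprS; ring.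
have -> : cmod (a n) * x0 ^+ n * t ^+ n = cmod ((x0 * t)%:C%C ^+ n * a n).
  rewrite cmodM cmodX cmod_real ger0_norm; last by rewrite mulr_ge0 ?ltW.
  by rewrite exprMn [RHS]mulrC mulrA.
rewrite -(addrK S (_ * a n)); apply: (le_trans (cmodB _ _)).
by apply: lerD.
Qed.

Lemma csums_real_inj a b (r : R) : 0 < r -> (forall x : R, 0 < x < r -> exists s,
    csums (fun n => x%:C%C ^+ n * a n) s /\ csums (fun n => x%:C%C ^+ n * b n) s) -> a =1 b.
Proof.
move=> r0 h n; apply/eqP; rewrite -subr_eq0; apply/eqP; move: n.
apply: (csums_real_eq0 r0) => x /h[s [ha hb]]; have := csumsD ha (csumsN hb).
by rewrite subrr; apply: eq_csums => k /=; rewrite mulrBr.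
Qed.

End PowerSeries.

(** * The complex exponential *)

Section ComplexExponential.
Context {R : realType}.
Implicit Types (z w : R[i]).

Lemma exp_coeff_le (r : R) n : 0 <= r -> r ^+ n / n`!%:R <= expR r.
Proof.
move=> r0; have nd : nondecreasing_seq (series (exp_coeff r)).
  by apply/nondecreasing_series => k _ _; exact: exp_coeff_ge0.
have := nondecreasing_cvgn_le nd (is_cvg_series_exp_coeff r) n.+1.
apply: le_trans; rewrite /series/= big_nat_recr//= lerDr.
by apply: sumr_ge0 => k _; exact: exp_coeff_ge0.
Qed.

(** A single term of the series of [expR (b * r)]: any geometric ratio can be reached at the price
    of a larger constant. *)
Lemma exp_coeff_geo (r b : R) n : 0 <= r -> 0 < b ->
  r ^+ n / n`!%:R <= expR (b * r) * b^-1 ^+ n.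
Proof.
move=> r0 b0; rewrite exprVn ler_pdivlMr ?exprn_gt0//.
have := exp_coeff_le n (mulr_ge0 (ltW b0) r0); apply: le_trans.
by apply: eq_ler; rewrite exprMn; ring.
Qed.

Definition cexp z := csum (fun n => z ^+ n / n`!%:R).

Lemma cmod_exp_coeff z n : cmod (z ^+ n / n`!%:R) = cmod z ^+ n / n`!%:R.
Proof. by rewrite cmodM cmodX cmodV cmod_nat. Qed.

Lemma csums_cexp z : csums (fun n => z ^+ n / n`!%:R) (cexp z).
Proof.
apply: (@csum_geo _ _ (expR (2 * cmod z))) => n.
by rewrite cmod_exp_coeff exp_coeff_geo// cmod_ge0.
Qed.

Lemma cexpD z w : cexp (z + w) = cexp z * cexp w.
Proof.
apply: (csums_unique (csums_cexp (z + w))).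
have hz n : cmod (z ^+ n / n`!%:R) <= expR (4 * cmod z) * 4^-1 ^+ n.
  by rewrite cmod_exp_coeff exp_coeff_geo// cmod_ge0.
have hw n : cmod (w ^+ n / n`!%:R) <= expR (2 * cmod w) * 2^-1 ^+ n.
  by rewrite cmod_exp_coeff exp_coeff_geo// cmod_ge0.
apply: eq_csums (csums_conv hz hw (csums_cexp z) (csums_cexp w)) => n.
rewrite /conv [z + w]addrC exprDn mulr_suml; apply: eq_bigr => k _.
have kn : (k <= n)%N by rewrite -ltnS.
have f0 j : (j`!%:R : R[i]) != 0 by rewrite pnatr_eq0 -lt0n fact_gt0.
rewrite -[_ *+ 'C(n, k)]mulr_natr -(bin_fact kn) !natrM.
have := f0 k; have := f0 (n - k)%N; have : ('C(n, k)%:R : R[i]) != 0.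
  by rewrite pnatr_eq0 -lt0n bin_gt0.
move: (_ `!%:R : R[i]) (_ `!%:R : R[i]) ('C(n, k)%:R : R[i]) => u v c c0 u0 v0.
by field; rewrite c0 u0 v0.
Qed.

Lemma cexp_real (r : R) : cexp r%:C%C = (expR r)%:C%C.
Proof.
have e n : (r%:C%C : R[i]) ^+ n / n`!%:R = (r ^+ n / n`!%:R)%:C%C.
  by rewrite rmorphM/= rmorphXn/= fmorphV/= rmorph_nat.
rewrite /cexp /csum; congr Complex.
  by rewrite /expR; congr (limn (series _)); apply/funext => n; rewrite e.
have -> : (fun n => cIm ((r%:C%C : R[i]) ^+ n / n`!%:R)) = fun=> 0.
  by apply/funext => n; rewrite e.
apply: cvg_lim => //.
have -> : series (fun=> (0 : R)) = fun=> 0 by apply/funext => n; rewrite /series/= big1.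
exact: cvg_cst.
Qed.

Lemma cexp0 : cexp 0 = 1.
Proof. by rewrite -[0 in LHS]/((0 : R)%:C%C) cexp_real expR0. Qed.

Lemma cexp_conj z : (cexp z)^* = cexp z^*.
Proof.
apply: (csums_unique (csums_conj (csums_cexp z))).
apply: eq_csums (csums_cexp z^*) => n.
by rewrite rmorphM/= rmorphXn/= fmorphV/= rmorph_nat.
Qed.

(** Without sines and cosines: |exp z|^2 = exp(z) exp(conj z) = exp(2 Re z). *)
Lemma cmod_cexp z : cmod (cexp z) = expR (cRe z).
Proof.
apply/eqP; rewrite -(@eqrXn2 _ 2) ?cmod_ge0 ?expR_ge0//; apply/eqP/rcI.
rewrite -mul_conj cexp_conj -cexpD.
have -> : z + z^* = (2 * cRe z)%:C%C.
  by rewrite conjE; case: z => a b; rewrite /= mulr2n mulrDl mul1r; congr Complex; rewrite /= ?subrr.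
by rewrite cexp_real expRM_natl.
Qed.

Lemma cexpM2 z : cexp (2 * z) = cexp z ^+ 2.
Proof. by rewrite mulr_natl mulr2n cexpD expr2. Qed.

End ComplexExponential.

(** * Complex differentiability and Cauchy's theorem *)

Section ComplexDifferentiability.
Context {R : realType}.
Implicit Types (f g : R[i] -> R[i]) (z w c : R[i]).

Definition ccont f z := forall e : R, 0 < e -> exists2 d : R, 0 < d &
  forall w, cmod (w - z) <= d -> cmod (f w - f z) <= e.

Lemma ccont_near f g z (d : R) : 0 < d ->
  (forall w, cmod (w - z) <= d -> f w = g w) -> ccont f z -> ccont g z.
Proof.
move=> d0 fg cf e /cf[d' d'0 h]; exists (Num.min d d'); first by rewrite lt_min d0.
move=> w; rewrite le_min => /andP[wd wd'].
by rewrite -(fg w wd) -(fg z) ?subrr ?cmod0 ?(ltW d0)//; exact: h.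
Qed.

Lemma ccont_cst c z : ccont (fun=> c) z.
Proof. by move=> e e0; exists 1 => // w _; rewrite subrr cmod0 ltW. Qed.

Lemma ccont_id z : ccont id z.
Proof. by move=> e e0; exists e. Qed.

Lemma ccont_bounded f z : ccont f z -> exists d M : R,
  [/\ 0 < d, 0 < M & forall w, cmod (w - z) <= d -> cmod (f w) <= M].
Proof.
move=> /(_ 1 ltr01)[d d0 h]; exists d, (cmod (f z) + 1); split => //.
  by rewrite ltr_wpDl// cmod_ge0.
move=> w /h h1; rewrite -[f w](subrK (f z)) addrC.
by apply: (le_trans (cmodD _ _)); rewrite lerD2l.
Qed.

Lemma ccontD f g z : ccont f z -> ccont g z -> ccont (fun w => f w + g w) z.
Proof.
move=> cf cg e e0; have e2 : 0 < e / 2 by rewrite divr_gt0.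
have [d d0 hd] := cf _ e2; have [d' d'0 hd'] := cg _ e2.
exists (Num.min d d'); first by rewrite lt_min d0.
move=> w; rewrite le_min => /andP[/hd h1 /hd' h2].
by rewrite opprD addrACA; apply: (le_trans (cmodD _ _)); lra.
Qed.

Lemma ccontM f g z : ccont f z -> ccont g z -> ccont (fun w => f w * g w) z.
Proof.
move=> cf cg e e0.
have [d0 [M [d00 M0 hM]]] := ccont_bounded cf.
have N0 : 0 < cmod (g z) + 1 by rewrite ltr_wpDl// cmod_ge0.
have e1 : 0 < e / 2 / (cmod (g z) + 1) by rewrite !divr_gt0.
have e2 : 0 < e / 2 / M by rewrite !divr_gt0.
have [d d_0 hd] := cf _ e1; have [d' d'0 hd'] := cg _ e2.
exists (Num.min d0 (Num.min d d')); first by rewrite !lt_min d00 d_0.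
move=> w; rewrite !le_min => /and3P[/hM h0 /hd h1 /hd' h2].
have -> : f w * g w - f z * g z = f w * (g w - g z) + (f w - f z) * g z by ring.
apply: (le_trans (cmodD _ _)); rewrite !cmodM.
have -> : e = M * (e / 2 / M) + e / 2 / (cmod (g z) + 1) * (cmod (g z) + 1).
  by field; rewrite !gt_eqF.
by apply: lerD; apply: ler_pM; rewrite ?cmod_ge0// lerDl.
Qed.

Lemma ccontV f z : f z != 0 -> ccont f z -> ccont (fun w => (f w)^-1) z.
Proof.
move=> fz0 cf e e0; have m0 : 0 < cmod (f z) by rewrite cmod_gt0.
pose m := cmod (f z).
have e1 : 0 < Num.min (m / 2) (e * (m * m / 2)).
  by rewrite lt_min divr_gt0//= mulr_gt0// divr_gt0// mulr_gt0.
have [d d0 h] := cf _ e1; exists d => // w /h; rewrite le_min => /andP[h1 h2].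
have h3 : m / 2 <= cmod (f w).
  have := cmodBr (f z) (f w); rewrite cmodBC -/m; lra.
have fw0 : f w != 0 by rewrite -cmod_gt0; apply: lt_le_trans h3; rewrite divr_gt0.
have -> : (f w)^-1 - (f z)^-1 = (f z - f w) / (f w * f z) by field; apply/andP.
rewrite cmodM cmodV cmodM ler_pdivrMr ?mulr_gt0 ?cmod_gt0// cmodBC.
apply: (le_trans h2); rewrite ler_wpM2l ?(ltW e0)// mulrAC ler_wpM2r//.
exact: ltW.
Qed.

Lemma ccont_conj f z : ccont f z^* -> ccont (sharp f) z.
Proof.
move=> cf e /cf[d d0 h]; exists d => // w wz.
by rewrite /sharp -rmorphB cmod_conj h// -rmorphB cmod_conj.
Qed.

(* Caratheodory's form of differentiability. *)
Definition cdiff f z := exists phi (d : R), [/\ 0 < d, ccont phi z &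
  forall w, cmod (w - z) <= d -> f w - f z = phi w * (w - z)].

Definition centire f := forall z, cdiff f z.

Lemma cdiff_ccont f z : cdiff f z -> ccont f z.
Proof.
move=> [phi [d [d0 cp h]]].
apply: (@ccont_near (fun w => f z + phi w * (w - z)) _ _ d d0) => [w /h <-|]; first by ring.
apply: ccontD; first exact: ccont_cst.
by apply: ccontM => //; apply: ccontD; [exact: ccont_id|exact: ccont_cst].
Qed.

Lemma cdiff_cst c z : cdiff (fun=> c) z.
Proof.
exists (fun=> 0), 1; split => //; first exact: ccont_cst.
by move=> w _; rewrite subrr mul0r.
Qed.

Lemma cdiff_id z : cdiff id z.
Proof.
exists (fun=> 1), 1; split => //; first exact: ccont_cst.
by move=> w _; rewrite mul1r.
Qed.

Lemma cdiffD f g z : cdiff f z -> cdiff g z -> cdiff (fun w => f w + g w) z.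
Proof.
move=> [phi [d [d0 cp hp]]] [gam [d' [d'0 cg hg]]].
exists (fun w => phi w + gam w), (Num.min d d'); split.
- by rewrite lt_min d0.
- exact: ccontD.
- move=> w; rewrite le_min => /andP[/hp h1 /hg h2].
  by rewrite opprD addrACA h1 h2 mulrDl.
Qed.

Lemma cdiffM f g z : cdiff f z -> cdiff g z -> cdiff (fun w => f w * g w) z.
Proof.
move=> df dg; move: (df) (dg) => [phi [d [d0 cp hp]]] [gam [d' [d'0 cg hg]]].
exists (fun w => phi w * g w + f z * gam w), (Num.min d d'); split.
- by rewrite lt_min d0.
- apply: ccontD; apply: ccontM => //; last exact: ccont_cst.
  exact: cdiff_ccont.
- move=> w; rewrite le_min => /andP[/hp h1 /hg h2].
  have -> : f w * g w - f z * g z = (f w - f z) * g w + f z * (g w - g z) by ring.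
  by rewrite h1 h2; ring.
Qed.

Lemma cdiffN f z : cdiff f z -> cdiff (fun w => - f w) z.
Proof.
move=> df; rewrite (_ : (fun w => - f w) = (fun w => -1 * f w)).
  by apply: cdiffM => //; exact: cdiff_cst.
by apply/funext => w; rewrite mulN1r.
Qed.

Lemma cdiffB f g z : cdiff f z -> cdiff g z -> cdiff (fun w => f w - g w) z.
Proof. by move=> df dg; apply: cdiffD => //; exact: cdiffN. Qed.

Lemma cdiffX f n z : cdiff f z -> cdiff (fun w => f w ^+ n) z.
Proof.
move=> df; elim: n => [|n IH]; first by under eq_fun do rewrite expr0; exact: cdiff_cst.
by under eq_fun do rewrite exprS; exact: cdiffM.
Qed.

Lemma cdiff_sum n (F : nat -> R[i] -> R[i]) z : (forall k, cdiff (F k) z) ->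
  cdiff (fun w => \sum_(k < n) F k w) z.
Proof.
move=> dF; elim: n => [|n IH].
  by under eq_fun do rewrite big_ord0; exact: cdiff_cst.
by under eq_fun do rewrite big_ord_recr/=; exact: cdiffD.
Qed.

Lemma cdiffV f z : f z != 0 -> cdiff f z -> cdiff (fun w => (f w)^-1) z.
Proof.
move=> fz0 df; have cf := cdiff_ccont df; move: df => [phi [d [d0 cp hp]]].
have m0 : 0 < cmod (f z) / 2 by rewrite divr_gt0// cmod_gt0.
have [d' d'0 h] := cf _ m0.
exists (fun w => - phi w * ((f w)^-1 * (f z)^-1)), (Num.min d d'); split.
- by rewrite lt_min d0.
- apply: ccontM.
    rewrite (_ : (fun w => - phi w) = (fun w => -1 * phi w)).
      by apply: ccontM => //; exact: ccont_cst.
    by apply/funext => w; rewrite mulN1r.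
  by apply: ccontM; [exact: ccontV|exact: ccont_cst].
- move=> w; rewrite le_min => /andP[/hp h1 /h h2].
  have fw0 : f w != 0.
    by apply: contraTneq h2 => ->; rewrite sub0r cmodN -ltNge; lra.
  have -> : (f w)^-1 - (f z)^-1 = - (f w - f z) * ((f w)^-1 * (f z)^-1).
    by field; apply/andP.
  by rewrite h1; ring.
Qed.

Lemma cdiff_sharp f z : cdiff f z^* -> cdiff (sharp f) z.
Proof.
move=> [phi [d [d0 cp hp]]]; exists (sharp phi), d; split => //.
  exact: ccont_conj.
move=> w wz; rewrite /sharp -rmorphB hp; last by rewrite -rmorphB cmod_conj.
by rewrite rmorphM rmorphB /= !conjCK.
Qed.

Lemma cdiff_approx f z : cdiff f z -> exists D, forall e : R, 0 < e ->
  exists2 d : R, 0 < d & forall w, cmod (w - z) <= d ->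
    cmod (f w - f z - D * (w - z)) <= e * cmod (w - z).
Proof.
move=> [phi [d [d0 cp hp]]]; exists (phi z) => e /cp[d' d'0 h].
exists (Num.min d d'); first by rewrite lt_min d0.
move=> w; rewrite le_min => /andP[/hp -> /h h1].
by rewrite -mulrBl cmodM ler_wpM2r ?cmod_ge0.
Qed.

Lemma approx_cdiff f z D : (forall e : R, 0 < e ->
  exists2 d : R, 0 < d & forall w, cmod (w - z) <= d ->
    cmod (f w - f z - D * (w - z)) <= e * cmod (w - z)) -> cdiff f z.
Proof.
move=> h; exists (fun w => if w == z then D else (f w - f z) / (w - z)), 1.
split => //.
- move=> e e0; have [d d0 hd] := h e e0; exists d => // w /hd; rewrite eqxx.
  case: eqP => [->|/eqP wz]; first by rewrite [D - D]subrr cmod0 => _; exact: ltW.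
  have wz0 : w - z != 0 by rewrite subr_eq0.
  have -> : f w - f z - D * (w - z) = ((f w - f z) / (w - z) - D) * (w - z) by field.
  by rewrite cmodM ler_pM2r// cmod_gt0.
- move=> w _; case: eqP => [->|/eqP wz]; first by rewrite !subrr mulr0.
  by rewrite divfK// subr_eq0.
Qed.

End ComplexDifferentiability.

(** * Complex integrals over segments *)

Section SegmentIntegral.
Context {R : realType}.
Notation mu := (@lebesgue_measure R).
Implicit Types (g h : R -> R[i]) (a b : R).

Definition rcint (g : R -> R) a b := (\int[mu]_(x in `[a, b]) g x)%R.

Definition cint g a b : R[i] :=
  Complex (rcint (fun x => cRe (g x)) a b) (rcint (fun x => cIm (g x)) a b).

Definition lint g a b := mu.-integrable `[a, b] (fun x => (cRe (g x))%:E) /\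
  mu.-integrable `[a, b] (fun x => (cIm (g x))%:E).

(** Continuity at the points of the segment as a function on the whole line: [s] may leave [[a, b]].
    The integrands are restrictions to a line of functions continuous at points of the plane, which
    provides exactly this. *)
Definition seg_cont g a b := forall t, a <= t <= b -> forall e : R, 0 < e ->
  exists2 d : R, 0 < d & forall s, `|s - t| <= d -> cmod (g s - g t) <= e.

Lemma continuous_integrable (f : R -> R) a b :
  (forall t, a <= t <= b -> {for t, continuous f}) ->
  mu.-integrable `[a, b] (EFin \o f).
Proof.
move=> h; apply: continuous_compact_integrable; first exact: segment_compact.
apply: continuous_in_subspaceT => t; rewrite inE/= in_itv/= => tab.
exact: h.
Qed.

Lemma seg_cont_lip (phi : R[i] -> R) g a b t :
  (forall z w, `|phi z - phi w| <= cmod (z - w)) -> seg_cont g a b -> a <= t <= b ->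
  {for t, continuous (fun s => phi (g s))}.
Proof.
move=> lip cg tab; apply/cvgrPdist_le => e e0; have [d d0 h] := cg _ tab _ e0.
near=> s; apply: (le_trans (lip _ _)); rewrite cmodBC.
apply: h; rewrite distrC; near: s; exact: cvgr_dist_le.
Unshelve. all: by end_near. Qed.

Lemma seg_cont_lint g a b : seg_cont g a b -> lint g a b.
Proof.
move=> cg; split; apply: continuous_integrable => t tab.
  by apply: (seg_cont_lip _ cg tab) => z w; rewrite -cReB ler_Re_cmod.
by apply: (seg_cont_lip _ cg tab) => z w; rewrite -cImB ler_Im_cmod.
Qed.

Lemma mitv a b : measurable (`[a, b]%classic : set (measurableTypeR R)).
Proof. exact: measurable_itv. Qed.
Hint Resolve mitv : core.

Lemma lintD g h a b : lint g a b -> lint h a b -> lint (fun x => g x + h x) a b.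
Proof.
move=> [g1 g2] [h1 h2]; split.
  rewrite (_ : (fun x => _) =
    (fun x => (cRe (g x))%:E) \+ (fun x => (cRe (h x))%:E))%E.
    exact: integrableD.
  by apply/funext => x; rewrite cReD.
rewrite (_ : (fun x => _) =
  (fun x => (cIm (g x))%:E) \+ (fun x => (cIm (h x))%:E))%E.
  exact: integrableD.
by apply/funext => x; rewrite cImD.
Qed.

Lemma cintD g h a b : lint g a b -> lint h a b ->
  cint (fun x => g x + h x) a b = cint g a b + cint h a b.
Proof.
move=> [g1 g2] [h1 h2]; apply/eqP; rewrite eq_complex/=; apply/andP; split; apply/eqP.
  by rewrite -RintegralD//; congr Rintegral; apply/funext => x; rewrite cReD.
by rewrite -RintegralD//; congr Rintegral; apply/funext => x; rewrite cImD.
Qed.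

Lemma lintZ g a b c : lint g a b -> lint (fun x => c * g x) a b.
Proof.
move=> [g1 g2]; split.
  rewrite (_ : (fun x => _) = (fun x => (cRe c)%:E * (cRe (g x))%:E) \-
      (fun x => (cIm c)%:E * (cIm (g x))%:E))%E.
    by apply: integrableB => //; exact: integrableZl.
  by apply/funext => x; rewrite cReM.
rewrite (_ : (fun x => _) = (fun x => (cRe c)%:E * (cIm (g x))%:E) \+
    (fun x => (cIm c)%:E * (cRe (g x))%:E))%E.
  by apply: integrableD => //; exact: integrableZl.
by apply/funext => x; rewrite cImM.
Qed.

Lemma cintZ g a b c : lint g a b -> cint (fun x => c * g x) a b = c * cint g a b.
Proof.
move=> [g1 g2]; have m := mitv a b.
have h (k : R) (f : R -> R) : mu.-integrable `[a, b] (EFin \o f) ->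
  mu.-integrable `[a, b] (EFin \o (fun x => k * f x)).
  by move=> /(@integrableZl _ _ _ _ _ m k).
apply/eqP; rewrite eq_complex cReM cImM/=; apply/andP; split; apply/eqP.
  rewrite /rcint -!RintegralZl// -RintegralB//; [|exact: h..].
  by congr Rintegral; apply/funext => x; rewrite cReM.
rewrite /rcint -!RintegralZl// -RintegralD//; [|exact: h..].
by congr Rintegral; apply/funext => x; rewrite cImM.
Qed.

Lemma rcint_cat (f : R -> R) a b c : a <= c -> c <= b ->
  mu.-integrable `[a, b] (EFin \o f) -> rcint f a b = rcint f a c + rcint f c b.
Proof.
move=> ac cb itf; apply/eqP; rewrite addrC -subr_eq; apply/eqP.
rewrite /rcint Rintegral_itvB ?bnd_simp//.
apply: Rintegral_itv_obnd_cbnd; apply: integrableS itf => //.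
by apply: subset_itvr; rewrite bnd_simp.
Qed.

Lemma cint_cat g a b c : a <= c -> c <= b -> lint g a b ->
  cint g a b = cint g a c + cint g c b.
Proof.
move=> ac cb [g1 g2]; apply/eqP; rewrite eq_complex/=.
by rewrite -!rcint_cat// !eqxx.
Qed.

Lemma lebesgue_itv a b : a <= b -> mu `[a, b]%classic = (b - a)%:E.
Proof.
move=> ab; have := @lebesgue_measure_itv R `[a, b]; rewrite /= lte_fin => ->.
have [//|ba] := ltP a b; have -> : a = b by apply: le_anti; rewrite ab.
by rewrite subrr.
Qed.

Lemma rcint_bound (f : R -> R) a b M : a <= b ->
  mu.-integrable `[a, b] (EFin \o f) ->
  (forall t, a <= t <= b -> `|f t| <= M) -> `|rcint f a b| <= M * (b - a).
Proof.
move=> ab itf h; apply: (le_trans (le_normr_Rintegral _ itf)) => //.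
have -> : M * (b - a) = (\int[mu]_(x in `[a, b]) M)%R.
  by rewrite Rintegral_cst//= lebesgue_itv.
have iM : mu.-integrable `[a, b] (EFin \o (fun=> M)).
  by apply: continuous_integrable => t _; exact: cvg_cst.
apply: (le_Rintegral (mitv a b) (integrable_norm itf) iM) => x /=.
by rewrite in_itv/=; exact: h.
Qed.

(** The factor 2 comes from bounding real and imaginary parts separately; it is inherited by all
    constants below. *)
Lemma cint_bound g a b M : a <= b -> lint g a b ->
  (forall t, a <= t <= b -> cmod (g t) <= M) -> cmod (cint g a b) <= 2 * M * (b - a).
Proof.
move=> ab [g1 g2] h; apply: (le_trans (cmod_le _)) => /=.
have -> : 2 * M * (b - a) = M * (b - a) + M * (b - a) by ring.
apply: lerD; apply: rcint_bound => // t /h; apply: le_trans.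
  exact: ler_Re_cmod.
exact: ler_Im_cmod.
Qed.

Lemma rcint_FTC (f F : R -> R) a b : a <= b ->
  (forall x : R, is_derive x 1 F (f x)) -> continuous f ->
  rcint f a b = F b - F a.
Proof.
move=> ab dF cf; rewrite /rcint; have [{}ab|ba] := ltP a b; last first.
  have -> : a = b by apply: le_anti; rewrite ab ba.
  by rewrite subrr set_itv1 Rintegral_set1.
have cF : continuous F by move=> x; apply: differentiable_continuous; apply/derivable1_diffP/ex_derive.
rewrite /Rintegral (@continuous_FTC2 _ f F)//.
- by apply: continuous_subspaceT.
- split; first by move=> x _; apply: ex_derive.
  + by apply: cvg_at_right_filter; exact: cF.
  + by apply: cvg_at_left_filter; exact: cF.
- by move=> x _; rewrite derive1E; apply: derive_val.
Qed.

Lemma rcint_affine (p q : R) a b : a <= b ->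
  rcint (fun x => p + q * x) a b = p * (b - a) + q * (b ^+ 2 - a ^+ 2) / 2.
Proof.
move=> ab; have dF (x : R) :
    is_derive x 1 (fun x : R => p * x + q * (x * x) / 2 : R) (p + q * x).
  by apply: is_derive_eq; rewrite /= /GRing.scale/=; field.
rewrite (rcint_FTC ab dF); first by field.
by move=> x; apply: continuousD; [exact: cvg_cst|apply: continuousM => //; exact: cvg_cst].
Qed.

Lemma cint_affine (p q : R[i]) a b : a <= b ->
  cint (fun x => p + q * x%:C%C) a b =
  p * (b - a)%:C%C + q * ((b ^+ 2 - a ^+ 2) / 2)%:C%C.
Proof.
move=> ab; case: p q => [p1 p2] [q1 q2].
rewrite /cint; apply/eqP; rewrite eq_complex/=; apply/andP; split; apply/eqP.
  transitivity (rcint (fun x => p1 + q1 * x) a b).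
    by congr rcint; apply/funext => x; rewrite /=; ring.
  by rewrite rcint_affine//; ring.
transitivity (rcint (fun x => p2 + q2 * x) a b).
  by congr rcint; apply/funext => x; rewrite /=; ring.
by rewrite rcint_affine//; ring.
Qed.

End SegmentIntegral.

(** * Goursat's theorem for rectangles *)

Section Goursat.
Context {R : realType}.
Implicit Types (f g : R[i] -> R[i]) (z w : R[i]) (a b c d : R).

Lemma ccont_seg_h f a b y : (forall t, a <= t <= b -> ccont f (Complex t y)) ->
  seg_cont (fun x => f (Complex x y)) a b.
Proof.
move=> cf t /cf h e /h[d d0 hd]; exists d => // s st; apply: hd.
by rewrite /cmod /= subrr expr0n/= addr0 sqrtr_sqr.
Qed.

Lemma ccont_seg_v f a b x : (forall t, a <= t <= b -> ccont f (Complex x t)) ->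
  seg_cont (fun y => f (Complex x y)) a b.
Proof.
move=> cf t /cf h e /h[d d0 hd]; exists d => // s st; apply: hd.
by rewrite /cmod /= subrr expr0n/= add0r sqrtr_sqr.
Qed.

(** The integral of f(z) dz counterclockwise along the boundary of [a, b] x [c, d], with dz = i dy
    on the vertical sides. *)
Definition rect f a b c d : R[i] :=
  cint (fun x => f (Complex x c)) a b + Complex 0 1 * cint (fun y => f (Complex b y)) c d
  - cint (fun x => f (Complex x d)) a b - Complex 0 1 * cint (fun y => f (Complex a y)) c d.

Definition rlint f a b c d :=
  [/\ lint (fun x => f (Complex x c)) a b, lint (fun x => f (Complex x d)) a b,
      lint (fun y => f (Complex a y)) c d & lint (fun y => f (Complex b y)) c d].

Lemma ccont_rlint f a b c d : a <= b -> c <= d ->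
  (forall x y, a <= x <= b -> c <= y <= d -> (x == a) || (x == b) || (y == c) || (y == d) ->
    ccont f (Complex x y)) -> rlint f a b c d.
Proof.
move=> ab cd h; split; apply: seg_cont_lint.
- by apply: ccont_seg_h => t tab; apply: h; rewrite ?lexx ?cd ?eqxx ?orbT.
- by apply: ccont_seg_h => t tab; apply: h; rewrite ?lexx ?cd ?eqxx ?orbT.
- by apply: ccont_seg_v => t tab; apply: h; rewrite ?lexx ?ab ?eqxx ?orbT.
- by apply: ccont_seg_v => t tab; apply: h; rewrite ?lexx ?ab ?eqxx ?orbT.
Qed.

Lemma rlintD f g a b c d : rlint f a b c d -> rlint g a b c d ->
  rlint (fun z => f z + g z) a b c d.
Proof. by move=> [? ? ? ?] [? ? ? ?]; split; exact: lintD. Qed.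

Lemma rlintZ f a b c d k : rlint f a b c d -> rlint (fun z => k * f z) a b c d.
Proof. by move=> [? ? ? ?]; split; exact: lintZ. Qed.

Lemma rectD f g a b c d : rlint f a b c d -> rlint g a b c d ->
  rect (fun z => f z + g z) a b c d = rect f a b c d + rect g a b c d.
Proof.
move=> [? ? ? ?] [? ? ? ?]; rewrite /rect !cintD//; ring.
Qed.

Lemma rectZ f a b c d k : rlint f a b c d ->
  rect (fun z => k * f z) a b c d = k * rect f a b c d.
Proof.
move=> [? ? ? ?]; rewrite /rect !cintZ//; ring.
Qed.

Lemma rect_sum n (F : nat -> R[i] -> R[i]) a b c d :
  (forall k, rlint (F k) a b c d) ->
  rlint (fun z => \sum_(k < n) F k z) a b c d /\
  rect (fun z => \sum_(k < n) F k z) a b c d = \sum_(k < n) rect (F k) a b c d.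
Proof.
move=> h; elim: n => [|n [IH1 IH2]].
  have z : rlint (fun=> 0 : R[i]) a b c d.
    by have := rlintZ 0 (h 0%N); under eq_fun do rewrite mul0r.
  under eq_fun do rewrite big_ord0; split => //; rewrite big_ord0.
  rewrite (_ : (fun=> 0) = (fun z : R[i] => 0 * (fun=> 0) z)); last first.
    by apply/funext => x; rewrite mul0r.
  by rewrite rectZ// mul0r.
under eq_fun do rewrite big_ord_recr/=; split; first exact: rlintD.
by rewrite rectD// IH2 big_ord_recr.
Qed.

Lemma cmodci z : cmod (Complex 0 1 * z) = cmod z.
Proof. by rewrite cmodM cmod_i mul1r. Qed.

Lemma rect_bound f a b c d (M : R) : a <= b -> c <= d -> rlint f a b c d ->
  (forall x y, a <= x <= b -> c <= y <= d -> (x == a) || (x == b) || (y == c) || (y == d) ->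
    cmod (f (Complex x y)) <= M) ->
  cmod (rect f a b c d) <= 4 * M * ((b - a) + (d - c)).
Proof.
move=> ab cd [h1 h2 h3 h4] hM.
have b1 : cmod (cint (fun x => f (Complex x c)) a b) <= 2 * M * (b - a).
  by apply: cint_bound => // t tab; apply: hM; rewrite ?lexx ?cd ?eqxx ?orbT.
have b2 : cmod (cint (fun x => f (Complex x d)) a b) <= 2 * M * (b - a).
  by apply: cint_bound => // t tab; apply: hM; rewrite ?lexx ?cd ?eqxx ?orbT.
have b3 : cmod (cint (fun y => f (Complex a y)) c d) <= 2 * M * (d - c).
  by apply: cint_bound => // t tab; apply: hM; rewrite ?lexx ?ab ?eqxx ?orbT.
have b4 : cmod (cint (fun y => f (Complex b y)) c d) <= 2 * M * (d - c).
  by apply: cint_bound => // t tab; apply: hM; rewrite ?lexx ?ab ?eqxx ?orbT.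
rewrite /rect; apply: (le_trans (cmodB _ _)); rewrite cmodci.
have := cmodB (cint (fun x => f (Complex x c)) a b + Complex 0 1 * cint (fun y => f (Complex b y)) c d)
  (cint (fun x => f (Complex x d)) a b).
have := cmodD (cint (fun x => f (Complex x c)) a b) (Complex 0 1 * cint (fun y => f (Complex b y)) c d).
rewrite cmodci; lra.
Qed.

Lemma rect_affine (p q : R[i]) a b c d : a <= b -> c <= d ->
  rect (fun z => p + q * z) a b c d = 0.
Proof.
move=> ab cd; rewrite /rect.
have h y : cint (fun x => p + q * Complex x y) a b =
   (p + q * Complex 0 y) * (b - a)%:C%C + q * ((b ^+ 2 - a ^+ 2) / 2)%:C%C.
  rewrite -cint_affine//; congr cint; apply/funext => x.
  by rewrite -addrA -mulrDr; congr (_ + _ * _); apply/eqP; rewrite eq_complex/= add0r addr0 !eqxx.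
have v x : cint (fun y => p + q * Complex x y) c d =
   (p + q * x%:C%C) * (d - c)%:C%C + (q * Complex 0 1) * ((d ^+ 2 - c ^+ 2) / 2)%:C%C.
  rewrite -cint_affine//; congr cint; apply/funext => y.
  rewrite -addrA -mulrA -mulrDr; congr (_ + _ * _); apply/eqP; rewrite eq_complex/=.
  by apply/andP; split; apply/eqP; ring.
rewrite !h !v; case: p q {h v} => [p1 p2] [q1 q2].
by apply/eqP; rewrite eq_complex/=; apply/andP; split; apply/eqP; field.
Qed.

Lemma rect_vsplit f a b c d e : a <= e -> e <= b ->
  lint (fun x => f (Complex x c)) a b -> lint (fun x => f (Complex x d)) a b ->
  rect f a b c d = rect f a e c d + rect f e b c d.
Proof. by move=> ae eb h1 h2; rewrite /rect !(cint_cat ae eb)//; ring. Qed.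

Lemma rect_hsplit f a b c d e : c <= e -> e <= d ->
  lint (fun y => f (Complex a y)) c d -> lint (fun y => f (Complex b y)) c d ->
  rect f a b c d = rect f a b c e + rect f a b e d.
Proof. by move=> ae eb h1 h2; rewrite /rect !(cint_cat ae eb)//; ring. Qed.

Lemma nested_intervals (u v : nat -> R) :
  (forall n, u n <= u n.+1) -> (forall n, v n.+1 <= v n) -> (forall n, u n <= v n) ->
  exists x, forall n, u n <= x <= v n.
Proof.
move=> hu hv huv.
have u_le m n : (m <= n)%N -> u m <= u n by move=> mn; exact: (homo_leq _ le_trans).
have v_le m n : (m <= n)%N -> v n <= v m.
  by elim: n => [|n IH]; rewrite leq_eqVlt => /orP[/eqP->//|]// /IH; apply: le_trans.
have uv m n : u m <= v n.
  apply: le_trans (v_le _ _ (leq_maxr m n)); apply: le_trans (huv _).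
  by apply: u_le; exact: leq_maxl.
have hs : has_sup (range u).
  by split; [exists (u 0%N), 0%N | exists (v 0%N) => _ [n _ <-]].
exists (sup (range u)) => n; apply/andP; split.
  by apply: ub_le_sup; [case: hs|exists n].
by apply: ge_sup; [case: hs|move=> _ [m _ <-]].
Qed.

(** Bisection. The threshold defining a bad rectangle is quadratic in its size, so one of the four
    quarters of a bad rectangle is bad again. At the common point of the nested rectangles [f] is
    affine up to a small relative error; the affine part integrates to 0 and the error contradicts
    badness. *)
Lemma goursat f a b c d : a <= b -> c <= d ->
  (forall x y, a <= x <= b -> c <= y <= d -> cdiff f (Complex x y)) ->
  rect f a b c d = 0.
Proof.
move=> ab cd df; apply: small_eq0 => e0 e00; rewrite leNgt; apply/negP => bad.
pose A := b - a; pose B := d - c.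
have A0 : 0 <= A by rewrite subr_ge0.
have B0 : 0 <= B by rewrite subr_ge0.
(* The added 1 keeps the denominator positive for a rectangle reduced to a point. *)
pose e := e0 / ((A + B) ^+ 2 + 1).
have d0 : 0 < (A + B) ^+ 2 + 1 by rewrite ltr_wpDl// sqr_ge0.
have e_gt0 : 0 < e by rewrite divr_gt0.
have {}bad : e * (A + B) ^+ 2 < cmod (rect f a b c d).
  apply: le_lt_trans bad; rewrite /e -mulrA ger_pMr// mulrC ler_pdivrMr// mul1r.
  by rewrite lerDl.
(* [(x, y, s)] encodes the rectangle with lower left corner [(x, y)] and sides [s * A], [s * B]. *)
pose Rp (p : R * R * R) := rect f p.1.1 (p.1.1 + p.2 * A) p.1.2 (p.1.2 + p.2 * B).
pose isbad p := e * (p.2 * (A + B)) ^+ 2 < cmod (Rp p).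
pose inside (p : R * R * R) := [/\ 0 < p.2, a <= p.1.1, p.1.1 + p.2 * A <= b, c <= p.1.2 & p.1.2 + p.2 * B <= d].
pose sub (p p' : R * R * R) := [/\ p'.2 = p.2 / 2, p.1.1 <= p'.1.1,
  p'.1.1 + p'.2 * A <= p.1.1 + p.2 * A, p.1.2 <= p'.1.2 & p'.1.2 + p'.2 * B <= p.1.2 + p.2 * B].
have step p : inside p -> isbad p -> exists p', sub p p' /\ isbad p'.
  case: p => [[x y] s] [/= s0 ax xb cy yd].
  have s2 : 0 < s / 2 by rewrite divr_gt0.
  have sA : 0 <= s / 2 * A by rewrite mulr_ge0// ltW.
  have sB : 0 <= s / 2 * B by rewrite mulr_ge0// ltW.
  rewrite /isbad /Rp /= => hb.
  apply: contrapT => /forallNP nb.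
  have hq (i j : bool) : cmod (rect f (x + (s / 2 * A) *+ i) (x + (s / 2 * A) *+ i + s / 2 * A)
       (y + (s / 2 * B) *+ j) (y + (s / 2 * B) *+ j + s / 2 * B)) <= e * (s / 2 * (A + B)) ^+ 2.
    rewrite leNgt; apply/negP => hlt.
    apply: (nb (x + (s / 2 * A) *+ i, y + (s / 2 * B) *+ j, s / 2)); split => //.
    by split => /=; rewrite ?mulr0n ?mulr1n; case: i {hlt}; case: j => /=; rewrite ?mulr0n ?mulr1n; lra.
  have cts u v : x <= u <= x + s * A -> y <= v <= y + s * B -> ccont f (Complex u v).
    by move=> hu hv; apply/cdiff_ccont/df; lra.
  have ex : x + s / 2 * A + s / 2 * A = x + s * A by field.
  have ey : y + s / 2 * B + s / 2 * B = y + s * B by field.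
  have lh v : y <= v <= y + s * B -> lint (fun x => f (Complex x v)) x (x + s * A).
    by move=> hv; apply/seg_cont_lint/ccont_seg_h => t ht; exact: cts.
  have lv u : x <= u <= x + s * A -> lint (fun y => f (Complex u y)) y (y + s * B).
    by move=> hv; apply/seg_cont_lint/ccont_seg_v => t ht; exact: cts.
  move: hb; rewrite (@rect_vsplit _ _ _ _ _ (x + s / 2 * A)); [|lra|lra|apply: lh; lra|apply: lh; lra].
  rewrite (@rect_hsplit _ x _ _ _ (y + s / 2 * B)); [|lra|lra|apply: lv; lra|apply: lv; lra].
  rewrite (@rect_hsplit _ (x + s / 2 * A) _ _ _ (y + s / 2 * B)); [|lra|lra|apply: lv; lra|apply: lv; lra].
  have := hq false false; have := hq false true; have := hq true false; have := hq true true.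
  rewrite !mulr0n !mulr1n !addr0 ex ey.
  set r1 := rect f x (x + s / 2 * A) y (y + s / 2 * B).
  set r2 := rect f x (x + s / 2 * A) (y + s / 2 * B) (y + s * B).
  set r3 := rect f (x + s / 2 * A) (x + s * A) y (y + s / 2 * B).
  set r4 := rect f (x + s / 2 * A) (x + s * A) (y + s / 2 * B) (y + s * B).
  move: {hq nb} r1 r2 r3 r4 => r1 r2 r3 r4 h1 h2 h3 h4.
  have := cmodD (r1 + r2) (r3 + r4); have := cmodD r3 r4; have := cmodD r1 r2.
  have -> : e * (s * (A + B)) ^+ 2 = 4 * (e * (s / 2 * (A + B)) ^+ 2) by field.
  move: (e * _) h1 h2 h3 h4 => k h1 h2 h3 h4 h5 h6 h7 h8; lra.
(* The default [p] is never taken along the sequence: [step] supplies a bad quarter at each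
   stage. *)
pose nxt p := if pselect (exists p', sub p p' /\ isbad p') is left h then projT1 (cid h) else p.
pose P n := iter n nxt (a, c, 1).
have insP n : inside (P n) /\ isbad (P n).
  elim: n => [|n [IH1 IH2]].
    by rewrite /P/= /inside /isbad /Rp/= !mul1r !lexx /A /B ltr01 !subrKC !lexx; split.
  rewrite /P iterS -/(P n) {1 2}/nxt; case: pselect => [h|]; last by case; exact: step.
  case: cid => p' [] /= [e1 e2 e3 e4 e5] bp'; split => //.
  case: IH1 => i1 i2 i3 i4 i5; split; first by rewrite e1 divr_gt0.
  - exact: le_trans e2.
  - exact: le_trans i3.
  - exact: le_trans e4.
  - exact: le_trans i5.
have subP n : sub (P n) (P n.+1).
  rewrite {2}/P iterS -/(P n) /nxt; case: pselect => [h|]; last by case; apply: step; case: (insP n).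
  by case: cid => p' [].
have sn n : (P n).2 = 2^-1 ^+ n.
  by elim: n => // n IH; rewrite exprSr -IH; case: (subP n).
have [x0 hx0] : exists x, forall n, (P n).1.1 <= x <= (P n).1.1 + (P n).2 * A.
  apply: nested_intervals => n; try by case: (subP n).
  by rewrite lerDl mulr_ge0//; case: (insP n) => -[/ltW].
have [y0 hy0] : exists y, forall n, (P n).1.2 <= y <= (P n).1.2 + (P n).2 * B.
  apply: nested_intervals => n; try by case: (subP n).
  by rewrite lerDl mulr_ge0//; case: (insP n) => -[/ltW].
have dz : cdiff f (Complex x0 y0).
  by apply: df; [have := hx0 0%N | have := hy0 0%N]; rewrite /P/= mul1r /A /B subrKC.
have [D hD] := cdiff_approx dz.
(* The 4 cancels the one in [rect_bound]: the error integrates to at most e (s (A + B))^2, the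
   threshold itself. *)
have e4 : 0 < e / 4 by rewrite divr_gt0.
have [dl dl0 hdl] := hD _ e4.
have [N hN] : exists N, (P N).2 * (A + B) <= dl.
  have AB1 : 0 < A + B + 1 by rewrite ltr_wpDl// addr_ge0.
  have [N hN] := half_pow_small (divr_gt0 dl0 AB1).
  exists N; rewrite sn; have := hN _ (leqnn N); rewrite ler_pdivlMr//; apply: le_trans.
  by rewrite ler_wpM2l ?exprn_ge0 ?invr_ge0// lerDl.
have [[s0 i1 i2 i3 i4]] := insP N; rewrite /isbad /Rp.
have := hx0 N; have := hy0 N.
move: (P N) s0 i1 i2 i3 i4 hN => [[x y] s] /= s0 i1 i2 i3 i4 hN hy hx.
rewrite ltNge => /negP; apply.
have sA : 0 <= s * A by rewrite mulr_ge0// ltW.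
have sB : 0 <= s * B by rewrite mulr_ge0// ltW.
pose r z := f z - (f (Complex x0 y0) - D * Complex x0 y0 + D * z).
have fE : f = (fun z => (f (Complex x0 y0) - D * Complex x0 y0 + D * z) + r z).
  by apply/funext => z; rewrite /r addrC subrK.
have la : rlint (fun z => f (Complex x0 y0) - D * Complex x0 y0 + D * z) x (x + s * A) y (y + s * B).
  apply: ccont_rlint; rewrite ?lerDl// => u v _ _ _.
  by apply/cdiff_ccont/cdiffD; [exact: cdiff_cst|apply: cdiffM; [exact: cdiff_cst|exact: cdiff_id]].
have lr : rlint r x (x + s * A) y (y + s * B).
  apply: ccont_rlint; rewrite ?lerDl// => u v hu hv _.
  apply/cdiff_ccont/cdiffB; first by apply: df; lra.
  by apply/cdiffD; [exact: cdiff_cst|apply: cdiffM; [exact: cdiff_cst|exact: cdiff_id]].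
rewrite fE rectD// rect_affine ?lerDl// add0r.
apply: (@le_trans _ _ (4 * (e / 4 * (s * (A + B))) * ((x + s * A - x) + (y + s * B - y)))).
  apply: rect_bound; rewrite ?lerDl// => u v hu hv _.
  have hc : cmod (Complex u v - Complex x0 y0) <= s * (A + B).
    apply: (le_trans (cmod_le _)) => /=.
    have h1 : `|u - x0| <= s * A by rewrite ler_norml; lra.
    have h2 : `|v - y0| <= s * B by rewrite ler_norml; lra.
    by rewrite mulrDr; exact: lerD.
  have := hdl _ (le_trans hc hN); rewrite /r.
  have -> : f (Complex u v) - (f (Complex x0 y0) - D * Complex x0 y0 + D * Complex u v) =
     f (Complex u v) - f (Complex x0 y0) - D * (Complex u v - Complex x0 y0) by ring.
  move/le_trans; apply; exact: ler_wpM2l (ltW e4) _ _ hc.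
by apply: eq_ler; field.
Qed.

End Goursat.

(** * Cauchy's formula, Taylor expansion and Liouville's theorem *)

Section CauchyFormula.
Context {R : realType}.
Implicit Types (f g : R[i] -> R[i]) (z w : R[i]) (a b c d : R).
Notation mu := (@lebesgue_measure R).

Definition kap : R[i] := Complex 0 (2 * pi).

Lemma kap_neq0 : kap != 0.
Proof.
by rewrite eq_complex/= eqxx/= mulf_neq0// gt_eqF// pi_gt0.
Qed.

Lemma cmod_kap : 1 <= cmod kap.
Proof.
rewrite /cmod/= expr0n/= add0r sqrtr_sqr ger0_norm ?mulr_ge0 ?pi_ge0//.
have := @pi_ge2 R; lra.
Qed.

(** A side of a square centred at the pole is seen from the pole under a quarter turn: the
    arctangent runs from -pi/4 to pi/4. The factor [k] serves for the orientation. *)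
Lemma atan_integral (k w e : R) : 0 < e ->
  rcint (fun x => k * (e / ((x - w) ^+ 2 + e ^+ 2))) (w - e) (w + e) = k * (pi / 2).
Proof.
move=> e0; have ne0 : e != 0 by rewrite gt_eqF.
have p0 (x : R) : (x - w) ^+ 2 + e ^+ 2 != 0.
  by rewrite gt_eqF// ltr_wpDl ?sqr_ge0// exprn_gt0.
have dF (x : R) : is_derive x 1 (fun x : R => k * atan ((x - w) / e) : R)
    (k * (e / ((x - w) ^+ 2 + e ^+ 2))).
  have d1 : is_derive x 1 (fun x : R => (x - w) / e : R) e^-1.
    by apply: is_derive_eq; rewrite /= /GRing.scale/=; field.
  have := @is_derive1_comp _ (@atan R) (fun x : R => (x - w) / e) x _ _ (is_derive1_atan _) d1.
  move=> d2; apply: is_derive_eq; rewrite /= /GRing.scale/=.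
  have p1 : 1 + ((x - w) / e) ^+ 2 != 0 by rewrite gt_eqF// ltr_wpDr ?sqr_ge0.
  by field; rewrite p0 ne0.
rewrite (rcint_FTC _ dF).
- have -> : (w + e - w) / e = 1 by field.
  have -> : (w - e - w) / e = -1 by field.
  by rewrite atanN atan1; field.
- by rewrite lerD2l; lra.
- move=> x; apply: cvgM; first exact: cvg_cst.
  apply: cvgM; first exact: cvg_cst.
  apply: cvgV; first exact: p0.
  apply: cvgD; last exact: cvg_cst.
  by apply: cvgM; apply: cvgB; [exact: cvg_id|exact: cvg_cst|exact: cvg_id|exact: cvg_cst].
Qed.

(** The four sides contribute a quarter turn each; the remaining parts agree on opposite sides and
    cancel. *)
Lemma rect_inv w (e : R) : 0 < e ->
  rect (fun z => (z - w)^-1) (cRe w - e) (cRe w + e)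
    (cIm w - e) (cIm w + e) = kap.
Proof.
case: w => w1 w2 e0 /=; rewrite /rect /cint.
have -> : rcint (fun x => cRe (Complex x (w2 - e) - Complex w1 w2)^-1) (w1 - e) (w1 + e) =
    rcint (fun x => cRe (Complex x (w2 + e) - Complex w1 w2)^-1) (w1 - e) (w1 + e).
  by congr rcint; apply/funext => x /=; congr (_ / (_ + _)); ring.
have -> : rcint (fun x => cIm (Complex x (w2 - e) - Complex w1 w2)^-1) (w1 - e) (w1 + e) = pi / 2.
  rewrite -[RHS]mul1r -(@atan_integral 1 w1 e)//; congr rcint; apply/funext => x /=.
  rewrite (_ : w2 - e - w2 = - e); last by ring.
  by rewrite sqrrN mul1r mulNr opprK.
have -> : rcint (fun x => cIm (Complex x (w2 + e) - Complex w1 w2)^-1) (w1 - e) (w1 + e) = - (pi / 2).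
  rewrite -[RHS]mulN1r -(@atan_integral (-1) w1 e)//; congr rcint; apply/funext => x /=.
  rewrite (_ : w2 + e - w2 = e); last by ring.
  by rewrite mulN1r.
have -> : rcint (fun y => cIm (Complex (w1 - e) y - Complex w1 w2)^-1) (w2 - e) (w2 + e) =
    rcint (fun y => cIm (Complex (w1 + e) y - Complex w1 w2)^-1) (w2 - e) (w2 + e).
  by congr rcint; apply/funext => x /=; congr (- (_ / (_ + _))); ring.
have -> : rcint (fun y => cRe (Complex (w1 + e) y - Complex w1 w2)^-1) (w2 - e) (w2 + e) = pi / 2.
  rewrite -[RHS]mul1r -(@atan_integral 1 w2 e)//; congr rcint; apply/funext => x /=.
  rewrite (_ : w1 + e - w1 = e); last by ring.
  by rewrite mul1r addrC.
have -> : rcint (fun y => cRe (Complex (w1 - e) y - Complex w1 w2)^-1) (w2 - e) (w2 + e) = - (pi / 2).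
  rewrite -[RHS]mulN1r -(@atan_integral (-1) w2 e)//; congr rcint; apply/funext => x /=.
  rewrite (_ : w1 - e - w1 = - e); last by ring.
  by rewrite mulN1r sqrrN mulNr addrC.
by apply/eqP; rewrite eq_complex/=; apply/andP; split; apply/eqP; field.
Qed.

(** Cutting along the sides of the inner square leaves four outer rectangles that avoid the pole,
    where Goursat's theorem applies. *)
Lemma rect_shrink g w a b c d (e : R) :
  (forall z, z != w -> cdiff g z) -> 0 < e ->
  a <= cRe w - e -> cRe w + e <= b ->
  c <= cIm w - e -> cIm w + e <= d ->
  rect g a b c d = rect g (cRe w - e) (cRe w + e)
    (cIm w - e) (cIm w + e).
Proof.
case: w => w1 w2 /= dg e0 h1 h2 h3 h4.
have ne x y : (x != w1) || (y != w2) -> cdiff g (Complex x y).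
  by move=> h; apply: dg; rewrite eq_complex negb_and.
have neq (x y : R) : (x < y) || (y < x) -> x != y by rewrite neq_lt.
have lh y (u v : R) : (y < w2) || (w2 < y) -> lint (fun x => g (Complex x y)) u v.
  by move=> hy; apply/seg_cont_lint/ccont_seg_h => t _; apply/cdiff_ccont/ne; rewrite (neq y)// orbT.
have lv x (u v : R) : (x < w1) || (w1 < x) -> lint (fun y => g (Complex x y)) u v.
  by move=> hx; apply/seg_cont_lint/ccont_seg_v => t _; apply/cdiff_ccont/ne; rewrite (neq x).
rewrite (@rect_vsplit _ _ _ _ _ _ (w1 - e)); [|lra|lra|apply: lh; lra|apply: lh; lra].
rewrite (@rect_vsplit _ _ (w1 - e) _ _ _ (w1 + e)); [|lra|lra|apply: lh; lra|apply: lh; lra].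
rewrite goursat ?add0r; [|lra|lra|by move=> x y hx hy; apply: ne; rewrite neq//; apply/orP; left; lra].
rewrite [X in _ + X]goursat ?addr0; [|lra|lra|by move=> x y hx hy; apply: ne; rewrite neq//; apply/orP; right; lra].
rewrite (@rect_hsplit _ _ _ _ _ _ (w2 - e)); [|lra|lra|apply: lv; lra|apply: lv; lra].
rewrite (@rect_hsplit _ _ _ _ (w2 - e) _ (w2 + e)); [|lra|lra|apply: lv; lra|apply: lv; lra].
rewrite goursat ?add0r; [|lra|lra|by move=> x y hx hy; apply: ne; rewrite orbC neq//; apply/orP; left; lra].
have -> : rect g (w1 - e) (w1 + e) (w2 + e) d = 0.
  by apply: goursat; [lra|lra|move=> x y hx hy; apply: ne; rewrite orbC neq//; apply/orP; right; lra].
by rewrite addr0.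
Qed.

Lemma cdiff_cauchy f w z : cdiff f z -> z != w -> cdiff (fun z => f z * (z - w)^-1) z.
Proof.
move=> df zw; apply: cdiffM => //; apply: cdiffV; first by rewrite subr_eq0.
by apply: cdiffB; [exact: cdiff_id|exact: cdiff_cst].
Qed.

Lemma square_bdry (w1 w2 e x y : R) : 0 < e -> w1 - e <= x <= w1 + e -> w2 - e <= y <= w2 + e ->
  (x == w1 - e) || (x == w1 + e) || (y == w2 - e) || (y == w2 + e) ->
  e <= cmod (Complex x y - Complex w1 w2) <= 2 * e.
Proof.
move=> e0 hx hy hb; apply/andP; split.
  have hr := ler_Re_cmod (Complex x y - Complex w1 w2).
  have hi := ler_Im_cmod (Complex x y - Complex w1 w2).
  move: hb hr hi => /=; move: (cmod _) => K; rewrite !ler_norml => hb /andP[h1 h2] /andP[h3 h4].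
  by case/orP : hb => [/orP[/orP[]|]|] /eqP h; lra.
apply: (le_trans (cmod_le _)) => /=; rewrite mulr_natl mulr2n.
by apply: lerD; rewrite ler_norml; lra.
Qed.

(** On a small square around [w], the part f(w)/(z - w) gives 2 pi i f(w). The rest is at most e/(32
    m) in modulus, and the sum of two adjacent sides is 4 m, so it contributes at most e/2. *)
Lemma cauchy_rect f w a b c d : centire f ->
  a < cRe w < b -> c < cIm w < d ->
  rect (fun z => f z * (z - w)^-1) a b c d = kap * f w.
Proof.
move=> df hab hcd; apply/eqP; rewrite -subr_eq0; apply/eqP/small_eq0 => e e0.
have e16 : 0 < e / 32 by rewrite divr_gt0.
have [dl dl0 hdl] := cdiff_ccont (df w) e16.
case: w hab hcd hdl => w1 w2 /= hab hcd hdl.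
(* [dl / 2], because boundary points of a square of half-side [m] may lie up to [2 * m] from its
   centre by [square_bdry]. *)
pose m := Num.min (Num.min (w1 - a) (b - w1)) (Num.min (Num.min (w2 - c) (d - w2)) (dl / 2)).
have m0 : 0 < m by rewrite !lt_min; lra.
have [m1 m2 m3 m4 m5] : [/\ m <= w1 - a, m <= b - w1, m <= w2 - c, m <= d - w2 & m <= dl / 2].
  by split; rewrite /m !ge_min lexx ?orbT.
move: (m) m0 m1 m2 m3 m4 m5 => {}m m0 m1 m2 m3 m4 m5.
rewrite (@rect_shrink _ (Complex w1 w2) _ _ _ _ m)//=; [|by move=> z; apply: cdiff_cauchy|lra|lra|lra|lra].
have cinv x y : w1 - m <= x <= w1 + m -> w2 - m <= y <= w2 + m ->
   (x == w1 - m) || (x == w1 + m) || (y == w2 - m) || (y == w2 + m) ->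
   cdiff (fun z => (z - Complex w1 w2)^-1) (Complex x y).
  move=> hx hy hb; have /andP[hm _] := square_bdry m0 hx hy hb.
  apply: cdiffV; last by apply: cdiffB; [exact: cdiff_id|exact: cdiff_cst].
  by rewrite -cmod_gt0; apply: lt_le_trans hm.
have i1 : rlint (fun z => (z - Complex w1 w2)^-1) (w1 - m) (w1 + m) (w2 - m) (w2 + m).
  by apply: ccont_rlint; [lra|lra|move=> x y hx hy hb; apply/cdiff_ccont/cinv].
have i2 : rlint (fun z => (f z - f (Complex w1 w2)) * (z - Complex w1 w2)^-1)
   (w1 - m) (w1 + m) (w2 - m) (w2 + m).
  apply: ccont_rlint; [lra|lra|move=> x y hx hy hb; apply/cdiff_ccont/cdiffM].
    by apply: cdiffB; [exact: df|exact: cdiff_cst].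
  exact: cinv.
have -> : (fun z => f z * (z - Complex w1 w2)^-1) = (fun z => f (Complex w1 w2) * (z - Complex w1 w2)^-1 +
   (f z - f (Complex w1 w2)) * (z - Complex w1 w2)^-1).
  by apply/funext => z; rewrite -mulrDl [f (Complex w1 w2) + _]addrC subrK.
rewrite rectD//; last exact: rlintZ.
rewrite rectZ// -[w1]/(cRe (Complex w1 w2)) -[w2]/(cIm (Complex w1 w2)) rect_inv//.
rewrite [f (Complex _ _) * _]mulrC [kap * _ + _]addrC addrK.
rewrite [cRe _]/= [cIm _]/=.
apply: (@le_trans _ _ (4 * (e / 32 / m) * ((w1 + m - (w1 - m)) + (w2 + m - (w2 - m))))).
  apply: rect_bound => //; [lra|lra|move=> x y hx hy hb].
  have /andP[hm hm2] := square_bdry m0 hx hy hb.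
  rewrite cmodM cmodV; apply: ler_pM; rewrite ?cmod_ge0 ?invr_ge0 ?cmod_ge0//.
    by apply: hdl; lra.
  by rewrite lef_pV2// posrE; apply: lt_le_trans hm.
rewrite (_ : 4 * _ * _ = e / 2); first lra.
by field; rewrite gt_eqF.
Qed.

Lemma seg_bounded (g : R -> R[i]) a b : a <= b -> seg_cont g a b ->
  exists M : R, forall t, a <= t <= b -> cmod (g t) <= M.
Proof.
move=> ab cg.
have cc : {within `[a, b], continuous (fun t => cmod (g t))}.
  apply: continuous_in_subspaceT => t; rewrite inE/= in_itv/= => tab.
  exact: (seg_cont_lip cmod_lip cg tab).
have [m _ hm] := EVT_max ab cc.
by exists (cmod (g m)) => t tab; apply: hm; rewrite in_itv.
Qed.

Lemma bdry_bounded f a b c d : a <= b -> c <= d -> centire f ->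
  exists M : R, forall x y, a <= x <= b -> c <= y <= d ->
  (x == a) || (x == b) || (y == c) || (y == d) -> cmod (f (Complex x y)) <= M.
Proof.
move=> ab cd df.
have h y : seg_cont (fun x => f (Complex x y)) a b.
  by apply: ccont_seg_h => t _; exact/cdiff_ccont.
have v x : seg_cont (fun y => f (Complex x y)) c d.
  by apply: ccont_seg_v => t _; exact/cdiff_ccont.
have [M1 h1] := seg_bounded ab (h c); have [M2 h2] := seg_bounded ab (h d).
have [M3 h3] := seg_bounded cd (v a); have [M4 h4] := seg_bounded cd (v b).
exists (Num.max (Num.max M1 M2) (Num.max M3 M4)) => x y hx hy; rewrite !le_max.
by case/orP => [/orP[/orP[]|]|] /eqP ->; rewrite ?h1 ?h2 ?h3 ?h4 ?orbT.
Qed.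

Lemma eq_cint (g h : R -> R[i]) a b : (forall t, a <= t <= b -> g t = h t) ->
  cint g a b = cint h a b.
Proof.
move=> gh; rewrite /cint; congr Complex; apply: eq_Rintegral => t;
  by rewrite inE/= in_itv/= => /gh ->.
Qed.

Lemma eq_rect f g a b c d : a <= b -> c <= d ->
  (forall x y, a <= x <= b -> c <= y <= d ->
  (x == a) || (x == b) || (y == c) || (y == d) -> f (Complex x y) = g (Complex x y)) ->
  rect f a b c d = rect g a b c d.
Proof.
move=> ab cd h; rewrite /rect; congr (_ + _ * _ - _ - _ * _); apply: eq_cint => t ht;
  by apply: h; rewrite ?lexx ?ab ?cd ?eqxx ?orbT.
Qed.

(** Cauchy's integral for the n-th Taylor coefficient at 0, over the square of half-side [r]. *)
Definition tcoef f (r : R) n : R[i] :=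
  kap^-1 * rect (fun z => f z * z^-1 ^+ n.+1) (- r) r (- r) r.

Lemma square0_bdry (e x y : R) : 0 < e -> - e <= x <= e -> - e <= y <= e ->
  (x == - e) || (x == e) || (y == - e) || (y == e) ->
  e <= cmod (Complex x y) <= 2 * e.
Proof.
move=> e0 hx hy hb; have := @square_bdry 0 0 e x y e0.
by rewrite -[Complex 0 0]/(0 : R[i]) subr0 !sub0r !add0r; apply.
Qed.

Lemma rlint_tcoef f (r : R) n : 0 < r -> centire f ->
  rlint (fun z => f z * z^-1 ^+ n) (- r) r (- r) r.
Proof.
move=> r0 df; apply: ccont_rlint; [lra|lra|move=> x y hx hy hb].
have /andP[hm _] := square0_bdry r0 hx hy hb.
apply/cdiff_ccont/cdiffM; [exact: df|apply: cdiffX; apply: cdiffV; last exact: cdiff_id].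
by rewrite -cmod_gt0; apply: lt_le_trans hm.
Qed.

(** The boundary of the square lies in the annulus, and 16 = 4 * 4 is the constant of [rect_bound]
    times the sum of two adjacent sides in units of [r]; the modulus of 2 pi i is only used to be at
    least 1. *)
Lemma tcoef_bound f (r M : R) n : 0 < r -> centire f ->
  (forall z, r <= cmod z <= 2 * r -> cmod (f z) <= M) ->
  cmod (tcoef f r n) <= 16 * M / r ^+ n.
Proof.
move=> r0 df hM.
have M0 : 0 <= M.
  apply: le_trans (hM r%:C%C _); rewrite ?cmod_ge0// cmod_real ger0_norm ?(ltW r0)//; lra.
rewrite /tcoef cmodM cmodV.
apply: (@le_trans _ _ (1 * (4 * (M / r ^+ n.+1) * ((r - - r) + (r - - r))))); last first.
  by apply: eq_ler; rewrite exprS; field; rewrite expf_neq0 ?gt_eqF.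
apply: ler_pM; rewrite ?invr_ge0 ?cmod_ge0//.
  by rewrite invf_le1 ?cmod_kap// (lt_le_trans ltr01) ?cmod_kap.
apply: rect_bound; [lra|lra|exact: rlint_tcoef|move=> x y hx hy hb].
have h := square0_bdry r0 hx hy hb; have /andP[hm _] := h.
rewrite cmodM cmodX cmodV -exprVn; apply: ler_pM; rewrite ?cmod_ge0 ?hM// ?exprn_ge0 ?invr_ge0 ?cmod_ge0//.
by apply: lerXn2r; rewrite ?nnegrE ?invr_ge0 ?cmod_ge0 ?(ltW r0)// lef_pV2// posrE (lt_le_trans r0).
Qed.

(** Finite expansion of the Cauchy kernel with its remainder, so that integrals are exchanged with
    finite sums only. *)
Lemma geo_identity z w N : z != 0 -> z != w ->
  (z - w)^-1 = \sum_(n < N) w ^+ n * z^-1 ^+ n.+1 + (w * z^-1) ^+ N * (z - w)^-1.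
Proof.
move=> z0 zw; have zw0 : z - w != 0 by rewrite subr_eq0.
elim: N => [|N IH]; first by rewrite big_ord0 expr0 add0r mul1r.
rewrite big_ord_recr/= {1}IH -addrA; congr +%R.
rewrite [(w * z^-1) ^+ N.+1]exprS [z^-1 ^+ N.+1]exprS exprMn.
by field; rewrite zw0 z0.
Qed.

(** For |w| <= r/2 the ratio w/z is at most 1/2 on the contour, and the remainder of [geo_identity]
    decays like 2^-N. *)
Lemma tcoef_csums f (r : R) w : 0 < r -> centire f -> cmod w <= r / 2 ->
  csums (fun n => w ^+ n * tcoef f r n) (f w).
Proof.
move=> r0 df wr.
have rr : - r <= r by lra.
have [M hM] := bdry_bounded rr rr df.
have M0 : 0 <= M.
  by apply: le_trans (hM r r _ _ _); rewrite ?cmod_ge0 ?rr ?lexx ?eqxx ?orbT.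
apply: (@geo_le_csums _ _ _ (32 * M)) => N.
have hR := le_trans (ler_Re_cmod w) wr; have hI := le_trans (ler_Im_cmod w) wr.
have cf : rect (fun z => f z * (z - w)^-1) (- r) r (- r) r = kap * f w.
  apply: cauchy_rect => //; [move: hR|move: hI]; rewrite ler_norml; lra.
have far x y : - r <= x <= r -> - r <= y <= r ->
   (x == - r) || (x == r) || (y == - r) || (y == r) ->
   [/\ Complex x y != 0, Complex x y != w, r <= cmod (Complex x y) & r / 2 <= cmod (Complex x y - w)].
  move=> hx hy hb; have /andP[hm _] := square0_bdry r0 hx hy hb.
  have h2 : r / 2 <= cmod (Complex x y - w) by have := cmodBr (Complex x y) w; lra.
  split => //; first by rewrite -cmod_gt0; lra.
  by rewrite -subr_eq0 -cmod_gt0; lra.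
pose F k := (fun z => w ^+ k * (f z * z^-1 ^+ k.+1)).
pose G := (fun z => f z * ((w * z^-1) ^+ N * (z - w)^-1)).
have lF k : rlint (F k) (- r) r (- r) r by apply/rlintZ/rlint_tcoef.
have [lS rS] := rect_sum N lF.
have lG : rlint G (- r) r (- r) r.
  apply: ccont_rlint => // x y hx hy hb; have [h1 h2 _ _] := far x y hx hy hb.
  apply/cdiff_ccont/cdiffM; first exact: df.
  apply: cdiffM; last first.
    apply: cdiffV; first by rewrite subr_eq0.
    by apply: cdiffB; [exact: cdiff_id|exact: cdiff_cst].
  by apply: cdiffX; apply: cdiffM; [exact: cdiff_cst|apply: cdiffV => //; exact: cdiff_id].
have e : rect (fun z => f z * (z - w)^-1) (- r) r (- r) r =
    rect (fun z => \sum_(k < N) F k z) (- r) r (- r) r + rect G (- r) r (- r) r.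
  rewrite -rectD//; apply: eq_rect => // x y hx hy hb; have [h1 h2 _ _] := far x y hx hy hb.
  rewrite {1}(geo_identity N h1 h2) mulrDr mulr_sumr; congr +%R.
  by apply: eq_bigr => k _; rewrite /F mulrCA.
have -> : f w - \sum_(k < N) w ^+ k * tcoef f r k = kap^-1 * rect G (- r) r (- r) r.
  have -> : rect G (- r) r (- r) r = kap * f w - \sum_(k < N) rect (F k) (- r) r (- r) r.
    by rewrite -cf e rS addrAC subrr add0r.
  rewrite mulrBr mulKf ?kap_neq0// mulr_sumr; congr (_ - _); apply: eq_bigr => k _.
  by rewrite /F rectZ; [rewrite /tcoef mulrCA|exact: rlint_tcoef].
rewrite cmodM cmodV.
apply: (@le_trans _ _ (1 * (4 * (M * (2^-1 ^+ N * (r / 2)^-1)) * ((r - - r) + (r - - r))))); last first.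
  by apply: eq_ler; field; rewrite gt_eqF.
apply: ler_pM; rewrite ?invr_ge0 ?cmod_ge0//.
  by rewrite invf_le1 ?cmod_kap// (lt_le_trans ltr01) ?cmod_kap.
apply: rect_bound => // x y hx hy hb; have [h1 h2 h3 h4] := far x y hx hy hb.
rewrite /G !cmodM cmodX cmodM !cmodV; apply: ler_pM; rewrite ?cmod_ge0 ?hM//.
  by rewrite mulr_ge0 ?exprn_ge0 ?mulr_ge0 ?invr_ge0 ?cmod_ge0.
apply: ler_pM; rewrite ?exprn_ge0 ?mulr_ge0 ?invr_ge0 ?cmod_ge0//.
  apply: lerXn2r; rewrite ?nnegrE ?mulr_ge0 ?invr_ge0 ?cmod_ge0//.
  rewrite ler_pdivrMr; last exact: lt_le_trans h3.
  lra.
by rewrite lef_pV2// posrE; [apply: lt_le_trans h4|]; rewrite divr_gt0.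
Qed.

(** Both expansions represent [f] near 0, so the identity theorem replaces a deformation of
    contours. *)
Lemma tcoef_indep f (r s : R) : 0 < r -> 0 < s -> centire f -> tcoef f r =1 tcoef f s.
Proof.
move=> r0 s0 df; have m0 : 0 < Num.min r s / 2 by rewrite divr_gt0// lt_min r0.
apply: (csums_real_inj m0) => x /andP[x0 xm]; exists (f x%:C%C).
by split; apply: tcoef_csums; rewrite // cmod_real ger0_norm ltW//;
  apply: lt_le_trans xm _; rewrite ler_pM2r ?invr_gt0// ge_min lexx ?orbT.
Qed.

Lemma taylor f : centire f -> exists a : nat -> R[i],
  [/\ entire_coef a, forall z, csums (fun n => z ^+ n * a n) (f z) &
  forall n (r M : R), 0 < r -> (forall z, r <= cmod z <= 2 * r -> cmod (f z) <= M) ->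
    cmod (a n) <= 16 * M / r ^+ n].
Proof.
move=> df; exists (tcoef f 1).
have h z : csums (fun n => z ^+ n * tcoef f 1 n) (f z).
  have r0 : 0 < 2 * cmod z + 1 by rewrite ltr_wpDl// mulr_ge0 ?cmod_ge0.
  have : csums (fun n => z ^+ n * tcoef f (2 * cmod z + 1) n) (f z).
    by apply: tcoef_csums => //; lra.
  by apply: eq_csums => n; rewrite (tcoef_indep r0 ltr01).
split => //; first by apply: csums_entire_coef => z; exists (f z).
by move=> n r M r0 hM; rewrite (tcoef_indep ltr01 r0)//; exact: tcoef_bound.
Qed.

Lemma liouville_poly f (C : R) (k : nat) : centire f ->
  (forall z, cmod (f z) <= C * (cmod z + 1) ^+ k) ->
  exists a : nat -> R[i], forall z, f z = \sum_(n < k.+1) a n * z ^+ n.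
Proof.
move=> df hC; have [a [ea ha ba]] := taylor df; exists a => z.
have C0 : 0 <= C.
  by have := hC 0; rewrite cmod0 add0r expr1n mulr1; apply: le_trans; exact: cmod_ge0.
have a0 n : (k < n)%N -> a n = 0.
  move=> kn; apply: small_eq0 => e e0.
  (* On the annulus |z| + 1 <= 2 r + 1 <= 3 r, so the Cauchy estimate is at most 16 C 3^k r^k / r^n
     with n > k; this [r] makes 16 C 3^k <= e r. *)
  pose r := 16 * C * 3 ^+ k / e + 1.
  have r1 : 1 <= r by rewrite lerDr divr_ge0 ?(ltW e0)// !mulr_ge0// exprn_ge0.
  have r0 : 0 < r by lra.
  apply: (@le_trans _ _ (16 * (C * (3 * r) ^+ k) / r ^+ n)).
    apply: ba => // z' /andP[_ hz]; apply: (le_trans (hC z')).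
    rewrite ler_wpM2l//; apply: lerXn2r; rewrite ?nnegrE ?addr_ge0 ?cmod_ge0 ?mulr_ge0 ?(ltW r0)//.
    lra.
  rewrite ler_pdivrMr ?exprn_gt0// -(subnKC kn) exprD exprS exprMn.
  have h2 : 1 <= r ^+ (n - k.+1) by rewrite exprn_ege1.
  have h3 : 16 * C * 3 ^+ k <= e * r by rewrite /r mulrDr mulr1 mulrCA divff ?gt_eqF// mulr1; lra.
  have rk : 0 <= r ^+ k by rewrite exprn_ge0// ltW.
  apply: (@le_trans _ _ ((e * r) * r ^+ k * 1)).
    by rewrite mulr1 (_ : 16 * _ = 16 * C * 3 ^+ k * r ^+ k) ?ler_wpM2r//; ring.
  rewrite (_ : e * (r * r ^+ k * _) = e * r * r ^+ k * r ^+ (n - k.+1)); last by ring.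
  by rewrite ler_wpM2l// !mulr_ge0// ltW.
apply: (csums_unique (ha z)) => e e0; exists k.+1 => n kn.
rewrite -(big_mkord xpredT (fun n => z ^+ n * a n)) (@big_cat_nat _ _ _ k.+1)//=.
rewrite [X in _ - (_ + X)]big1_seq ?addr0; last first.
  by move=> i /=; rewrite mem_index_iota => /andP[h _]; rewrite a0 ?mulr0.
rewrite big_mkord (eq_bigr (fun i : 'I_k.+1 => z ^+ i * a i)); last by move=> i _; rewrite mulrC.
by rewrite subrr cmod0 ltW.
Qed.

End CauchyFormula.

(** * Sub-mean value inequalities *)

Section MonotoneIntegral.
Context d (T : measurableType d) (R : realType) (mu : {measure set T -> \bar R}).
Local Open Scope ereal_scope.

(* Both integrals are suprema over simple minorants, so no measurability is required. *)
Lemma ge0_le_integralT (f g : T -> \bar R) : (forall x, 0 <= f x) ->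
  (forall x, f x <= g x) -> \int[mu]_x f x <= \int[mu]_x g x.
Proof.
move=> f0 fg; have g0 x : 0 <= g x by apply: le_trans (fg x).
rewrite !ge0_integralTE//; apply: le_ereal_sup => _ [h hf <-].
by exists h => // x; exact: le_trans (hf x) (fg x).
Qed.

End MonotoneIntegral.

Section SubMean.
Context {R : realType}.
Notation mu := (@lebesgue_measure R).
Notation mu2 := (mu \x mu)%E.
Notation T2 := (measurableTypeR R * measurableTypeR R)%type.
Implicit Types (f g : R[i] -> R[i]) (z w : R[i]).

Definition pt (u : R * R) : R[i] := Complex u.1 u.2.

Definition mcx f := measurable_fun [set: T2] (fun u : T2 => cRe (f (pt u))) /\
  measurable_fun [set: T2] (fun u : T2 => cIm (f (pt u))).

Lemma mcx_cst c : mcx (fun=> c).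
Proof. by split; exact: measurable_cst. Qed.

Lemma mcx_id : mcx id.
Proof. by split; [exact: measurable_fst|exact: measurable_snd]. Qed.

Lemma mcxD f g : mcx f -> mcx g -> mcx (fun z => f z + g z).
Proof.
move=> [f1 f2] [g1 g2]; split.
  by under eq_fun do rewrite cReD; exact: measurable_funD.
by under eq_fun do rewrite cImD; exact: measurable_funD.
Qed.

Lemma mcxM f g : mcx f -> mcx g -> mcx (fun z => f z * g z).
Proof.
move=> [f1 f2] [g1 g2]; split.
  by under eq_fun do rewrite cReM; apply: measurable_funB; exact: measurable_funM.
by under eq_fun do rewrite cImM; apply: measurable_funD; exact: measurable_funM.
Qed.

Lemma mcx_lim (F : nat -> R[i] -> R[i]) f : (forall n, mcx (F n)) ->
  (forall z (e : R), 0 < e -> exists N, forall n, (N <= n)%N -> cmod (f z - F n z) <= e) ->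
  mcx f.
Proof.
move=> mF h; split.
  apply: (@measurable_fun_cvg _ _ _ _ (fun n u => cRe (F n (pt u)))).
    by move=> n; case: (mF n).
  move=> u _; apply/cvgrPdist_le => e /(h (pt u))[N hN]; exists N => // n /= /hN hn.
  by rewrite -cReB; apply: le_trans hn; exact: ler_Re_cmod.
apply: (@measurable_fun_cvg _ _ _ _ (fun n u => cIm (F n (pt u)))).
  by move=> n; case: (mF n).
move=> u _; apply/cvgrPdist_le => e /(h (pt u))[N hN]; exists N => // n /= /hN hn.
by rewrite -cImB; apply: le_trans hn; exact: ler_Im_cmod.
Qed.

Lemma centire_mcx f : centire f -> mcx f.
Proof.
move=> df; have [a [_ ha _]] := taylor df.
apply: (@mcx_lim (fun n z => \sum_(k < n) z ^+ k * a k)); last first.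
  by move=> z e e0; exact: ha.
elim=> [|n IH]; first by under eq_fun do rewrite big_ord0; exact: mcx_cst.
under eq_fun do rewrite big_ord_recr/=.
apply: mcxD => //; apply: mcxM; last exact: mcx_cst.
elim: n {IH} => [|n IH]; first by under eq_fun do rewrite expr0; exact: mcx_cst.
by under eq_fun do rewrite exprS; apply: mcxM => //; exact: mcx_id.
Qed.

Lemma mcx_cmod f : mcx f -> measurable_fun [set: T2] (fun u : T2 => cmod (f (pt u))).
Proof.
move=> [f1 f2]; rewrite /cmod.
have m : measurable_fun [set: T2]
    (fun u : T2 => cRe (f (pt u)) ^+ 2 + cIm (f (pt u)) ^+ 2).
  by apply: measurable_funD; exact: measurable_funX.
apply: (measurableT_comp _ m); apply: continuous_measurable_fun.
exact: sqrt_continuous.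
Qed.

(* Locally uniform limits of entire functions. *)
Definition hol f := forall r e : R, 0 < e -> exists g, centire g /\
  forall z, cmod z <= r -> cmod (f z - g z) <= e.

Lemma centire_hol f : centire f -> hol f.
Proof. by move=> df r e e0; exists f; split => // z _; rewrite subrr cmod0 ltW. Qed.

Lemma hol_mcx f : hol f -> mcx f.
Proof.
move=> hf.
have h n : exists g, centire g /\ forall z, cmod z <= n%:R -> cmod (f z - g z) <= 2^-1 ^+ n.
  by apply: hf; rewrite exprn_gt0.
pose F n := projT1 (cid (h n)).
have FE n : centire (F n) /\ forall z, cmod z <= n%:R -> cmod (f z - F n z) <= 2^-1 ^+ n.
  by rewrite /F; case: cid.
apply: (@mcx_lim F); first by move=> n; apply: centire_mcx; case: (FE n).
move=> z e e0; have [N hN] := half_pow_small e0.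
exists (maxn N (Num.trunc (cmod z)).+1) => n; rewrite geq_max => /andP[/hN h1 h2].
apply: le_trans h1; apply: (FE n).2; apply: ltW.
by apply: lt_le_trans (truncnS_gt (cmod z)) _; rewrite ler_nat.
Qed.

Lemma hol_bounded f (r : R) : hol f -> exists2 M : R, 0 <= M & forall z, cmod z <= r -> cmod (f z) <= M.
Proof.
move=> hf; have [g [dg hg]] := hf r 1 ltr01.
have [a [ea ha _]] := taylor dg.
have r0 : 0 < 2 * (`|r| + 1) by rewrite mulr_gt0// ltr_wpDl.
have [K hK] := ea _ r0.
have K0 : 0 <= K.
  apply: le_trans (hK 0%N); by rewrite mulr_ge0 ?cmod_ge0// exprn_ge0// ltW.
exists (4 * K + 1) => [|z zr]; first by rewrite addr_ge0// mulr_ge0.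
have : cmod (g z) <= 4 * K.
  have hb n : cmod (z ^+ n * a n) <= K * 2^-1 ^+ n.
    rewrite exprVn ler_pdivlMr ?exprn_gt0//; apply: le_trans (hK n).
    rewrite cmodM cmodX [leLHS](_ : _ = cmod (a n) * (cmod z * 2) ^+ n); last by rewrite exprMn; ring.
    rewrite ler_wpM2l ?cmod_ge0//.
    apply: lerXn2r; rewrite ?nnegrE ?mulr_ge0 ?cmod_ge0 ?addr_ge0//.
    by rewrite mulrC ler_wpM2l//; have := ler_norm r; lra.
  by have := csums_tail (ha z) hb 0%N; rewrite big_ord0 subr0 expr0 mulr1.
have := hg z zr; have := cmodBr (f z) (g z); lra.
Qed.

Lemma holZ f c : hol f -> hol (fun z => c * f z).
Proof.
move=> hf r e e0; have c1 : 0 < cmod c + 1 by rewrite ltr_wpDl// cmod_ge0.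
have [g [dg hg]] := hf r _ (divr_gt0 e0 c1).
exists (fun z => c * g z); split; first by move=> z; apply: cdiffM => //; exact: cdiff_cst.
move=> z /hg; rewrite -mulrBr cmodM ler_pdivlMr// => h; apply: le_trans h.
by rewrite mulrC ler_wpM2l ?cmod_ge0// lerDl.
Qed.

Definition xside z (r : R) : set R := `[cRe z - r, cRe z + r]%classic.
Definition yside z (r : R) : set R := `[cIm z - r, cIm z + r]%classic.
Definition square z (r : R) : set (R * R) := xside z r `*` yside z r.

Lemma msquare z r : measurable (square z r).
Proof. by apply: measurableX; exact: measurable_itv. Qed.

Lemma square_vsection (F : R * R -> \bar R) z (r x : R) : xside z r x ->
  fubini_F mu (F \_ (square z r)) x = (\int[mu]_(y in yside z r) F (x, y))%E.
Proof.
move=> hx; rewrite [RHS]integral_mkcond; apply: eq_integral => y _.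
by rewrite !patchE; congr (if _ then _ else _); apply/idP/idP; rewrite !inE; [case|split].
Qed.

Lemma square_hsection (F : R * R -> \bar R) z (r y : R) : yside z r y ->
  fubini_G mu (F \_ (square z r)) y = (\int[mu]_(x in xside z r) F (x, y))%E.
Proof.
move=> hy; rewrite [RHS]integral_mkcond; apply: eq_integral => x _.
by rewrite !patchE; congr (if _ then _ else _); apply/idP/idP; rewrite !inE; [case|split].
Qed.

(* Chebyshev's inequality, selecting a side of the rectangle used for Cauchy's formula. *)
Lemma good_side (h : R -> \bar R) (s t A : R) : s < t -> 0 < A ->
  measurable_fun [set: measurableTypeR R] h -> (forall x, 0 <= h x)%E ->
  (\int[mu]_x h x <= A%:E)%E ->
  exists2 x : R, s <= x <= t & (h x <= (2 * A / (t - s))%:E)%E.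
Proof.
move=> st A0 mh h0 hA; apply: contrapT => /forall2NP nh.
have st0 : 0 < t - s by rewrite subr_gt0.
suff : ((2 * A)%:E <= A%:E)%E by rewrite lee_fin; lra.
apply: le_trans hA.
apply: (@le_trans _ _ (\int[mu]_(x in `[s, t]) h x)%E); last first.
  by apply: (ge0_subset_integral _ (mitv s t) measurableT).
have -> : ((2 * A)%:E = \int[mu]_(x in `[s, t]) (2 * A / (t - s))%:E)%E.
  rewrite integral_cst; last exact: mitv.
  rewrite [X in (_ * X)%E]lebesgue_itv ?(ltW st)//.
  by rewrite -EFinM divfK// gt_eqF.
apply: (ge0_le_integral _ (mitv s t)) => //.
- by move=> x _; rewrite lee_fin divr_ge0 ?ltW// mulr_gt0.
- exact: measurable_funTS.
- move=> x; rewrite /= in_itv/= => hx.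
  by have [//|/negP] := nh x; rewrite -ltNge => /ltW.
Qed.

Lemma seg_cont_cmod_integrable (g : R -> R[i]) a b : seg_cont g a b ->
  mu.-integrable `[a, b] (fun x => (cmod (g x))%:E).
Proof.
move=> cg; apply: (@continuous_integrable _ (fun x => cmod (g x))) => t tab.
exact: (seg_cont_lip cmod_lip cg tab).
Qed.

Lemma le_rcint (u v : R -> R) a b : mu.-integrable `[a, b] (EFin \o u) ->
  mu.-integrable `[a, b] (EFin \o v) ->
  (forall t, a <= t <= b -> u t <= v t) -> rcint u a b <= rcint v a b.
Proof.
move=> iu iv h; apply: (le_Rintegral (mitv a b) iu iv) => x /=.
by rewrite in_itv/=; exact: h.
Qed.

Lemma cmod_cint_le (g : R -> R[i]) a b : seg_cont g a b ->
  cmod (cint g a b) <= 2 * rcint (fun t => cmod (g t)) a b.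
Proof.
move=> cg; have [g1 g2] := seg_cont_lint cg; have g3 := seg_cont_cmod_integrable cg.
apply: (le_trans (cmod_le _)) => /=; rewrite mulr_natl mulr2n; apply: lerD.
  apply: (le_trans (le_normr_Rintegral (mitv a b) g1)).
  by apply: le_rcint => //; [exact: (integrable_norm g1)|move=> t _; exact: ler_Re_cmod].
apply: (le_trans (le_normr_Rintegral (mitv a b) g2)).
by apply: le_rcint => //; [exact: (integrable_norm g2)|move=> t _; exact: ler_Im_cmod].
Qed.


Lemma rcint_sub (u : R -> R) a b c d : a <= c -> c <= d -> d <= b ->
  mu.-integrable `[a, b] (EFin \o u) -> (forall t, 0 <= u t) ->
  rcint u c d <= rcint u a b.
Proof.
move=> ac cd db iu u0.
have ge0 s t : 0 <= rcint u s t by apply: Rintegral_ge0.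
have iu2 : mu.-integrable `[c, b] (EFin \o u).
  apply: (integrableS (mitv a b) (mitv c b)) => //.
  by apply: subset_itvr; rewrite bnd_simp.
rewrite (@rcint_cat _ u a b c)//; last exact: le_trans db.
rewrite (@rcint_cat _ u c b d)//.
by have := ge0 a c; have := ge0 d b; lra.
Qed.

(** The side of the contour is [c, d], but the integral of |h| is controlled on the full segment
    [a, b], which is what Chebyshev's inequality provides. *)
Lemma side_bound (h k : R -> R[i]) (a b c d r B : R) :
  seg_cont h a b -> a <= c -> c <= d -> d <= b -> 0 < r ->
  seg_cont (fun t => h t * (k t)^-1) c d -> (forall t, c <= t <= d -> r <= cmod (k t)) ->
  rcint (fun t => cmod (h t)) a b <= B ->
  cmod (cint (fun t => h t * (k t)^-1) c d) <= 2 * B / r.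
Proof.
move=> ch ac cd db r0 ck hk hB.
have ih := seg_cont_cmod_integrable ch.
have ihs : mu.-integrable `[c, d] (EFin \o (fun t => cmod (h t))).
  apply: (integrableS (mitv a b) (mitv c d)) => //.
  by apply: subset_itv; rewrite bnd_simp.
apply: (le_trans (cmod_cint_le ck)); rewrite -mulrA ler_wpM2l//.
apply: (@le_trans _ _ (rcint (fun t => r^-1 * cmod (h t)) c d)).
  apply: le_rcint; first exact: seg_cont_cmod_integrable.
    by have := @integrableZl _ _ _ mu _ (mitv c d) r^-1 _ ihs.
  move=> t tcd; rewrite cmodM cmodV mulrC ler_wpM2r ?cmod_ge0//.
  by rewrite lef_pV2 ?posrE// ?hk//; apply: lt_le_trans (hk t tcd).
rewrite /rcint (RintegralZl _ (mitv c d) ihs).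
rewrite mulrC ler_wpM2r ?invr_ge0 ?(ltW r0)//; apply: le_trans hB.
by apply: rcint_sub => // t; exact: cmod_ge0.
Qed.

Lemma entire_seg_h f y u v : centire f -> seg_cont (fun x => f (Complex x y)) u v.
Proof. by move=> df; apply: ccont_seg_h => t _; exact/cdiff_ccont. Qed.

Lemma entire_seg_v f x u v : centire f -> seg_cont (fun y => f (Complex x y)) u v.
Proof. by move=> df; apply: ccont_seg_v => t _; exact/cdiff_ccont. Qed.

Lemma entire_int_v f x a b : centire f ->
  mu.-integrable `[a, b] (EFin \o (fun y => cmod (f (Complex x y)))).
Proof.
move=> df; have h := @seg_cont_cmod_integrable (fun y => f (Complex x y)) a b.
by apply: h; exact: entire_seg_v.
Qed.

Lemma entire_int_h f y a b : centire f ->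
  mu.-integrable `[a, b] (EFin \o (fun x => cmod (f (Complex x y)))).
Proof.
move=> df; have h := @seg_cont_cmod_integrable (fun x => f (Complex x y)) a b.
by apply: h; exact: entire_seg_h.
Qed.

Lemma rcint_EFin (u : R -> R) a b : mu.-integrable `[a, b] (EFin \o u) ->
  (\int[mu]_(x in `[a, b]) (u x)%:E = (rcint u a b)%:E)%E.
Proof. by move=> iu; rewrite /rcint /Rintegral fineK//; exact: (integrable_fin_num (mitv _ _) iu). Qed.

Lemma cmod_four_sides (A B C D : R[i]) (K : R) :
  cmod A <= K -> cmod C <= K -> cmod D <= K -> cmod B <= K ->
  cmod (A + Complex 0 1 * B - C - Complex 0 1 * D) <= 4 * K.
Proof.
move=> a c d b; have t3 := cmodB (A + Complex 0 1 * B - C) (Complex 0 1 * D).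
have t1 := cmodB (A + Complex 0 1 * B) C; have t2 := cmodD A (Complex 0 1 * B).
rewrite cmodci in t2; rewrite cmodci in t3; lra.
Qed.

(** Cauchy's formula over a rectangle whose sides are at distance at least r/2 from the centre: each
    of the four sides contributes at most 2 B / (r/2), and |2 pi i| >= 1. *)
Lemma lines_estimate f (z1 z2 a b c d r B : R) : centire f -> 0 < r ->
  z1 - r <= a <= z1 - r / 2 -> z1 + r / 2 <= b <= z1 + r ->
  z2 - r <= c <= z2 - r / 2 -> z2 + r / 2 <= d <= z2 + r ->
  rcint (fun y => cmod (f (Complex a y))) (z2 - r) (z2 + r) <= B ->
  rcint (fun y => cmod (f (Complex b y))) (z2 - r) (z2 + r) <= B ->
  rcint (fun x => cmod (f (Complex x c))) (z1 - r) (z1 + r) <= B ->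
  rcint (fun x => cmod (f (Complex x d))) (z1 - r) (z1 + r) <= B ->
  cmod (f (Complex z1 z2)) <= 16 * B / r.
Proof.
move=> df r0 ha hb hc hd; set z := Complex z1 z2.
have far x y : (x == a) || (x == b) || (y == c) || (y == d) -> r / 2 <= cmod (Complex x y - z).
  have := ler_Re_cmod (Complex x y - z); have := ler_Im_cmod (Complex x y - z); rewrite /=.
  move: (cmod _) => K; rewrite !ler_norml => /andP[k1 k2] /andP[k3 k4].
  by case/orP => [/orP[/orP[]|]|] /eqP e; subst; lra.
have r2 : 0 < r / 2 by rewrite divr_gt0.
have cz x y : (x == a) || (x == b) || (y == c) || (y == d) ->
    ccont (fun w => f w * (w - z)^-1) (Complex x y).
  move=> /far h; apply/cdiff_ccont/cdiff_cauchy; first exact: df.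
  by rewrite -subr_eq0 -cmod_gt0; apply: lt_le_trans h.
have sh y : (y == c) || (y == d) ->
    rcint (fun x => cmod (f (Complex x y))) (z1 - r) (z1 + r) <= B ->
    cmod (cint (fun x => f (Complex x y) * (Complex x y - z)^-1) a b) <= 2 * B / (r / 2).
  move=> hy; apply: (@side_bound (fun x => f (Complex x y)) (fun x => Complex x y - z)) => //.
  - exact: entire_seg_h.
  - by case/andP: ha.
  - by case/andP: ha => _ /le_trans; apply; case/andP: hb => + _; apply: le_trans; rewrite lerD2l; lra.
  - by case/andP: hb.
  - by apply: (@ccont_seg_h _ (fun w => f w * (w - z)^-1)) => t _; apply: cz; rewrite -orbA hy ?orbT.
  - by move=> t _; apply: far; rewrite -orbA hy orbT.
have sv x : (x == a) || (x == b) ->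
    rcint (fun y => cmod (f (Complex x y))) (z2 - r) (z2 + r) <= B ->
    cmod (cint (fun y => f (Complex x y) * (Complex x y - z)^-1) c d) <= 2 * B / (r / 2).
  move=> hx; apply: (@side_bound (fun y => f (Complex x y)) (fun y => Complex x y - z)) => //.
  - exact: entire_seg_v.
  - by case/andP: hc.
  - by case/andP: hc => _ /le_trans; apply; case/andP: hd => + _; apply: le_trans; rewrite lerD2l; lra.
  - by case/andP: hd.
  - by apply: (@ccont_seg_v _ (fun w => f w * (w - z)^-1)) => t _; apply: cz; rewrite hx.
  - by move=> t _; apply: far; rewrite hx.
move=> /sv b3 /sv b4 /sh b1 /sh b2.
have {}b1 := b1 (introT orP (or_introl (eqxx _))); have {}b2 := b2 (introT orP (or_intror (eqxx _))).
have {}b3 := b3 (introT orP (or_introl (eqxx _))); have {}b4 := b4 (introT orP (or_intror (eqxx _))).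
have cR : rect (fun w => f w * (w - z)^-1) a b c d = kap * f z.
  by apply: cauchy_rect => //=; clear -ha hb hc hd r0; lra.
apply: (@le_trans _ _ (cmod (kap * f z))).
  by rewrite cmodM ler_peMl ?cmod_ge0// cmod_kap.
have e4 : 2 * B / (r / 2) = 4 * B / r by field; rewrite gt_eqF.
rewrite e4 in b1 b2 b3 b4; have -> : 16 * B / r = 4 * (4 * B / r) by field; rewrite gt_eqF.
by rewrite -cR /rect; apply: cmod_four_sides.
Qed.

(** Cartesian substitute for averaging over circles. By Tonelli's theorem and Chebyshev's
    inequality, each of the four strips of width r/2 along the sides of the square contains a line
    on which |f| has integral at most 4 A / r; the four lines bound a rectangle suitable for
    Cauchy's formula. *)
Lemma submean_entire f z (r A : R) : centire f -> 0 < r -> 0 < A ->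
  (\int[mu2]_(u in square z r) (cmod (f (pt u)))%:E <= A%:E)%E ->
  cmod (f z) <= 64 * A / r ^+ 2.
Proof.
move=> df r0 A0; case: z => z1 z2 hA; pose S := square (Complex z1 z2) r.
pose F := (fun u : R * R => (cmod (f (pt u)))%:E) \_ S.
have mF : measurable_fun [set: T2] F.
  have ms : measurable (S : set T2) by exact: msquare.
  have mS : measurable_fun (S : set T2) (fun u : R * R => (cmod (f (pt u)))%:E).
    by apply: measurable_funTS; apply/measurable_EFinP; apply: mcx_cmod; exact: centire_mcx.
  exact/(measurable_restrictT _ _).1.
have {}hA : (\int[mu2]_u F u <= A%:E)%E by move: hA; rewrite integral_mkcond.
have F0 u : (0 <= F u)%E by rewrite /F patchE; case: ifP => _ //; rewrite lee_fin cmod_ge0.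
have vside s t : z1 - r <= s -> s < t -> t <= z1 + r -> t - s = r / 2 -> exists2 x, s <= x <= t &
    rcint (fun y => cmod (f (Complex x y))) (z2 - r) (z2 + r) <= 4 * A / r.
  move=> hs st ht ts.
  have [||x xst] := good_side st A0 (@measurable_fun_fubini_tonelli_F _ _ _ _ _ mu _ mF F0).
  - by move=> x; exact: integral_ge0.
  - by rewrite -fubini_tonelli1.
  have xS : xside (Complex z1 z2) r x by rewrite /xside /= in_itv/=; lra.
  rewrite ts => hx; exists x => //.
  have {hx} : ((rcint (fun y => cmod (f (Complex x y))) (z2 - r) (z2 + r))%:E <= (2 * A / (r / 2))%:E)%E.
    rewrite -(rcint_EFin (entire_int_v _ _ _ df)).
    by rewrite -(square_vsection (fun u => (cmod (f (pt u)))%:E) xS); exact: hx.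
  rewrite lee_fin => hx.
  by apply: le_trans hx _; apply: eq_ler; field; rewrite gt_eqF.
have hside s t : z2 - r <= s -> s < t -> t <= z2 + r -> t - s = r / 2 -> exists2 y, s <= y <= t &
    rcint (fun x => cmod (f (Complex x y))) (z1 - r) (z1 + r) <= 4 * A / r.
  move=> hs st ht ts.
  have [||y yst] := good_side st A0 (@measurable_fun_fubini_tonelli_G _ _ _ _ _ mu _ mF F0).
  - by move=> y; exact: integral_ge0.
  - by rewrite -fubini_tonelli2.
  have yS : yside (Complex z1 z2) r y by rewrite /yside /= in_itv/=; lra.
  rewrite ts => hy; exists y => //.
  have {hy} : ((rcint (fun x => cmod (f (Complex x y))) (z1 - r) (z1 + r))%:E <= (2 * A / (r / 2))%:E)%E.
    rewrite -(rcint_EFin (entire_int_h _ _ _ df)).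
    by rewrite -(square_hsection (fun u => (cmod (f (pt u)))%:E) yS); exact: hy.
  rewrite lee_fin => hy.
  by apply: le_trans hy _; apply: eq_ler; field; rewrite gt_eqF.
have [||||b hb hb1] := vside (z1 + r / 2) (z1 + r); [clear -r0; lra..|].
have [||||a ha ha1] := vside (z1 - r) (z1 - r / 2); [clear -r0; lra..|].
have [||||d hd hd1] := hside (z2 + r / 2) (z2 + r); [clear -r0; lra..|].
have [||||c hc hc1] := hside (z2 - r) (z2 - r / 2); [clear -r0; lra..|].
have := lines_estimate df r0 ha hb hc hd ha1 hb1 hc1 hd1.
by move/le_trans; apply; apply: eq_ler; field; rewrite gt_eqF.
Qed.

End SubMean.

(** * Sub-mean value inequality for powers of the modulus *)

Section PowerSubMean.
Context {R : realType}.
Notation mu := (@lebesgue_measure R).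
Notation mu2 := (mu \x mu)%E.
Notation T2 := (measurableTypeR R * measurableTypeR R)%type.
Implicit Types (f g : R[i] -> R[i]) (z w : R[i]).

Lemma in_square z (r : R) (u : R * R) : square z r u <->
  `|cRe (pt u - z)| <= r /\ `|cIm (pt u - z)| <= r.
Proof.
case: u => x y; case: z => z1 z2; rewrite /square /xside /yside /= !in_itv /= !ler_norml.
by split => -[/andP[h1 h2] /andP[h3 h4]]; split; apply/andP; lra.
Qed.

Lemma in_square_cmod z (r : R) (u : R * R) : square z r u -> cmod (pt u - z) <= 2 * r.
Proof.
move=> /in_square[h1 h2]; apply: (le_trans (cmod_le _)).
by rewrite mulr_natl mulr2n; exact: lerD.
Qed.

Lemma mu2_square z (r : R) : 0 <= r -> mu2 (square z r) = (4 * r ^+ 2)%:E.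
Proof.
move=> r0; rewrite /square product_measure1E; [|exact: mitv..].
have h (c : R) : mu `[(c - r)%R, (c + r)%R]%classic = (2 * r)%:E.
  by rewrite lebesgue_itv; [congr EFin; ring|rewrite lerD2l; lra].
transitivity ((2 * r)%:E * (2 * r)%:E)%E; first by congr (_ * _)%E; exact: h.
by rewrite -EFinM; congr EFin; ring.
Qed.

Lemma measurable_cmod_hol f : hol f ->
  measurable_fun [set: T2] (fun u : T2 => (cmod (f (pt u)))%:E).
Proof. by move=> hf; apply/measurable_EFinP; apply: mcx_cmod; exact: hol_mcx. Qed.

Lemma measurable_powR_hol f (q : R) : hol f ->
  measurable_fun [set: T2] (fun u : T2 => (cmod (f (pt u)) `^ q)%:E).
Proof.
move=> hf; apply/measurable_EFinP; apply: (measurableT_comp (measurable_powR q)).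
by apply: mcx_cmod; exact: hol_mcx.
Qed.

Lemma submean_hol f z (r A : R) : hol f -> 0 < r -> 0 < A ->
  (\int[mu2]_(u in square z r) (cmod (f (pt u)))%:E <= A%:E)%E ->
  cmod (f z) <= 64 * A / r ^+ 2.
Proof.
move=> hf r0 A0 hA; have ms : measurable (square z r : set T2) by exact: msquare.
apply/ler_addgt0Pr => e e0.
(* Approximation within e' adds 4 r^2 e' to the integral, hence 256 e' to the bound, and another e'
   at [z] itself. *)
have [e' e'0 ee] : exists2 e', 0 < e' & e = 257 * e'.
  by exists (e / 257); lra.
have [g [dg hg]] := hf (cmod z + 2 * r) _ e'0.
have mf := measurable_cmod_hol hf; have mg := measurable_cmod_hol (centire_hol dg).
have gA : (\int[mu2]_(u in square z r) (cmod (g (pt u)))%:E <= (A + 4 * r ^+ 2 * e')%:E)%E.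
  apply: (@le_trans _ _ (\int[mu2]_(u in square z r) ((cmod (f (pt u)))%:E + e'%:E))%E).
    apply: (ge0_le_integral _ ms).
    - by move=> u _; rewrite lee_fin cmod_ge0.
    - exact: measurable_funTS.
    - by apply: emeasurable_funD; [exact: measurable_funTS|exact: measurable_cst].
    - move=> u su; rewrite -EFinD lee_fin.
      have := hg (pt u); have : cmod (pt u) <= cmod z + 2 * r.
        by have := in_square_cmod su; have := cmodBr (pt u) z; lra.
      by move=> h /(_ h); rewrite cmodBC; have := cmodBr (g (pt u)) (f (pt u)); lra.
  rewrite ge0_integralD//.
  - rewrite integral_cst// EFinD; apply: leeD => //.
    by rewrite [X in (_ * X)%E](mu2_square z (ltW r0)) -EFinM lee_fin mulrC.
  - by move=> u _; rewrite lee_fin cmod_ge0.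
  - exact: measurable_funTS.
  - by move=> u _; rewrite lee_fin ltW.
have A'0 : 0 < A + 4 * r ^+ 2 * e' by rewrite addr_gt0 ?mulr_gt0 ?exprn_gt0 ?ltr0n.
have h1 := submean_entire dg r0 A'0 gA.
have h2 : cmod (f z - g z) <= e' by apply: hg; rewrite lerDl mulr_ge0// ltW.
have h3 := cmodBr (f z) (g z).
rewrite ee.
have : 64 * (A + 4 * r ^+ 2 * e') / r ^+ 2 = 64 * A / r ^+ 2 + 256 * e'.
  by field; rewrite gt_eqF.
by move: h1 h2 h3; clear; lra.
Qed.

(* Maximise [|f| d ^ (2 / q)] over the square, where [d] is the distance to its boundary. Near an
   almost maximal point, [|f|] is at most a constant times its value there, and on a square around
   it of size comparable to [d] the exponent [q] can be traded for the exponent 1. *)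
Lemma submean_pow_le1 (q : R) f z : 0 < q -> q <= 1 -> hol f ->
  (\int[mu2]_(u in square z 1) (cmod (f (pt u)) `^ q)%:E <= 1%:E)%E ->
  cmod (f z) <= (128 * 2 `^ (2 / q)) `^ q^-1.
Proof.
move=> q0 q1 hf hA; pose k := 2 / q; have k0 : 0 < k by rewrite divr_gt0.
pose d w := 1 - Num.max `|cRe (w - z)| `|cIm (w - z)|.
pose phi w := cmod (f w) * d w `^ k.
have dz : d z = 1 by rewrite /d subrr /= normr0 maxxx subr0.
pose E := [set phi w | w in [set w | 0 < d w]].
have [M M0 hM] := hol_bounded (cmod z + 2) hf.
have dcl w : 0 < d w -> cmod w <= cmod z + 2.
  rewrite /d subr_gt0 gt_max => /andP[h1 h2].
  by have := cmod_le (w - z); have := cmodBr w z; lra.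
have d1 w : d w <= 1 by rewrite /d gerBl le_max normr_ge0.
have Ez : E (cmod (f z)).
  by exists z; rewrite /= ?dz// /phi dz powR1 mulr1.
have hE : has_sup E.
  split; first by exists (cmod (f z)).
  exists M => _ [w /= dw <-]; rewrite /phi.
  apply: (@le_trans _ _ (cmod (f w) * 1)); last by rewrite mulr1 hM// dcl.
  have p1 : 1 `^ k = 1 :> R by rewrite powR1.
  rewrite ler_wpM2l ?cmod_ge0// -p1 ge0_ler_powR ?nnegrE ?(ltW k0)// ?(ltW dw)//.
pose S := sup E.
have leS w : 0 < d w -> phi w <= S.
  by move=> dw; apply: ub_le_sup; [case: hE|exists w].
have zS : cmod (f z) <= S by apply: ub_le_sup => //; case: hE.
apply: (le_trans zS).
have [S0|S0] := leP S 0; first by apply: le_trans S0 _; exact: powR_ge0.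
have [_ [z1 /= dz1 <-] hz1] := @sup_adherent _ E (S / 2) (divr_gt0 S0 (ltr0Sn _ _)) hE.
have {}hz1 : S / 2 < phi z1 by move: hz1; rewrite -/S; lra.
pose D := d z1 / 2; have D0 : 0 < D by rewrite divr_gt0.
have near u : square z1 D u -> D <= d (pt u).
  move=> /in_square[h1 h2].
  have : `|cRe (z1 - z)| <= 1 - d z1 /\ `|cIm (z1 - z)| <= 1 - d z1.
    by rewrite /d subKr !le_max !lexx orbT.
  move=> [h3 h4]; rewrite /d lerBrDr -lerBrDl ge_max.
  have -> : pt u - z = (pt u - z1) + (z1 - z) by ring.
  rewrite cReD cImD; have e2 : d z1 = 2 * D by rewrite /D; field.
  by apply/andP; split; apply: (le_trans (ler_normD _ _)); lra.
have sub u : square z1 D u -> square z 1 u.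
  move=> /near h; apply/in_square; move: (lt_le_trans D0 h); rewrite /d subr_gt0 gt_max.
  by move=> /andP[/ltW ? /ltW ?].
pose m := S / D `^ k.
have Dk : 0 < D `^ k by rewrite powR_gt0.
have m0 : 0 < m by rewrite divr_gt0.
have fm u : square z1 D u -> cmod (f (pt u)) <= m.
  move=> /near h; rewrite ler_pdivlMr//.
  apply: le_trans (leS (pt u) (lt_le_trans D0 h)).
  by rewrite ler_wpM2l ?cmod_ge0// ge0_ler_powR ?nnegrE ?(ltW k0) ?(ltW D0)// (le_trans _ h)// ltW.
have mq0 : 0 < m `^ (1 - q) by rewrite powR_gt0.
have ms1 : measurable (square z1 D : set T2) by exact: msquare.
have ms : measurable (square z 1 : set T2) by exact: msquare.
have mp := measurable_powR_hol q hf.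
(* Here |f| = |f|^(1 - q) |f|^q <= m^(1 - q) |f|^q, as |f| <= m on the small square and q <= 1. *)
have hI : (\int[mu2]_(u in square z1 D) (cmod (f (pt u)))%:E <= (m `^ (1 - q))%:E)%E.
  apply: (@le_trans _ _ (\int[mu2]_(u in square z1 D) ((m `^ (1 - q))%:E * (cmod (f (pt u)) `^ q)%:E))%E).
    apply: (ge0_le_integral _ ms1).
    - by move=> u _; rewrite lee_fin cmod_ge0.
    - by apply: measurable_funTS; exact: measurable_cmod_hol.
    - by apply: measurable_funeM; exact: measurable_funTS.
    - move=> u su; rewrite -EFinM lee_fin -{1}(powRr1 (cmod_ge0 (f (pt u)))).
      have -> : 1 = (1 - q) + q by ring.
      rewrite powRD ?subrK ?oner_eq0// ler_wpM2r ?powR_ge0//.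
      by rewrite ge0_ler_powR ?nnegrE ?cmod_ge0 ?(ltW m0) ?fm// subr_ge0.
  rewrite ge0_integralZl//; last 3 first.
  - exact: measurable_funTS.
  - by move=> u _; rewrite lee_fin powR_ge0.
  - by rewrite lee_fin ltW.
  rewrite -[leRHS]mule1; apply: lee_wpmul2l; first by rewrite lee_fin ltW.
  apply: le_trans hA; apply: (ge0_subset_integral _ ms1 ms) => //.
  - exact: measurable_funTS.
  - by move=> u _; rewrite lee_fin powR_ge0.
have h1 := submean_hol hf D0 mq0 hI.
have h2 : m / (2 * 2 `^ k) <= cmod (f z1).
  move: hz1; rewrite /phi; have -> : d z1 = 2 * D by rewrite /D; field.
  rewrite powRM ?(ltW D0)// => /ltW hz1.
  rewrite ler_pdivrMr ?mulr_gt0 ?powR_gt0// /m ler_pdivrMr//; move: hz1.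
  by move: (2 `^ k) (D `^ k) => a b; clear; lra.
have h3 : m `^ q <= 128 * 2 `^ k / D ^+ 2.
  have e1 : m = m `^ q * m `^ (1 - q).
    by rewrite -powRD ?subrKC ?oner_eq0// powRr1// ltW.
  have k2 : 0 < 2 * 2 `^ k by rewrite mulr_gt0 ?powR_gt0 ?ltr0n.
  have := le_trans h2 h1; rewrite ler_pdivrMr// {1}e1.
  have -> : 64 * m `^ (1 - q) / D ^+ 2 * (2 * 2 `^ k) = 128 * 2 `^ k / D ^+ 2 * m `^ (1 - q).
    by move: (m `^ _) (2 `^ k) => a b; field; rewrite gt_eqF.
  by rewrite ler_pM2r.
(* As m = S / D^k and k q = 2, one has m^q = S^q / D^2: the unknown distance D cancels, which is
   what the exponent k = 2/q is for. *)
have h4 : S `^ q <= 128 * 2 `^ k.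
  move: h3; rewrite ler_pdivlMr ?exprn_gt0//; apply: le_trans.
  rewrite /m powRM ?(ltW S0) ?invr_ge0 ?(ltW Dk)//.
  have -> : (D `^ k)^-1 `^ q = (D ^+ 2)^-1.
    rewrite -(powR_inv1 (powR_ge0 _ _)) -!powRrM.
    have -> : k * (-1 * q) = - 2%:R by rewrite /k; field; rewrite gt_eqF.
    by rewrite powR_invn// ltW.
  by rewrite divfK// expf_neq0// gt_eqF.
have -> : S = (S `^ q) `^ q^-1 by rewrite -powRrM divff ?gt_eqF// powRr1// ltW.
by rewrite ge0_ler_powR ?nnegrE ?invr_ge0 ?powR_ge0 ?(ltW q0)// mulr_ge0// powR_ge0.
Qed.

Lemma submean_pow1 (q : R) : 0 < q -> exists2 C : R, 0 < C & forall f z, hol f ->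
  (\int[mu2]_(u in square z 1) (cmod (f (pt u)) `^ q)%:E <= 1%:E)%E ->
  cmod (f z) <= C.
Proof.
move=> q0; have [q1|q1] := leP q 1.
  exists ((128 * 2 `^ (2 / q)) `^ q^-1); first by rewrite powR_gt0// mulr_gt0// powR_gt0.
  by move=> f z hf hA; exact: submean_pow_le1.
(* For q > 1, |f| <= 1 + |f|^q; the square has area 4, which gives 5 = 4 + 1. *)
exists (64 * 5 / 1 ^+ 2) => [|f z hf hA]; first by rewrite expr1n divr_gt0.
apply: submean_hol => //.
have ms : measurable (square z 1 : set T2) by exact: msquare.
apply: (@le_trans _ _ (\int[mu2]_(u in square z 1) (4^-1%:E * 4%:E + (cmod (f (pt u)) `^ q)%:E))%E).
  apply: (ge0_le_integral _ ms).
  - by move=> u _; rewrite lee_fin cmod_ge0.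
  - by apply: measurable_funTS; exact: measurable_cmod_hol.
  - by apply: emeasurable_funD; [exact: measurable_cst|apply: measurable_funTS; exact: measurable_powR_hol].
  - move=> u _; rewrite -EFinM mulVf ?pnatr_eq0// -EFinD lee_fin.
    have [h|h] := leP (cmod (f (pt u))) 1.
      by apply: (le_trans h); rewrite lerDl powR_ge0.
    apply: (@le_trans _ _ (cmod (f (pt u)) `^ q)); last by rewrite lerDr.
    by rewrite le1r_powR// ltW.
rewrite -EFinM mulVf ?pnatr_eq0// ge0_integralD//.
- rewrite integral_cst// [X in (_ * X)%E](mu2_square z ler01) expr1n mulr1 mul1e (_ : 5 = 4 + 1 :> R) ?EFinD; first exact: leeD.
  by ring.
- by move=> u _; rewrite lee_fin powR_ge0.
- by apply: measurable_funTS; exact: measurable_powR_hol.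
Qed.

Lemma submean_pow (q : R) : 0 < q -> exists2 C : R, 0 < C & forall f z (K : R), hol f ->
  0 <= K ->
  (\int[mu2]_(u in square z 1) (cmod (f (pt u)) `^ q)%:E <= (K `^ q)%:E)%E ->
  cmod (f z) <= C * K.
Proof.
move=> q0; have [C C0 hC] := submean_pow1 q0; exists C => // f z K1 hf K10 hA.
(* The bound may be 0, so [f] is divided by a slightly larger number instead. *)
apply/ler_addgt0Pr => e e0; have eC : 0 < e / C by rewrite divr_gt0.
have -> : C * K1 + e = C * (K1 + e / C) by field; rewrite gt_eqF.
have K0 : 0 < K1 + e / C by rewrite ltr_wpDl.
have {hA} : (\int[mu2]_(u in square z 1) (cmod (f (pt u)) `^ q)%:E <= ((K1 + e / C) `^ q)%:E)%E.
  apply: (le_trans hA); rewrite lee_fin.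
  by rewrite ge0_ler_powR ?nnegrE ?lerDl ?(ltW q0) ?(ltW K0) ?(ltW eC).
move: (K1 + e / C) K0 => {e e0 K1 K10 eC} K K0 hA.
have ms : measurable (square z 1 : set T2) by exact: msquare.
have Kq : 0 < K `^ q by rewrite powR_gt0.
have := hC (fun z => (K^-1)%:C%C * f z) z (holZ _ hf).
rewrite cmodM cmod_real ger0_norm ?invr_ge0 ?(ltW K0)// mulrC ler_pdivrMr//; apply.
have e u : cmod ((K^-1)%:C%C * f (pt u)) `^ q = (K `^ q)^-1 * cmod (f (pt u)) `^ q.
  rewrite cmodM cmod_real ger0_norm ?invr_ge0 ?(ltW K0)// powRM ?invr_ge0 ?(ltW K0) ?cmod_ge0//.
  by rewrite -(powR_inv1 (ltW K0)) powRAC powR_inv1// powR_ge0.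
under eq_integral do rewrite e EFinM.
rewrite ge0_integralZl//; last 3 first.
- by apply: measurable_funTS; exact: measurable_powR_hol.
- by move=> u _; rewrite lee_fin powR_ge0.
- by rewrite lee_fin invr_ge0 ltW.
apply: (@le_trans _ _ ((K `^ q)^-1%:E * (K `^ q)%:E)%E).
  by apply: lee_wpmul2l => //; rewrite lee_fin invr_ge0 ltW.
by rewrite -EFinM mulVf// gt_eqF.
Qed.

End PowerSubMean.

(** * Agreement of [cdiff] with complex differentiability over [R[i]] *)

Section Derivable.
Context {R : realType}.
Implicit Types (f : R[i] -> R[i]) (z : R[i]).

(** In the order of [R[i]] positive elements are real, which turns the complex radii of its balls
    into real ones. *)
Lemma complex_pos (e : R[i]) : 0 < e -> exists2 r : R, 0 < r & e = r%:C%C.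
Proof.
case: e => a b; rewrite ltcE /= => /andP[/eqP -> a0]; by exists a.
Qed.

Lemma derivable_cdiff f z : derivable f z 1 -> cdiff f z.
Proof.
move=> /cvg_ex[D hD]; apply: (@approx_cdiff _ _ _ D) => e e0.
have e0C : 0 < e%:C%C by rewrite ltcR.
move/cvgrPdist_le : hD => /(_ _ e0C).
rewrite /dnbhs /within /= => /nbhs_ballP[d /= /complex_pos[r r0 ->] hd].
exists (r / 2); first by rewrite divr_gt0.
move=> w wz; have [->|wz0] := eqVneq w z; first by rewrite !subrr mulr0 subr0 cmod0 mulr0.
have := hd (w - z); rewrite /ball /= sub0r normrN cmodE ltcR => /(_ _).
have wr : cmod (w - z) < r by apply: le_lt_trans wz _; lra.
move=> /(_ wr); rewrite subr_eq0 => /(_ wz0).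
rewrite scaler1 subrK /= cmodE lecR => h.
have {h} : cmod (D - (w - z)^-1 * (f w - f z)) <= e by exact: h.
move: (D : R[i]) => {hd}D h.
have wz1 : w - z != 0 by rewrite subr_eq0.
have -> : f w - f z - D * (w - z) = - ((D - (w - z)^-1 * (f w - f z)) * (w - z)).
  by field.
by rewrite cmodN cmodM ler_wpM2r// cmod_ge0.
Qed.

Lemma cdiff_derivable f z : cdiff f z -> derivable f z 1.
Proof.
move=> /cdiff_approx[D hD]; apply/cvg_ex; exists D.
apply/cvgrPdist_le => e /complex_pos[r r0 ->].
have [d d0 hd] := hD _ r0.
rewrite /dnbhs /within /=; apply/nbhs_ballP; exists d%:C%C; first by rewrite /= ltcR.
move=> h; rewrite /ball /= sub0r normrN cmodE ltcR => hd' h0.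
have := hd (h + z); rewrite addrK => /(_ (ltW hd')).
rewrite scaler1 /= cmodE lecR => hq.
suff : cmod (D - h^-1 * (f (h + z) - f z)) <= r by [].
move: hq; have -> : f (h + z) - f z - D * h = - ((D - h^-1 * (f (h + z) - f z)) * h).
  by field.
by rewrite cmodN cmodM ler_pM2r// cmod_gt0.
Qed.

Lemma entire_centire f : entire f -> centire f.
Proof. by move=> df z; apply: derivable_cdiff; exact: df. Qed.

End Derivable.

(** * Slices and quaternionic power series *)

Section Quaternions.
Context {R : realType}.
Notation H := (quat R).
Implicit Types (I J x y : H) (z w : R[i]).

Lemma quat_eq x y : q0 x = q0 y -> q1 x = q1 y -> q2 x = q2 y -> q3 x = q3 y -> x = y.
Proof. by case: x y => ? ? ? ? [? ? ? ?] /= -> -> -> ->. Qed.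

Lemma quat_normE x : `|x| = quat_norm x. Proof. by []. Qed.

Lemma quat_normM x y : `|x * y| = `|x| * `|y|.
Proof.
rewrite !quat_normE /quat_norm -sqrtrM ?quat_dot_ge0//; congr Num.sqrt.
by case: x y => ? ? ? ? [? ? ? ?]; rewrite /quat_dot /=; ring.
Qed.

(** The vector part of I^2 is 2 (Re I) times that of I. With nonzero real part, I would thus be
    real, and its square could not be -1. *)
Lemma imaginary_unitP I : imaginary_unit I ->
  q0 I = 0 /\ q1 I ^+ 2 + q2 I ^+ 2 + q3 I ^+ 2 = 1.
Proof.
case: I => a b c d; rewrite /imaginary_unit expr2 => -[/= h0 h1 h2 h3].
have a0 : a = 0.
  apply/eqP/negP => /negP a0.
  have e (t : R) : a * t + t * a = 0 -> t = 0.
    move=> h; have : a * t = 0 by lra.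
    by move/eqP; rewrite mulf_eq0 (negbTE a0)/= => /eqP.
  have b0 : b = 0 by apply: e; lra.
  have c0 : c = 0 by apply: e; lra.
  have d0 : d = 0 by apply: e; lra.
  by have := sqr_ge0 a; subst; lra.
by split => //; subst; lra.
Qed.

Lemma norm_imaginary_unit I : imaginary_unit I -> `|I| = 1.
Proof.
move=> /imaginary_unitP[h0 h1]; rewrite quat_normE /quat_norm /quat_dot h0 mul0r add0r.
by rewrite -!expr2 h1 sqrtr1.
Qed.

Lemma slice_comps I z : slice I z =
  Quat (cRe z + cIm z * q0 I) (cIm z * q1 I)
       (cIm z * q2 I) (cIm z * q3 I).
Proof.
by case: I z => a b c d [x y]; apply: quat_eq; rewrite /slice /=; ring.
Qed.

Lemma sliceD I z w : slice I (z + w) = slice I z + slice I w.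
Proof. by rewrite /slice cReD cImD !scalerDl addrACA. Qed.

Lemma slice0 I : slice I 0 = 0.
Proof. by rewrite /slice /= !scale0r addr0. Qed.

Lemma sliceN I z : slice I (- z) = - slice I z.
Proof. by apply/eqP; rewrite -addr_eq0 -sliceD addNr slice0. Qed.

Lemma sliceB I z w : slice I (z - w) = slice I z - slice I w.
Proof. by rewrite sliceD sliceN. Qed.

Lemma slice_real I (r : R) : slice I r%:C%C = r *: 1.
Proof. by rewrite /slice /= scale0r addr0. Qed.

Lemma slice1 I : slice I 1 = 1.
Proof. by rewrite -[1 in LHS]/((1 : R)%:C%C) slice_real scale1r. Qed.

Lemma slice_sum I n (F : nat -> R[i]) : slice I (\sum_(k < n) F k) = \sum_(k < n) slice I (F k).
Proof. by elim: n => [|n IH]; rewrite ?big_ord0 ?slice0// !big_ord_recr/= sliceD IH. Qed.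

Lemma slice_realM I (r : R) z : slice I (r%:C%C * z) = r *: slice I z.
Proof. by rewrite /slice cReM cImM /= !mul0r subr0 addr0 -!scalerA scalerDr. Qed.

Section Unit.
Variable I : H.
Hypothesis hI : imaginary_unit I.

Lemma sliceM z w : slice I (z * w) = slice I z * slice I w.
Proof.
have [h0 h1] := imaginary_unitP hI; rewrite !slice_comps h0 cReM cImM.
apply: quat_eq => /=; rewrite ?mulr0 ?addr0; [|ring..].
by rewrite -[cIm z * cIm w]mulr1 -h1; ring.
Qed.

Lemma sliceX z n : slice I (z ^+ n) = slice I z ^+ n.
Proof. by elim: n => [|n IH]; rewrite ?expr0 ?slice1// !exprS sliceM IH. Qed.

Lemma slice_conj z : quat_conj (slice I z) = slice I z^*.
Proof.
have [h0 h1] := imaginary_unitP hI; rewrite !slice_comps h0 conjE; case: z => a b.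
by apply: quat_eq => /=; ring.
Qed.

Lemma norm_slice z : `|slice I z| = cmod z.
Proof.
have [h0 h1] := imaginary_unitP hI; rewrite quat_normE /quat_norm /cmod; congr Num.sqrt.
rewrite slice_comps h0 /quat_dot /= mulr0 addr0.
rewrite -[in RHS](mulr1 (cIm z ^+ 2)) -h1; ring.
Qed.

(** A nonzero vector part determines the slice by normalisation; a real quaternion lies on all
    slices, and the unit at hand is taken. *)
Lemma slice_surj x : exists J z, imaginary_unit J /\ x = slice J z.
Proof.
case: x => a b c d; pose s := Num.sqrt (b ^+ 2 + c ^+ 2 + d ^+ 2).
have s2 : s ^+ 2 = b ^+ 2 + c ^+ 2 + d ^+ 2 by rewrite sqr_sqrtr// !addr_ge0 ?sqr_ge0.
have [s0|s0] := eqVneq s 0.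
  exists I, a%:C%C; split => //; rewrite slice_real.
  move/eqP: s2; rewrite s0 expr0n/= eq_sym !paddr_eq0 ?addr_ge0 ?sqr_ge0// !sqrf_eq0.
  by move=> /andP[/andP[/eqP -> /eqP ->] /eqP ->]; apply: quat_eq => /=; ring.
exists (Quat 0 (b / s) (c / s) (d / s)), (Complex a s); split.
  rewrite /imaginary_unit expr2; apply: quat_eq => /=; try by ring.
  have -> : 0 * 0 - b / s * (b / s) - c / s * (c / s) - d / s * (d / s) =
    - ((b ^+ 2 + c ^+ 2 + d ^+ 2) / s ^+ 2) by field.
  by rewrite -s2 divff ?expf_neq0.
by rewrite slice_comps /=; apply: quat_eq => /=; field.
Qed.

Variable J : H.
Hypothesis hJ : imaginary_unit J.
Hypothesis hJI : quat_orthogonal J I.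

Lemma sliceJ z : J * slice I z = slice I z^* * J.
Proof.
have [h0 h1] := imaginary_unitP hI; have [g0 g1] := imaginary_unitP hJ.
move: hJI; rewrite /quat_orthogonal /quat_dot h0 g0 mul0r add0r => o.
rewrite !slice_comps h0 conjE; case: z => a b.
apply: quat_eq => /=; rewrite ?h0 ?g0; [|ring..].
transitivity (- b * (q1 J * q1 I + q2 J * q2 I + q3 J * q3 I)); first by ring.
by rewrite o mulr0; transitivity (b * (q1 J * q1 I + q2 J * q2 I + q3 J * q3 I)); [rewrite o mulr0|ring].
Qed.

Definition split2 (p r : R[i]) : H := slice I p + slice I r * J.

(** The product rule for first rows of matrices with rows (p, r) and (-conj r, conj p), that is, the
    embedding of the quaternions in the 2x2 complex matrices. It is the reason why star powers
    follow the powers of the matrix symbol. *)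
Lemma split2M p r p' r' :
  split2 p r * split2 p' r' = split2 (p * p' - r * r'^*) (p * r' + r * p'^*).
Proof.
have e1 : slice I r * J * slice I p' = slice I (r * p'^*) * J.
  by rewrite -mulrA sliceJ mulrA -sliceM.
have e2 : slice I r * J * (slice I r' * J) = - slice I (r * r'^*).
  by rewrite mulrA -(mulrA (slice I r)) sliceJ !mulrA -sliceM -mulrA -expr2 hJ mulrN1.
rewrite /split2 mulrDl (mulrDr (slice I p)) (mulrDr (slice I r * J)).
rewrite e1 e2 mulrA -!sliceM sliceB sliceD (mulrDl (slice I (p * r'))).
by rewrite [slice I (r * p'^*) * J - _]addrC addrACA.
Qed.

Lemma norm_split2 p r : `|split2 p r| ^+ 2 = cmod p ^+ 2 + cmod r ^+ 2.
Proof.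
have [h0 h1] := imaginary_unitP hI; have [g0 g1] := imaginary_unitP hJ.
have -> : `|split2 p r| ^+ 2 = quat_dot (split2 p r) (split2 p r).
  by rewrite quat_normE sqr_sqrtr// quat_dot_ge0.
have h : quat_dot (slice I p) (slice I r * J) = 0.
  move: hJI; rewrite /quat_orthogonal /quat_dot h0 g0 mul0r add0r => o.
  rewrite !slice_comps h0; case: p r => [a b] [c d] /=; rewrite g0.
  transitivity ((b * c - a * d) * (q1 J * q1 I + q2 J * q2 I + q3 J * q3 I)); last by rewrite o mulr0.
  by ring.
have -> : quat_dot (split2 p r) (split2 p r) = quat_dot (slice I p) (slice I p) +
  quat_dot (slice I r * J) (slice I r * J) + 2 * quat_dot (slice I p) (slice I r * J).
  by rewrite /split2; move: (slice I p) (slice I r * J) => [? ? ? ?] [? ? ? ?]; rewrite /quat_dot /=; ring.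
rewrite h mulr0 addr0 -(norm_slice p).
have -> : cmod r = `|slice I r * J| by rewrite quat_normM norm_slice (norm_imaginary_unit hJ) mulr1.
by rewrite !quat_normE !sqr_sqrtr ?quat_dot_ge0.
Qed.

Lemma norm_split2_le p r : `|split2 p r| <= cmod p + cmod r.
Proof.
apply: (le_trans (ler_normD _ _)).
by rewrite quat_normM !norm_slice (norm_imaginary_unit hJ) mulr1.
Qed.

Lemma split2B p r p' r' : split2 p r - split2 p' r' = split2 (p - p') (r - r').
Proof. by rewrite /split2 !sliceB mulrBl opprD addrACA. Qed.

Lemma split2_sum n (F G : nat -> R[i]) :
  \sum_(k < n) split2 (F k) (G k) = split2 (\sum_(k < n) F k) (\sum_(k < n) G k).
Proof. by rewrite /split2 big_split/= -mulr_suml -!slice_sum. Qed.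

Lemma cvg_split2 (F G : nat -> R[i]) s t : csums F s -> csums G t ->
  series (fun n => split2 (F n) (G n)) @ \oo --> split2 s t.
Proof.
move=> hF hG; apply/cvgrPdist_le => e e0; have e2 : 0 < e / 2 by rewrite divr_gt0.
have [N hN] := hF _ e2; have [M hM] := hG _ e2.
exists (maxn N M) => // n /=; rewrite geq_max => /andP[/hN h1 /hM h2].
rewrite /series/= big_mkord split2_sum split2B.
by apply: (le_trans (norm_split2_le _ _)); lra.
Qed.

End Unit.
End Quaternions.

(** * Power series and star products across slices *)

Section QuaternionSeries.
Context {R : realType}.
Notation H := (quat R).
Implicit Types (I J x y : H) (z w : R[i]) (p r : nat -> R[i]) (f g : H -> H) (a b : nat -> H).

Lemma ler_q0_norm x : `|q0 x| <= `|x|.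
Proof.
case: x => a b c d; rewrite quat_normE /quat_norm /quat_dot /= -!expr2 -sqrtr_sqr ler_wsqrtr//.
by rewrite -!addrA lerDl !addr_ge0 ?sqr_ge0.
Qed.
(* The complex linear functional h |-> q0 h + i <h, I> for left multiplication by C_I. *)
Definition cl I x : R[i] := Complex (q0 x) (quat_dot x I).

Lemma clD I x y : cl I (x + y) = cl I x + cl I y.
Proof.
apply/eqP; rewrite eq_complex /cl /=; apply/andP; split; apply/eqP => //.
by rewrite /quat_dot /=; ring.
Qed.

Lemma cl_real I (r : R) x : cl I (r *: x) = r%:C%C * cl I x.
Proof.
apply/eqP; rewrite eq_complex /cl /=; apply/andP; split; apply/eqP; rewrite mul0r ?subr0 ?addr0//.
by rewrite /quat_dot /=; ring.
Qed.

Lemma clN I x : cl I (- x) = - cl I x.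
Proof. by rewrite -scaleN1r cl_real rmorphN1 mulN1r. Qed.

Lemma clB I x y : cl I (x - y) = cl I x - cl I y.
Proof. by rewrite clD clN. Qed.

Lemma cl0 I : cl I 0 = 0.
Proof. by rewrite -[X in cl I X](scale0r (0 : H)) cl_real mul0r. Qed.

Lemma cl_sum I n (F : nat -> H) : cl I (\sum_(k < n) F k) = \sum_(k < n) cl I (F k).
Proof. by elim: n => [|n IH]; rewrite ?big_ord0 ?cl0// !big_ord_recr/= clD IH. Qed.

Lemma cl_slice I z x : imaginary_unit I -> cl I (slice I z * x) = z * cl I x.
Proof.
move=> hI; have [h0 h1] := imaginary_unitP hI.
rewrite slice_comps h0; case: z => a b; case: x => x0 x1 x2 x3.
apply/eqP; rewrite eq_complex /cl /quat_dot /= h0; apply/andP; split; apply/eqP; first by ring.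
transitivity (a * (x1 * q1 I + x2 * q2 I + x3 * q3 I) + b * x0 * (q1 I ^+ 2 + q2 I ^+ 2 + q3 I ^+ 2)).
  by ring.
by rewrite h1; ring.
Qed.

Lemma cl_le I x : imaginary_unit I -> cmod (cl I x) <= 2 * `|x|.
Proof.
move=> hI; apply: (le_trans (cmod_le _)) => /=; rewrite mulr_natl mulr2n.
apply: lerD; first exact: ler_q0_norm.
have -> : quat_dot x I = q0 (x * quat_conj I).
  by case: x I {hI} => ? ? ? ? [? ? ? ?]; rewrite /quat_dot /=; ring.
apply: (le_trans (ler_q0_norm _)); rewrite quat_normM.
have -> : `|quat_conj I| = `|I|.
  by rewrite !quat_normE; case: I {hI} => ? ? ? ?; rewrite /quat_norm /quat_dot /= !mulrNN.
by rewrite (norm_imaginary_unit hI) mulr1.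
Qed.

(** The real parts of x u, for u in the standard basis, are the four coordinates of x up to sign. *)
Lemma cl_faithful I x y : (forall u, cl I (x * u) = cl I (y * u)) -> x = y.
Proof.
move=> h; case: x y h => x0 x1 x2 x3 [y0 y1 y2 y3] h.
have := h (Quat 1 0 0 0); have := h (Quat 0 1 0 0); have := h (Quat 0 0 1 0); have := h (Quat 0 0 0 1).
move=> [/= e3 _] [/= e2 _] [/= e1 _] [/= e0 _].
by apply: quat_eq => /=; lra.
Qed.

Lemma cvg_cl I x0 u (a : nat -> H) : imaginary_unit I -> series a @ \oo --> x0 ->
  csums (fun n => cl I (a n * u)) (cl I (x0 * u)).
Proof.
move=> hI /cvgrPdist_le h e e0.
have u1 : 0 < 2 * (`|u| + 1) by rewrite mulr_gt0// ltr_wpDl.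
have [N _ hN] := h _ (divr_gt0 e0 u1); exists N => n /hN /=.
rewrite /series/= big_mkord ler_pdivlMr// => hn.
rewrite -(@cl_sum I n (fun k => a k * u)) -mulr_suml -clB -mulrBl.
apply: (le_trans (cl_le _ hI)); rewrite quat_normM; apply: le_trans hn.
by rewrite mulrCA ler_wpM2l// ler_wpM2l// lerDl.
Qed.

Lemma real_power (x : R) n (h : H) : (x *: 1 : H) ^+ n * h = (x ^+ n) *: h.
Proof. by rewrite exprZn expr1n -scalerAl mul1r. Qed.

Lemma has_power_series_real I f a u (x : R) : imaginary_unit I -> has_power_series f a ->
  csums (fun n => x%:C%C ^+ n * cl I (a n * u)) (cl I (f (x *: 1) * u)).
Proof.
move=> hI /(_ (x *: 1)) h; have := cvg_cl u hI h; apply: eq_csums => n.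
by rewrite real_power -scalerAl cl_real rmorphXn.
Qed.

Lemma imag_ex : exists I : H, imaginary_unit I.
Proof.
by exists (Quat 0 1 0 0); rewrite /imaginary_unit expr2; apply: quat_eq => /=; ring.
Qed.

(** On the real axis the functionals h -> [cl I (h * u)] turn the expansion into complex power
    series, to which the identity theorem applies. *)
Lemma has_power_series_unique f a b : has_power_series f a -> has_power_series f b -> a = b.
Proof.
move=> ha hb; have [I hI] := imag_ex; apply/funext => n; apply: (@cl_faithful I) => u.
apply: (csums_real_inj ltr01 (a := fun n => cl I (a n * u)) (b := fun n => cl I (b n * u))) => x _.
by exists (cl I (f (x *: 1) * u)); split; exact: has_power_series_real.
Qed.

Lemma coefsE f a : has_power_series f a -> coefs f = a.
Proof.
move=> ha; apply: (has_power_series_unique _ ha).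
exact: (@getPex _ [set a | has_power_series f a] (ex_intro _ a ha)).
Qed.

Lemma cvg_mull (h l : H) (u : nat -> H) : u @ \oo --> l -> (fun n => h * u n) @ \oo --> h * l.
Proof.
move=> /cvgrPdist_le hu; apply/cvgrPdist_le => e e0.
have h1 : 0 < `|h| + 1 by rewrite ltr_wpDl.
have [N _ hN] := hu _ (divr_gt0 e0 h1); exists N => // n /hN /=.
rewrite ler_pdivlMr// -mulrBr quat_normM => hn; apply: le_trans hn.
by rewrite mulrC ler_wpM2l// lerDl.
Qed.

Section Split.
Variables (I J : H).
Hypotheses (hI : imaginary_unit I) (hJ : imaginary_unit J) (hJI : quat_orthogonal J I).

Definition ecoefs p r n : H := split2 I J (p n) (r n).

Lemma entire_coef_real_csums p (s : nat -> R) z : entire_coef p ->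
  (forall n, `|s n| <= cmod (z ^+ n)) -> exists l, csums (fun n => (s n)%:C%C * p n) l.
Proof.
move=> hp hs; have [K hK] := @entire_coef_geo _ _ z 2 hp (ltr0Sn _ _).
exists (csum (fun n => (s n)%:C%C * p n)); apply: (@csum_geo _ _ K) => n.
by apply: le_trans (hK n); rewrite !cmodM cmod_real ler_wpM2r ?cmod_ge0.
Qed.

Lemma split2_real (s : R) (a b : R[i]) : split2 I J (s%:C%C * a) (s%:C%C * b) = s *: split2 I J a b.
Proof. by rewrite /split2 !slice_realM [RHS]scalerDr scalerAl. Qed.

(** On another slice the powers are Re(z^n) + I' Im(z^n). The real weights commute with everything,
    so convergence reduces to four complex series dominated by those on [C_I]. *)
Lemma ecoefs_cvg p r xi : entire_coef p -> entire_coef r ->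
  cvgn (series (fun n => xi ^+ n * ecoefs p r n)).
Proof.
move=> hp hr; have [I' [z [hI' ->]]] := slice_surj hI xi.
have [l1 h1] := @entire_coef_real_csums _ (fun n => cRe (z ^+ n)) z hp (fun n => ler_Re_cmod _).
have [l2 h2] := @entire_coef_real_csums _ (fun n => cRe (z ^+ n)) z hr (fun n => ler_Re_cmod _).
have [l3 h3] := @entire_coef_real_csums _ (fun n => cIm (z ^+ n)) z hp (fun n => ler_Im_cmod _).
have [l4 h4] := @entire_coef_real_csums _ (fun n => cIm (z ^+ n)) z hr (fun n => ler_Im_cmod _).
have c1 := cvg_split2 hI hJ h1 h2; have c2 := cvg_split2 hI hJ h3 h4.
have c3 := @cvg_mull I' _ _ c2.
apply/cvg_ex; exists (split2 I J l1 l2 + I' * split2 I J l3 l4).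
rewrite (_ : series _ = (fun n => series (fun n => split2 I J ((cRe (z ^+ n))%:C%C * p n) ((cRe (z ^+ n))%:C%C * r n)) n
  + I' * series (fun n => split2 I J ((cIm (z ^+ n))%:C%C * p n) ((cIm (z ^+ n))%:C%C * r n)) n)).
  by apply: cvgD.
apply/funext => n; rewrite /series/= mulr_sumr -big_split/=; apply: eq_bigr => k _.
rewrite -sliceX// !split2_real /ecoefs {1}/slice mulrDl -!scalerAl mul1r.
by rewrite -scalerAr.
Qed.

Definition eseries p r xi : H := limn (series (fun n => xi ^+ n * ecoefs p r n)).

Lemma eseries_hps p r : entire_coef p -> entire_coef r ->
  has_power_series (eseries p r) (ecoefs p r).
Proof. by move=> hp hr xi; exact: ecoefs_cvg. Qed.

Lemma eseries_slice p r z s t : csums (fun n => z ^+ n * p n) s -> csums (fun n => z ^+ n * r n) t ->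
  eseries p r (slice I z) = split2 I J s t.
Proof.
move=> hs ht; apply: cvg_lim => //.
have := cvg_split2 hI hJ hs ht; rewrite (_ : (fun n => split2 I J _ _) = (fun n => slice I z ^+ n * ecoefs p r n))//.
apply/funext => n; rewrite /ecoefs -sliceX// /split2 mulrDr mulrA -!sliceM//.
Qed.

(** [split2M] coefficient by coefficient. Conjugated coefficients belong to [sharp] functions, so on
    [C_I] the formula reads (F F' - G G'#) + (F G' + G F'#) J. *)
Lemma star_ecoefs f g p r p' r' : entire_coef p -> entire_coef r -> entire_coef p' -> entire_coef r' ->
  has_power_series f (ecoefs p r) -> has_power_series g (ecoefs p' r') ->
  star f g = eseries (fun n => conv p p' n - conv r (fun n => (r' n)^*) n)
                     (fun n => conv p r' n + conv r (fun n => (p' n)^*) n).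
Proof.
move=> hp hr hp' hr' hf hg; apply/funext => xi; rewrite /star /eseries (coefsE hf) (coefsE hg).
congr (limn (series _)); apply/funext => n; congr (_ * _).
rewrite (eq_bigr (fun k : 'I_n.+1 => split2 I J (p k * p' (n - k)%N - r k * (r' (n - k)%N)^*)
   (p k * r' (n - k)%N + r k * (p' (n - k)%N)^*))); last by move=> k _; rewrite /ecoefs split2M.
rewrite (split2_sum _ _ n.+1 (fun k => p k * p' (n - k)%N - r k * (r' (n - k)%N)^*)
   (fun k => p k * r' (n - k)%N + r k * (p' (n - k)%N)^*)).
by rewrite /ecoefs /conv sumrB big_split.
Qed.

End Split.

Lemma entire_coef_conj p : entire_coef p -> entire_coef (fun n => (p n)^*).
Proof. by move=> hp s /hp[K hK]; exists K => n; rewrite cmod_conj. Qed.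

Lemma entire_coefD p r : entire_coef p -> entire_coef r -> entire_coef (fun n => p n + r n).
Proof.
move=> hp hr s s0; have [K hK] := hp _ s0; have [L hL] := hr _ s0; exists (K + L) => n.
apply: le_trans (lerD (hK n) (hL n)); rewrite -mulrDl ler_wpM2r ?exprn_ge0 ?(ltW s0)//.
exact: cmodD.
Qed.

Lemma entire_coefN p : entire_coef p -> entire_coef (fun n => - p n).
Proof. by move=> hp s /hp[K hK]; exists K => n; rewrite cmodN. Qed.

Section SliceRegularSeries.
Variables (psi : H -> H).
Hypothesis hpsi : slice_regular psi.

Lemma derive1_slice I (x y : R) (v : H) (l : R -> R[i]) (t0 : R) :
  (forall h, slice I (l (h + t0)) = h *: v + slice I (l t0)) ->
  derive1 (fun t => psi (slice I (l t))) t0 = 'd psi (slice I (l t0)) v.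
Proof.
move=> hl; have [dpsi _] := hpsi; rewrite -(deriveE _ (dpsi _)) /derive1 /derive.
by under eq_fun do rewrite hl.
Qed.

(** The slice equation gives d psi(I) = I d psi(1), so along [C_I] the differential is h -> h d
    psi(1). Since [cl I] commutes with left multiplication by [C_I], it turns this into a complex
    derivative. *)
Lemma slice_regular_cdiff I u : imaginary_unit I -> centire (fun z => cl I (psi (slice I z) * u)).
Proof.
move=> hI z; have [dpsi CR] := hpsi.
have dpsiz := dpsi (slice I z).
have := CR I hI (cRe z) (cIm z).
rewrite (@derive1_slice I 0 0 1 (fun t => Complex t (cIm z))); last first.
  by move=> h; rewrite /slice /= scalerDl addrA.
rewrite (@derive1_slice I 0 0 I (fun t => Complex (cRe z) t)); last first.
  by move=> h; rewrite /slice /= scalerDl addrCA.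
have -> : Complex (cRe z) (cIm z) = z by case: (z).
move/eqP; rewrite scaler_eq0 invr_eq0 pnatr_eq0 /= => /eqP cr.
have dI : 'd psi (slice I z) I = I * 'd psi (slice I z) 1.
  have : I * ('d psi (slice I z) 1 + I * 'd psi (slice I z) I) = 0 by rewrite cr mulr0.
  rewrite mulrDr mulrA -expr2 hI mulN1r => /eqP; rewrite subr_eq0 => /eqP -> //.
have dh w : 'd psi (slice I z) (slice I w) = slice I w * 'd psi (slice I z) 1.
  by rewrite /slice linearD !linearZ /= dI mulrDl -!scalerAl mul1r.
apply: (@approx_cdiff _ _ _ (cl I ('d psi (slice I z) 1 * u))) => e e0.
have u1 : 0 < 2 * (`|u| + 1) by rewrite mulr_gt0// ltr_wpDl.
have /eqaddoP/(_ _ (divr_gt0 e0 u1)) := diff_locally dpsiz.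
move=> /nbhs_ballP[d /= d0 hd]; exists (d / 2); first by rewrite divr_gt0.
move=> w wz.
have := hd (slice I (w - z)); rewrite -ball_normE /ball_ /= sub0r normrN norm_slice// => /(_ _).
have wd : cmod (w - z) < d by move: wz d0; clear; lra.
move=> /(_ wd); rewrite !fctE /= -sliceD subrK dh opprD addrA => hn.
rewrite -clB [cl I (_ 1 * u) * _]mulrC -cl_slice// -clB -mulrBl mulrA -mulrBl.
apply: (le_trans (cl_le _ hI)); rewrite quat_normM.
move: hn; rewrite mulrAC ler_pdivlMr// => hn; apply: le_trans hn.
by rewrite mulrCA ler_wpM2l// ler_wpM2l// lerDl.
Qed.

(* Both sides agree on the real axis; composed with the functionals [x |-> cl I' (x * u)], they are
   entire on each slice, hence agree there as well. *)
Lemma slice_regular_hps I J P Q : imaginary_unit I -> imaginary_unit J -> quat_orthogonal J I ->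
  centire P -> centire Q -> (forall z, psi (slice I z) = slice I (P z) + slice I (Q z) * J) ->
  exists p r, [/\ entire_coef p, entire_coef r,
    forall z, csums (fun n => z ^+ n * p n) (P z), forall z, csums (fun n => z ^+ n * r n) (Q z) &
    has_power_series psi (ecoefs I J p r)].
Proof.
move=> hI hJ hJI dP dQ hpq.
have [p [ep hp _]] := taylor dP; have [r [er hr _]] := taylor dQ.
exists p, r; split => //.
suff -> : psi = eseries I J p r by exact: eseries_hps.
have es := eseries_hps hI hJ ep er.
apply/funext => xi; have [I' [z [hI' ->]]] := slice_surj hI xi.
apply: (@cl_faithful I') => u.
have [b [eb hb _]] := taylor (slice_regular_cdiff u hI').
have real (x : R) : psi (x *: 1) = eseries I J p r (x *: 1).
  by rewrite -(slice_real I) hpq (eseries_slice hI hJ (hp _) (hr _)).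
have bE n : b n = cl I' (ecoefs I J p r n * u).
  apply: (csums_real_inj ltr01 (b := fun n => cl I' (ecoefs I J p r n * u))) => x _.
  by eexists; split; [exact: hb|rewrite slice_real real; exact: has_power_series_real].
apply: (csums_unique (hb z)).
have := cvg_cl u hI' (es (slice I' z)); apply: eq_csums => n.
by rewrite bE -mulrA -sliceX// cl_slice.
Qed.

End SliceRegularSeries.

End QuaternionSeries.

(** * Growth of the exponential of the symbol *)

Section Conjugation.
Context {R : realType}.
Implicit Types (z w : R[i]).

Lemma conjD z w : (z + w)^* = z^* + w^*. Proof. exact: rmorphD. Qed.
Lemma conjM z w : (z * w)^* = z^* * w^*. Proof. exact: rmorphM. Qed.
Lemma conjX z n : (z ^+ n)^* = z^* ^+ n. Proof. exact: rmorphXn. Qed.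
Lemma conjV z : (z^-1)^* = z^*^-1. Proof. exact: fmorphV. Qed.
Lemma conjR (r : R) : (r%:C%C : R[i])^* = r%:C%C. Proof. by rewrite conjE conjc_real. Qed.
Lemma conjn n : (n%:R : R[i])^* = n%:R. Proof. exact: rmorph_nat. Qed.

End Conjugation.

(** * Powers of a 2x2 matrix through its trace and determinant *)

Section Lucas.
Context {R : realType}.
Implicit Types (t d l : R[i]).

(* [M ^ n = (luc t d n).1 M + (luc t d n).2] for a 2x2 matrix [M] of trace [t] and determinant [d]. *)
Fixpoint luc t d n : R[i] * R[i] :=
  if n is m.+1 then (t * (luc t d m).1 + (luc t d m).2, - d * (luc t d m).1) else (0, 1).

Lemma luc_root t d l n : l ^+ 2 = t * l - d -> (luc t d n).1 * l + (luc t d n).2 = l ^+ n.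
Proof.
move=> hl; elim: n => [|n IH] /=; first by rewrite mul0r add0r expr0.
rewrite exprS -IH mulrDr [l * (_ * l)]mulrCA -expr2 hl; ring.
Qed.

Lemma luc_conj t d n : (luc t^* d^* n) = ((luc t d n).1^*, (luc t d n).2^*).
Proof.
elim: n => [|n IH] /=; first by rewrite rmorph0 rmorph1.
by rewrite IH /= rmorphD !rmorphM rmorphN.
Qed.

Lemma luc_bound t d n (m : R) : 1 + cmod t + cmod d <= m ->
  cmod (luc t d n).1 <= m ^+ n /\ cmod (luc t d n).2 <= m ^+ n.
Proof.
move=> hm; have t0 := cmod_ge0 t; have d0 := cmod_ge0 d; have m0 : 0 <= m by lra.
elim: n => [|n [IH1 IH2]] /=; first by rewrite cmod0 cmod1 expr0.
have mn : 0 <= m ^+ n by rewrite exprn_ge0.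
rewrite exprS; split.
  apply: (le_trans (cmodD _ _)); rewrite cmodM.
  apply: (@le_trans _ _ (cmod t * m ^+ n + m ^+ n)).
    by apply: lerD => //; rewrite ler_wpM2l.
  by rewrite -[X in _ + X]mul1r -mulrDl ler_wpM2r//; lra.
rewrite cmodM cmodN; apply: (@le_trans _ _ (cmod d * m ^+ n)); first by rewrite ler_wpM2l.
by rewrite ler_wpM2r//; lra.
Qed.

Lemma cdiff_luc (t d : R[i] -> R[i]) n : centire t -> centire d ->
  centire (fun z => (luc (t z) (d z) n).1) /\ centire (fun z => (luc (t z) (d z) n).2).
Proof.
move=> ht hd; elim: n => [|n [IH1 IH2]] /=; first by split => z; exact: cdiff_cst.
split => z; first by apply: cdiffD => //; exact: cdiffM.
by apply: cdiffM => //; exact: cdiffN.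
Qed.

End Lucas.

Section HolSeries.
Context {R : realType}.

(** The partial sums are the approximants. The sum itself is not shown to be entire: [hol] is what
    the sub-mean value inequalities ask for. *)
Lemma hol_series (g : nat -> R[i] -> R[i]) : (forall n, centire (g n)) ->
  (forall r : R, exists K : R, forall n z, cmod z <= r -> cmod (g n z) <= K * 2^-1 ^+ n) ->
  hol (fun z => csum (fun n => g n z)).
Proof.
move=> dg hK r e e0; have [K {}hK] := hK r.
have K1 : 0 < 4 * `|K| + 1 by rewrite ltr_wpDl// mulr_ge0.
have [N hN] := half_pow_small (divr_gt0 e0 K1).
exists (fun z => \sum_(k < N) g k z); split.
  by move=> z; apply: cdiff_sum => k; exact: dg.
move=> z zr; apply: le_trans (csum_tail (fun n => hK n z zr) N) _.
have := hN N (leqnn _); rewrite ler_pdivlMr//; apply: le_trans.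
rewrite [leRHS]mulrC ler_wpM2r ?exprn_ge0 ?invr_ge0//.
by have := ler_norm K; lra.
Qed.

Lemma hol_sharp (f : R[i] -> R[i]) : hol f -> hol (sharp f).
Proof.
move=> hf r e e0; have [g [dg hg]] := hf r e e0; exists (sharp g); split.
  by move=> z; apply: cdiff_sharp; exact: dg.
by move=> z zr; rewrite /sharp -rmorphB cmod_conj hg// cmod_conj.
Qed.

End HolSeries.

(** * The first row of the powers and of the exponential of the symbol *)

Section Symbol.
Context {R : realType}.
Variables (P Q : R[i] -> R[i]).
Hypotheses (dP : centire P) (dQ : centire Q).
Implicit Types (z w : R[i]).

Definition tr z : R[i] := P z + sharp P z.
Definition dt z : R[i] := P z * sharp P z + Q z * sharp Q z.

Lemma tr_conj z : (tr z^*)^* = tr z.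
Proof. by rewrite /tr /sharp conjD !conjCK addrC. Qed.

Lemma dt_conj z : (dt z^*)^* = dt z.
Proof.
by rewrite /dt /sharp conjD !conjM !conjCK; ring.
Qed.

Lemma centire_tr : centire tr.
Proof. by move=> z; apply: cdiffD => //; exact: cdiff_sharp. Qed.

Lemma centire_dt : centire dt.
Proof. by move=> z; apply: cdiffD; apply: cdiffM => //; exact: cdiff_sharp. Qed.

(* [(pF n z, pG n z)] is the first row of the [n]-th power of the matrix symbol. *)
Definition pF n z := (luc (tr z) (dt z) n).1 * P z + (luc (tr z) (dt z) n).2.
Definition pG n z := (luc (tr z) (dt z) n).1 * Q z.

Lemma luc_sharp n z : ((luc (tr z^*) (dt z^*) n).1)^* = (luc (tr z) (dt z) n).1 /\
  ((luc (tr z^*) (dt z^*) n).2)^* = (luc (tr z) (dt z) n).2.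
Proof. by rewrite -(tr_conj z) -(dt_conj z) luc_conj. Qed.

(** First row of A A^n: the lower row of A^n is the [sharp] of (-[pG n], [pF n]), hence the
    conjugated values at the conjugate point. *)
Lemma pF_step n z : P z * pF n z - Q z * (pG n z^*)^* = pF n.+1 z.
Proof.
have [h1 h2] := luc_sharp n z.
by rewrite /pF /pG conjM h1 /= /tr /dt /sharp; ring.
Qed.

Lemma pG_step n z : P z * pG n z + Q z * (pF n z^*)^* = pG n.+1 z.
Proof.
have [h1 h2] := luc_sharp n z.
by rewrite /pF /pG conjD conjM h1 h2 /= /tr /dt /sharp; ring.
Qed.

Variables (psi : quat R -> quat R) (I J : quat R).
Hypotheses (hI : imaginary_unit I) (hJ : imaginary_unit J) (hJI : quat_orthogonal J I).
Hypotheses (hpsi : slice_regular psi)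
  (split : forall z, psi (slice I z) = slice I (P z) + slice I (Q z) * J).

(** [star] reads its arguments only through their coefficients, so the induction carries a power
    series valid on all of the quaternions, together with its two components on [C_I]. *)
Lemma star_exp_series n : exists a b : nat -> R[i],
  [/\ entire_coef a, entire_coef b, has_power_series (star_exp psi n) (ecoefs I J a b),
   forall z, csums (fun n => z ^+ n * a n) (pF n z) &
   forall z, csums (fun n => z ^+ n * b n) (pG n z)].
Proof.
have [p [r [ep er hp hr hpr]]] := slice_regular_hps hpsi hI hJ hJI dP dQ split.
elim: n => [|n [a [b [ea eb hab ha hb]]]].
  (* The coefficients of the constant 1, the star power of exponent 0. *)
  pose a := fun n : nat => (n == 0)%:R : R[i].
  have sa z N : \sum_(k < N.+1) z ^+ k * a k = 1.
    by rewrite big_ord_recl big1 ?addr0 ?expr0 ?mul1r//= => i _; rewrite /a /= mulr0.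
  have ha z : csums (fun n => z ^+ n * a n) 1.
    by move=> e e0; exists 1%N => -[//|N] _; rewrite sa subrr cmod0 ltW.
  have hb z : csums (fun n => z ^+ n * (0 : R[i])) 0.
    by move=> e e0; exists 0%N => N _; rewrite big1 ?subrr ?cmod0 ?ltW// => i _; rewrite mulr0.
  exists a, (fun=> 0); split.
  - by apply: csums_entire_coef => z; exists 1.
  - by apply: csums_entire_coef => z; exists 0.
  - have -> : star_exp psi 0 = eseries I J a (fun=> 0).
      apply/funext => xi /=; apply/esym/cvg_lim => //.
      apply/cvgrPdist_le => e e0; exists 1%N => // -[//|N] _ /=.
      rewrite /series/= big_mkord big_ord_recl big1 ?addr0; last first.
        by move=> i _; rewrite /ecoefs /a /= /split2 !slice0 mul0r addr0 mulr0.
      by rewrite expr0 mul1r /ecoefs /a /split2 slice1 slice0 mul0r addr0 subrr normr0 ltW.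
    apply: (eseries_hps hI hJ) => //.
      by apply: csums_entire_coef => z; exists 1.
    by apply: csums_entire_coef => z; exists 0.
  - by move=> z; rewrite /pF /= mul0r add0r.
  - by move=> z; rewrite /pG /= mul0r.
have ebc := entire_coef_conj eb; have eac := entire_coef_conj ea.
have e1 : entire_coef (fun n => conv p a n - conv r (fun n => (b n)^*) n).
  by apply: entire_coefD; [exact: entire_coef_conv|apply: entire_coefN; exact: entire_coef_conv].
have e2 : entire_coef (fun n => conv p b n + conv r (fun n => (a n)^*) n).
  by apply: entire_coefD; exact: entire_coef_conv.
exists (fun n => conv p a n - conv r (fun n => (b n)^*) n),
       (fun n => conv p b n + conv r (fun n => (a n)^*) n); split => //.
- rewrite /star_exp iterS -/(star_exp psi n) (star_ecoefs hI hJ hJI ep er ea eb hpr hab).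
  exact: (eseries_hps hI hJ).
- move=> z; rewrite -pF_step.
  have hbc : csums (fun n => z ^+ n * (b n)^*) (pG n z^*)^*.
    by apply: eq_csums (csums_conj (hb z^*)) => k; rewrite rmorphM rmorphXn /= conjCK.
  have c1 := csums_conv_pow ep ea (hp z) (ha z).
  have c2 := csums_conv_pow er ebc (hr z) hbc.
  by apply: eq_csums (csumsD c1 (csumsN c2)) => k /=; rewrite mulrBr.
- move=> z; rewrite -pG_step.
  have hac : csums (fun n => z ^+ n * (a n)^*) (pF n z^*)^*.
    by apply: eq_csums (csums_conj (ha z^*)) => k; rewrite rmorphM rmorphXn /= conjCK.
  have c1 := csums_conv_pow ep eb (hp z) (hb z).
  have c2 := csums_conv_pow er eac (hr z) hac.
  by apply: eq_csums (csumsD c1 c2) => k /=; rewrite mulrDr.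
Qed.

Lemma star_exp_slice n z : star_exp psi n (slice I z) = split2 I J (pF n z) (pG n z).
Proof.
have [a [b [ea eb hab ha hb]]] := star_exp_series n.
have := eseries_slice hI hJ (ha z) (hb z) => <-.
have h1 := hab (slice I z).
have h2 : has_power_series (eseries I J a b) (ecoefs I J a b) by exact: (eseries_hps hI hJ).
have {}h2 := h2 (slice I z).
by rewrite -(cvg_lim _ h1)// -(cvg_lim _ h2).
Qed.

Variable alpha : R.
Hypothesis alpha0 : 0 < alpha.

Lemma kernel_coef_entire w :
  entire_coef (fun n => (alpha ^+ n / n`!%:R)%:C%C * w ^+ n).
Proof.
move=> r r0; exists (expR (r * (alpha * cmod w))) => n.
have := exp_coeff_le n (mulr_ge0 (ltW r0) (mulr_ge0 (ltW alpha0) (cmod_ge0 w))).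
apply: le_trans; rewrite cmodM cmod_real cmodX ger0_norm.
  by apply: eq_ler; rewrite !exprMn; ring.
by rewrite divr_ge0// exprn_ge0// ltW.
Qed.

Definition kerc w n : R[i] := (expR (- (alpha / 2) * cmod w ^+ 2))%:C%C *
  ((alpha ^+ n / n`!%:R)%:C%C * w^* ^+ n).

Lemma coefs_fock w : coefs (fock_kernel alpha (slice I w)) = fun n => slice I (kerc w n).
Proof.
apply: coefsE => xi; rewrite /fock_kernel norm_slice// slice_conj//.
set K := expR _.
have e0 : entire_coef (fun=> 0 : R[i]) by move=> r r0; exists 0 => n; rewrite cmod0 mul0r.
have h := @ecoefs_cvg _ _ _ hI hJ _ _ xi (kernel_coef_entire w^*) e0.
set u := (fun n => (alpha ^+ n / n`!%:R) *: (xi ^+ n * slice I w^* ^+ n)).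
have eu : (fun n => xi ^+ n * ecoefs I J (fun n => (alpha ^+ n / n`!%:R)%:C%C * w^* ^+ n) (fun=> 0) n) = u.
  apply/funext => n; rewrite /u /ecoefs /split2 slice0 mul0r addr0 slice_realM sliceX//.
  by rewrite scalerAr.
rewrite eu in h.
have -> : series (fun n => xi ^+ n * slice I (kerc w n)) = (fun n => K *: series u n).
  apply/funext => n; rewrite /series/= scaler_sumr; apply: eq_bigr => k _.
  by rewrite /kerc slice_realM -scalerAr; congr (_ *: _); rewrite /u slice_realM sliceX// scalerAr.
exact: cvgZr.
Qed.

Definition E1t w z n : R[i] := (alpha%:C%C * w) ^+ n / n`!%:R * pF n z.
Definition E2t w z n : R[i] := (alpha%:C%C * w) ^+ n / n`!%:R * pG n z.

Lemma symbol_bound (r : R) : exists2 M : R, 0 <= M & forall z n, cmod z <= r ->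
  cmod (pF n z) <= M * M ^+ n /\ cmod (pG n z) <= M * M ^+ n.
Proof.
have [M1 M10 h1] := hol_bounded r (centire_hol centire_tr).
have [M2 M20 h2] := hol_bounded r (centire_hol centire_dt).
have [M3 M30 h3] := hol_bounded r (centire_hol dP).
have [M4 M40 h4] := hol_bounded r (centire_hol dQ).
exists (1 + M1 + M2 + M3 + M4) => [|z n zr]; first by lra.
set M := 1 + M1 + M2 + M3 + M4.
have hm : 1 + cmod (tr z) + cmod (dt z) <= M.
  by have := h1 z zr; have := h2 z zr; rewrite /M; lra.
have [b1 b2] := luc_bound n hm.
have M0 : 0 <= M by rewrite /M; lra.
have Mn : 0 <= M ^+ n by rewrite exprn_ge0.
have p3 := h3 z zr; have p4 := h4 z zr.
split; rewrite /pF /pG.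
  apply: (le_trans (cmodD _ _)); rewrite cmodM.
  apply: (@le_trans _ _ (M ^+ n * M3 + M ^+ n * 1)).
    by apply: lerD; [apply: ler_pM; rewrite ?cmod_ge0|rewrite mulr1].
  by rewrite -mulrDr mulrC ler_wpM2r// /M; lra.
rewrite cmodM; apply: (@le_trans _ _ (M ^+ n * M4)).
  by apply: ler_pM; rewrite ?cmod_ge0.
by rewrite mulrC ler_wpM2r// /M; lra.
Qed.

(** The powers of the symbol grow at most geometrically on a disc and the factorial absorbs them.
    Uniformity in both variables makes [E1] the locally uniform limit of its partial sums in either
    of them. *)
Lemma E_geo (r s : R) : exists K : R, forall w z n, cmod z <= r -> cmod w <= s ->
  cmod (E1t w z n) <= K * 2^-1 ^+ n /\ cmod (E2t w z n) <= K * 2^-1 ^+ n.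
Proof.
have [M M0 hM] := symbol_bound r.
exists (M * expR (2 * (alpha * `|s| * M))) => w z n zr ws.
have [h1 h2] := hM z n zr.
have k : (alpha * cmod w) ^+ n / n`!%:R * (M * M ^+ n) <= M * expR (2 * (alpha * `|s| * M)) * 2^-1 ^+ n.
  have a0 : 0 <= alpha * `|s| * M by rewrite !mulr_ge0// ltW.
  have := exp_coeff_geo n a0 (ltr0Sn R 1) => h.
  apply: (@le_trans _ _ (M * ((alpha * `|s| * M) ^+ n / n`!%:R))); last by rewrite -[leRHS]mulrA ler_wpM2l.
  rewrite [leLHS](_ : _ = M * ((alpha * cmod w * M) ^+ n / n`!%:R)); last by rewrite [in RHS]exprMn; ring.
  rewrite ler_wpM2l// ler_wpM2r ?invr_ge0//; apply: lerXn2r; rewrite ?nnegrE ?mulr_ge0 ?cmod_ge0 ?(ltW alpha0)//.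
  by rewrite ler_wpM2r// ler_wpM2l ?(ltW alpha0)// (le_trans ws)// ler_norm.
have c : cmod ((alpha%:C%C * w) ^+ n / n`!%:R) = (alpha * cmod w) ^+ n / n`!%:R.
  by rewrite cmod_exp_coeff cmodM cmod_real ger0_norm ?ltW.
have c0 : 0 <= (alpha * cmod w) ^+ n / n`!%:R by rewrite -c cmod_ge0.
by split; rewrite cmodM c; apply: le_trans k; rewrite ler_wpM2l.
Qed.

(* [(E1 z w, E2 z w)] is the first row of the exponential of [alpha * w] times the matrix symbol. *)
Definition E1 z w := csum (E1t w z).
Definition E2 z w := csum (E2t w z).

Lemma csums_E1 z w : csums (E1t w z) (E1 z w).
Proof.
have [K hK] := E_geo (cmod z) (cmod w).
by apply: (@csum_geo _ _ K) => n; case: (hK w z n (lexx _) (lexx _)).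
Qed.

Lemma csums_E2 z w : csums (E2t w z) (E2 z w).
Proof.
have [K hK] := E_geo (cmod z) (cmod w).
by apply: (@csum_geo _ _ K) => n; case: (hK w z n (lexx _) (lexx _)).
Qed.

Lemma hol_E1_z w : hol (E1^~ w).
Proof.
apply: (@hol_series _ (fun n z => E1t w z n)).
  move=> n z; have [u1 u2] := cdiff_luc n centire_tr centire_dt.
  apply: cdiffM; first exact: cdiff_cst.
  by apply: cdiffD; [apply: cdiffM|].
move=> r; have [K hK] := E_geo r (cmod w).
by exists K => n z zr; case: (hK w z n zr (lexx _)).
Qed.

Lemma hol_E1_w z : hol (E1 z).
Proof.
apply: (@hol_series _ (fun n w => E1t w z n)).
  move=> n w; apply: cdiffM; last exact: cdiff_cst.
  apply: cdiffM; last exact: cdiff_cst.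
  by apply: cdiffX; apply: cdiffM; [exact: cdiff_cst|exact: cdiff_id].
move=> r; have [K hK] := E_geo (cmod z) r.
by exists K => n w wr; case: (hK w z n (lexx _) wr).
Qed.

(** The two components of the splitting are orthogonal, so one of them may be dropped. Coefficients
    of the kernel stand on the right, and passing them across J conjugates them: thus [E1] is
    evaluated at the conjugate of [w] and [E2] at [w]. *)
Lemma slice_comp_ge z w : expR (- (alpha / 2) * cmod w ^+ 2) * cmod (E1 z w^*) <=
  `|slice_comp (fock_kernel alpha (slice I w)) psi (slice I z)|.
Proof.
set K := expR _; have K0 : 0 <= K by exact: expR_ge0.
have h1 := csumsZ K%:C%C (csums_E1 z w^*); have h2 := csumsZ K%:C%C (csums_E2 z w).
have -> : slice_comp (fock_kernel alpha (slice I w)) psi (slice I z) =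
    split2 I J (K%:C%C * E1 z w^*) (K%:C%C * E2 z w).
  rewrite /slice_comp coefs_fock; apply: cvg_lim => //.
  have := cvg_split2 hI hJ h1 h2.
  rewrite (_ : (fun n => split2 I J _ _) = (fun n => star_exp psi n (slice I z) * slice I (kerc w n)))//.
  apply/funext => n; rewrite star_exp_slice.
  have -> : slice I (kerc w n) = split2 I J (kerc w n) 0 by rewrite /split2 slice0 mul0r addr0.
  rewrite split2M// rmorph0 !mulr0 subr0 add0r.
  have an : (alpha ^+ n / n`!%:R)%:C%C = alpha%:C%C ^+ n / n`!%:R :> R[i].
    by rewrite rmorphM/= rmorphXn/= fmorphV/= rmorph_nat.
  congr split2; rewrite /kerc /E1t /E2t -/K exprMn an; first by ring.
  by rewrite !conjM !conjX conjCK conjV conjn !conjR; ring.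
rewrite -ler_sqr ?nnegrE ?mulr_ge0 ?cmod_ge0//.
rewrite norm_split2//; have -> : K * cmod (E1 z w^*) = cmod (K%:C%C * E1 z w^*).
  by rewrite cmodM cmod_real ger0_norm.
by rewrite lerDl sqr_ge0.
Qed.

(** Termwise, the trace of A^n is l1^n + l2^n: [luc_root] writes both powers with the coefficients
    that express A^n. The eigenvalues enter only as two numbers of given sum and product, so no
    branch is chosen. *)
Lemma trace_E1 z w l1 l2 : l1 + l2 = tr z -> l1 * l2 = dt z ->
  E1 z w + (E1 z^* w^*)^* = cexp (alpha%:C%C * w * l1) + cexp (alpha%:C%C * w * l2).
Proof.
move=> h1 h2; apply: (csums_unique (csumsD (csums_E1 z w) (csums_conj (csums_E1 z^* w^*)))).
apply: eq_csums (csumsD (csums_cexp _) (csums_cexp _)) => n /=.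
have r1 : l1 ^+ 2 = tr z * l1 - dt z by rewrite -h1 -h2; ring.
have r2 : l2 ^+ 2 = tr z * l2 - dt z by rewrite -h1 -h2; ring.
rewrite exprMn [(_ * l2) ^+ n]exprMn -(luc_root n r1) -(luc_root n r2).
have [s1 s2] := luc_sharp n z.
rewrite /E1t /pF !conjM conjD conjM s1 s2 conjX conjM conjCK conjV conjn conjR.
have -> : (P z^*)^* = sharp P z by [].
have -> : l2 = P z + sharp P z - l1 by rewrite -[P z + _]h1; ring.
ring.
Qed.

End Symbol.

(** * Pointwise growth from the integral hypotheses *)

Section Growth.
Context {R : realType}.
Notation mu := (@lebesgue_measure R).
Notation mu2 := (mu \x mu)%E.
Notation T2 := (measurableTypeR R * measurableTypeR R)%type.
Implicit Types (z w : R[i]).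

(** Applied with [G] the integrand of [berezin], or a power of [berezin] as a function of w; by
    [ge0_le_integralT], measurability of neither has to be established. *)
Lemma le_integral_square (F G : R * R -> \bar R) z (r : R) :
  (forall u, square z r u -> (0 <= F u)%E) -> (forall u, (0 <= G u)%E) ->
  (forall u, square z r u -> (F u <= G u)%E) ->
  (\int[mu2]_(u in square z r) F u <= \int[mu2]_u G u)%E.
Proof.
move=> F0 G0 FG; rewrite integral_mkcond; apply: ge0_le_integralT => u; rewrite patchE.
  by case: ifPn => //; rewrite inE; exact: F0.
by case: ifPn => //; rewrite inE; exact: FG.
Qed.

Variables (P Q : R[i] -> R[i]).
Hypotheses (dP : centire P) (dQ : centire Q).
Variables (psi : quat R -> quat R) (I J : quat R).
Hypotheses (hI : imaginary_unit I) (hJ : imaginary_unit J) (hJI : quat_orthogonal J I).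
Hypotheses (hpsi : slice_regular psi)
  (split : forall z, psi (slice I z) = slice I (P z) + slice I (Q z) * J).
Variable alpha : R.
Hypothesis alpha0 : 0 < alpha.
Variable q : R.
Hypothesis q0 : 0 < q.

Notation E1 := (E1 P Q alpha).
Notation B := (berezin alpha q psi I).

(** On the square around [z] the Gaussian weight is at least its value at radius |z| + 2. Together
    with the normalisation of the kernel this is the factor [l], and the integral of |E1|^q over the
    square is at most b / l. *)
Lemma pointwise_berezin : exists2 C : R, 0 < C & forall z w (b : R), 0 <= b -> (B w <= b%:E)%E ->
  cmod (E1 z w^*) <= C * expR (alpha / 2 * (cmod w ^+ 2 + (cmod z + 2) ^+ 2)) * b `^ q^-1.
Proof.
have [C C0 hC] := submean_pow q0; exists C => // z w b b0 hb.
rewrite -mulrA; apply: (hC (E1^~ w^*)).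
- exact: hol_E1_z.
- by rewrite mulr_ge0 ?expR_ge0 ?powR_ge0.
set X := cmod w ^+ 2 + (cmod z + 2) ^+ 2.
pose l := expR (- (alpha * q / 2) * X).
have l0 : 0 < l by exact: expR_gt0.
have -> : (expR (alpha / 2 * X) * b `^ q^-1) `^ q = l^-1 * b.
  rewrite powRM ?expR_ge0 ?powR_ge0// -powRrM mulVf ?gt_eqF// powRr1// -expRM /l -expRN.
  by congr (expR _ * _); field.
have hol1 := hol_E1_z dP dQ alpha0 w^*.
have mF : measurable_fun (square z 1 : set T2) (fun u : T2 => (cmod (E1 (pt u) w^*) `^ q)%:E).
  by apply: measurable_funTS; exact: (measurable_powR_hol q hol1).
rewrite EFinM lee_pdivlMl//.
have ms : measurable (square z 1 : set T2) by exact: msquare.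
rewrite -ge0_integralZl//; last 2 first.
- by move=> u _; rewrite lee_fin powR_ge0.
- by rewrite lee_fin ltW.
apply: le_trans hb; rewrite /berezin /plane_integral.
apply: le_integral_square.
- by move=> u _; rewrite -EFinM lee_fin mulr_ge0 ?powR_ge0 ?ltW.
- by move=> u; rewrite lee_fin mulr_ge0 ?powR_ge0 ?expR_ge0.
move=> u su; rewrite -EFinM lee_fin.
have h1 := slice_comp_ge dP dQ hI hJ hJI hpsi split alpha0 (pt u) w.
have zu : cmod (pt u) <= cmod z + 2.
  by have := in_square_cmod su; have := cmodBr (pt u) z; lra.
rewrite -[Complex u.1 u.2]/(pt u) norm_slice//.
apply: (@le_trans _ _ ((expR (- (alpha / 2) * cmod w ^+ 2) * cmod (E1 (pt u) w^*)) `^ q *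
  expR (- (alpha * q / 2) * (cmod z + 2) ^+ 2))).
  rewrite powRM ?expR_ge0 ?cmod_ge0// -expRM mulrAC -expRD.
  rewrite ler_wpM2r ?powR_ge0// /l /X.
  by apply: eq_ler; congr expR; field.
apply: ler_pM; rewrite ?powR_ge0 ?expR_ge0//.
  by rewrite ge0_ler_powR ?nnegrE ?(ltW q0) ?mulr_ge0 ?expR_ge0 ?cmod_ge0.
rewrite ler_expR; have aq : 0 <= alpha * q / 2 by rewrite divr_ge0// mulr_ge0// ltW.
rewrite !mulNr lerN2 ler_wpM2l//.
by apply: lerXn2r; rewrite ?nnegrE ?cmod_ge0 ?addr_ge0 ?cmod_ge0.
Qed.

Lemma ereal_bound (x : \bar R) : (x < +oo)%E -> exists2 b : R, 0 <= b & (x <= b%:E)%E.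
Proof.
case: x => [r _|//|_]; last by exists 0; rewrite ?leNye.
by exists `|r|; rewrite ?lee_fin ?ler_norm.
Qed.

Lemma sqr_add2 (t : R) : 0 <= t -> t ^+ 2 <= (t + 2) ^+ 2.
Proof. by move=> t0; apply: lerXn2r; rewrite ?nnegrE ?addr_ge0// lerDl. Qed.

(* In the second case [|E1 z w^*| ^ (q * s)] is dominated by [B w ^ s], so that the sub-mean value
   inequality is applied once more, in [w] and with the exponent [q * s]. *)
Lemma growth_E1 (p : R) : 0 < p ->
  ((ereal_sup (range B) < +oo)%E \/
   (q < p /\ (plane_integral (fun w => B w `^ (p / (p - q))) < +oo)%E)) ->
  exists2 C : R, 0 < C & forall z w,
    cmod (E1 z w) <= C * expR (alpha / 2 * ((cmod z + 2) ^+ 2 + (cmod w + 2) ^+ 2)).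
Proof.
move=> p0 hyp; have [C1 C10 hC1] := pointwise_berezin.
have a2 : 0 <= alpha / 2 by rewrite divr_ge0// ltW.
case: hyp => [/ereal_bound[b b0 hb]|[qp /ereal_bound[A A0 hA]]].
  exists (C1 * b `^ q^-1 + 1); first by rewrite ltr_wpDl// mulr_ge0 ?powR_ge0// ltW.
  move=> z w.
  have := hC1 z w^* b b0 (le_trans (ereal_sup_ubound (ex_intro2 _ _ w^* Logic.I erefl)) hb).
  rewrite conjCK cmod_conj => /le_trans; apply.
  rewrite mulrAC; apply: ler_pM; rewrite ?mulr_ge0 ?powR_ge0 ?expR_ge0 ?(ltW C10)//.
    by rewrite lerDl.
  by rewrite ler_expR ler_wpM2l// addrC lerD2l sqr_add2// cmod_ge0.
pose s := p / (p - q); have pq : 0 < p - q by rewrite subr_gt0.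
have s0 : 0 < s by rewrite divr_gt0.
have qs0 : 0 < q * s by rewrite mulr_gt0.
have [C2 C20 hC2] := submean_pow qs0.
exists (C2 * C1 * A `^ (q * s)^-1 + 1).
  by rewrite ltr_wpDl// !mulr_ge0 ?powR_ge0// ltW.
move=> z w; set X := (cmod z + 2) ^+ 2 + (cmod w + 2) ^+ 2.
have [L L0 LE] : exists2 L, 0 < L & L = C1 * expR (alpha / 2 * X).
  by exists (C1 * expR (alpha / 2 * X)) => //; rewrite mulr_gt0// expR_gt0.
(* [pointwise_berezin] bounds [E1] at the conjugate of the Berezin parameter; [sharp] gives a
   holomorphic function of the parameter itself with the same modulus. *)
have hf : hol (sharp (E1 z)) by apply: hol_sharp; exact: hol_E1_w.
have fE v : cmod (sharp (E1 z) v) = cmod (E1 z v^*) by rewrite /sharp cmod_conj.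
have hK : 0 <= L * A `^ (q * s)^-1 by rewrite mulr_ge0 ?powR_ge0// ltW.
have := hC2 (sharp (E1 z)) w^* _ hf hK.
have -> : cmod (E1 z w) = cmod (sharp (E1 z) w^*) by rewrite fE conjCK.
move=> h.
apply: (@le_trans _ _ (C2 * (L * A `^ (q * s)^-1))); first apply: h; last first.
  rewrite LE (_ : C2 * _ = C2 * C1 * A `^ (q * s)^-1 * expR (alpha / 2 * X)); last by ring.
  by rewrite ler_wpM2r ?expR_ge0// lerDl.
have -> : (L * A `^ (q * s)^-1) `^ (q * s) = L `^ (q * s) * A.
  by rewrite powRM ?powR_ge0 ?(ltW L0)// -(powRrM A) mulVf ?gt_eqF// powRr1.
have Lq : 0 < L `^ (q * s) by rewrite powR_gt0.
rewrite -[L `^ (q * s)]invrK EFinM lee_pdivlMl ?invr_gt0//.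
have ms : measurable (square w^* 1 : set T2) by exact: msquare.
rewrite -ge0_integralZl//; last 3 first.
- by apply: measurable_funTS; exact: (measurable_powR_hol (q * s) hf).
- by move=> u _; rewrite lee_fin powR_ge0.
- by rewrite lee_fin invr_ge0 ltW.
apply: le_trans hA; apply: le_integral_square.
- by move=> u _; rewrite -EFinM lee_fin mulr_ge0 ?powR_ge0// invr_ge0 ltW.
- by move=> u; exact: poweR_ge0.
move=> u su; rewrite -[Complex u.1 u.2]/(pt u) fE.
have B0 : (0 <= B (pt u))%E.
  by apply: integral_ge0 => v _; rewrite lee_fin mulr_ge0 ?powR_ge0 ?expR_ge0.
(* Where [B] is infinite so is its power, as [s > 0], and the bound is void. *)
case: (B (pt u)) (B0) (hC1 z (pt u)) => [b| |] //; last first.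
  move=> _ _; rewrite -/s /poweR gt_eqF//; exact: leey.
rewrite lee_fin => b0 /(_ b b0 (lexx _)) hb.
rewrite -/s poweR_EFin -EFinM lee_fin ler_pdivrMl//.
have -> : L `^ (q * s) * b `^ s = (L * b `^ q^-1) `^ (q * s).
  by rewrite powRM ?powR_ge0 ?(ltW L0)// -(powRrM b) mulrA mulVf ?gt_eqF// mul1r.
rewrite ge0_ler_powR ?nnegrE ?cmod_ge0 ?(ltW qs0) ?mulr_ge0 ?powR_ge0 ?(ltW L0)//.
apply: (le_trans hb); rewrite ler_wpM2r ?powR_ge0// LE ler_wpM2l ?(ltW C10)//.
rewrite ler_expR ler_wpM2l// /X addrC lerD2l.
apply: lerXn2r; rewrite ?nnegrE ?cmod_ge0 ?addr_ge0 ?cmod_ge0//.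
have := in_square_cmod su; have := cmodBr (pt u) w^*; rewrite cmod_conj.
by move: (cmod (_ - _)) => k; lra.
Qed.

Lemma growth (p : R) : 0 < p ->
  ((ereal_sup (range B) < +oo)%E \/
   (q < p /\ (plane_integral (fun w => B w `^ (p / (p - q))) < +oo)%E)) ->
  exists2 C : R, 0 < C & forall z w l1 l2, l1 + l2 = tr P z -> l1 * l2 = dt P Q z ->
    cmod (cexp (alpha%:C%C * w * l1) + cexp (alpha%:C%C * w * l2)) <=
    C * expR (alpha / 2 * ((cmod z + 2) ^+ 2 + (cmod w + 2) ^+ 2)).
Proof.
move=> p0 /(growth_E1 p0)[C C0 hC]; exists (2 * C) => [|z w l1 l2 h1 h2]; first by rewrite mulr_gt0.
rewrite -(trace_E1 dP dQ alpha0 w h1 h2); apply: (le_trans (cmodD _ _)).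
have := hC z w; have := hC z^* w^*; rewrite !cmod_conj => e1 e2.
by apply: (le_trans (lerD e2 e1)); apply: eq_ler; ring.
Qed.

End Growth.

(** * Trace and discriminant are polynomials *)

Section RealAsymptotics.
Context {R : realType}.

(** The middle clause is what turns a nonconstant discriminant into one with negative leading
    coefficient. *)
Lemma quadratic_le0 (a b c : R) : (forall x, a * x ^+ 2 + b * x + c <= 0) ->
  [/\ a <= 0, (a = 0 -> b = 0) & c <= 0].
Proof.
move=> h; split; last by have := h 0; rewrite expr0n/= !mulr0 !add0r.
- rewrite leNgt; apply/negP => a0.
  pose x := 1 + (`|b| + `|c| + 1) / a.
  have xa : x * a = a + `|b| + `|c| + 1 by rewrite /x; field; rewrite gt_eqF.
  have x1 : 1 <= x by rewrite lerDl divr_ge0 ?(ltW a0)// !addr_ge0.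
  have := h x; rewrite leNgt => /negP; apply.
  have -> : a * x ^+ 2 + b * x + c = x * (x * a + b) + c by ring.
  rewrite xa; have := ler_norm (- b); have := ler_norm (- c); rewrite !normrN => hc hb.
  have : 1 * (`|c| + 1) <= x * (a + `|b| + `|c| + 1 + b).
    by apply: ler_pM; rewrite ?addr_ge0//; lra.
  by lra.
- move=> a0; apply/eqP/negP => /negP b0; have := h ((1 - c) / b).
  by rewrite a0 mul0r add0r mulrC divfK//; lra.
Qed.

(** The inequality is supposed only at some arbitrarily large points, since the slope estimates hold
    where the two exponentials do not cancel, and such points cannot be prescribed. *)
Lemma quadratic_dominates (a b c d : R) :
  (forall x, exists2 y, x <= y & a * y ^+ 2 <= b * y ^+ 2 + c * y + d) -> a <= b.
Proof.
move=> h; rewrite leNgt; apply/negP => ab; pose e := a - b.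
have e0 : 0 < e by rewrite subr_gt0.
have [y hy] := h (1 + (`|c| + `|d| + 1) / e).
apply/negP; rewrite -ltNge.
have y1 : 1 <= y by apply: le_trans hy; rewrite lerDl divr_ge0 ?(ltW e0)// !addr_ge0.
have ye : `|c| + `|d| + 1 <= e * y.
  rewrite -ler_pdivrMl//; apply: le_trans hy; rewrite mulrC lerDr//.
have : y * (`|c| + `|d| + 1) <= y * (e * y) by rewrite ler_wpM2l//; lra.
have -> : y * (e * y) = a * y ^+ 2 - b * y ^+ 2 by rewrite /e; ring.
have hc : c * y <= `|c| * y by rewrite ler_wpM2r ?ler_norm//; lra.
have hd : `|d| * 1 <= `|d| * y by rewrite ler_wpM2l.
have := ler_norm d; lra.
Qed.

(** Here [m] is the common modulus of the two conjugate eigenvalues at [x], and the last quantity is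
    the difference of the exponents of the two exponentials. As -Delta grows like x^2 and [m] at
    most like x, it exceeds 1 for large x. *)
Lemma quadratic_gap (alpha t0 t1 d0 d1 d2 x0 : R) : 0 < alpha -> d2 < 0 -> exists x : R,
  [/\ x0 <= x, 1 <= x, 0 < - (d2 * x ^+ 2 + d1 * x + d0) &
    forall m, 0 < m -> m ^+ 2 = ((t1 * x + t0) ^+ 2 - (d2 * x ^+ 2 + d1 * x + d0)) / 4 ->
      1 <= alpha * x * - (d2 * x ^+ 2 + d1 * x + d0) / (2 * m)].
Proof.
move=> alpha0 d20; have nd2 : 0 < - d2 by rewrite oppr_gt0.
have [K [K1 Kt Kd]] : exists K : R, [/\ 1 <= K, `|t1| + `|t0| <= K & `|d2| + `|d1| + `|d0| <= K].
  exists (1 + (`|t1| + `|t0|) + (`|d2| + `|d1| + `|d0|)).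
  have := normr_ge0 t1; have := normr_ge0 t0.
  by have := normr_ge0 d2; have := normr_ge0 d1; have := normr_ge0 d0; split; lra.
have q1 : 0 <= 2 * (`|d1| + `|d0|) / (- d2) by rewrite divr_ge0 ?mulr_ge0 ?addr_ge0// ltW.
have q2 : 0 <= 4 * K / (alpha * (- d2)).
  by rewrite divr_ge0 ?mulr_ge0 ?(ltW alpha0) ?(ltW nd2)//; lra.
have [x [xx0 x1 xa xb]] : exists x : R, [/\ x0 <= x, 1 <= x, 2 * (`|d1| + `|d0|) <= x * (- d2) &
    4 * K <= x * (alpha * (- d2))].
  exists (1 + `|x0| + 2 * (`|d1| + `|d0|) / (- d2) + 4 * K / (alpha * (- d2))).
  have n0 := normr_ge0 x0; have n1 := ler_norm x0.
  by split; [lra|lra|rewrite -ler_pdivrMr//; lra|rewrite -ler_pdivrMr ?mulr_gt0//; lra].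
exists x; have xp : 0 < x by lra.
have xx : x <= x ^+ 2 by rewrite expr2 ler_peMr// ltW.
have n2 : - d2 / 2 * x ^+ 2 <= - (d2 * x ^+ 2 + d1 * x + d0).
  have : d1 * x <= `|d1| * x by rewrite ler_wpM2r ?ler_norm// ltW.
  have : `|d0| * 1 <= `|d0| * x by rewrite ler_wpM2l.
  have : 2 * (`|d1| + `|d0|) * x <= x * (- d2) * x by rewrite ler_wpM2r// ltW.
  have := ler_norm d0; rewrite expr2; lra.
split=> //; first by apply: lt_le_trans n2; rewrite mulr_gt0 ?divr_gt0// exprn_gt0.
move=> m m0 m2; have K0 : 0 <= K by exact: le_trans K1.
have mK : m <= K * x.
  rewrite -(@ler_pXn2r _ 2 _ _ _ (ltW m0) (mulr_ge0 K0 (ltW xp)))//.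
  rewrite m2 exprMn.
  have b2 : (t1 * x + t0) ^+ 2 <= K ^+ 2 * x ^+ 2.
    rewrite -exprMn -real_normK ?num_real//.
    apply: lerXn2r; [exact: normr_ge0|exact: mulr_ge0 K0 (ltW xp)|].
    apply: (@le_trans _ _ ((`|t1| + `|t0|) * x)); last by rewrite ler_wpM2r ?(ltW xp).
    apply: (le_trans (ler_normD _ _)); rewrite normrM (ger0_norm (ltW xp)) mulrDl lerD2l.
    by rewrite ler_peMr.
  have b3 : - (d2 * x ^+ 2 + d1 * x + d0) <= K ^+ 2 * x ^+ 2.
    apply: (@le_trans _ _ (K * x ^+ 2)); last first.
      by rewrite ler_wpM2r ?sqr_ge0// expr2 ler_peMr//; lra.
    apply: (@le_trans _ _ ((`|d2| + `|d1| + `|d0|) * x ^+ 2)); last by rewrite ler_wpM2r ?sqr_ge0.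
    have c1 : - d2 * x ^+ 2 <= `|d2| * x ^+ 2 by rewrite ler_wpM2r ?sqr_ge0// -normrN ler_norm.
    have c2 : - d1 * x <= `|d1| * x ^+ 2.
      apply: (@le_trans _ _ (`|d1| * x)); first by rewrite ler_wpM2r ?(ltW xp)// -normrN ler_norm.
      by rewrite ler_wpM2l.
    have c3 : - d0 <= `|d0| * x ^+ 2.
      apply: (@le_trans _ _ `|d0|); first by rewrite -normrN ler_norm.
      by rewrite ler_peMr// (le_trans x1).
    lra.
  have := mulr_ge0 (sqr_ge0 K) (sqr_ge0 x); lra.
rewrite ler_pdivlMr ?mulr_gt0// mul1r.
apply: (@le_trans _ _ (2 * (K * x))); first by rewrite ler_wpM2l.
apply: (@le_trans _ _ (alpha * x * (- d2 / 2 * x ^+ 2))); last first.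
  by rewrite ler_wpM2l// mulr_ge0// ltW.
have g1 : 4 * K * x <= x * (alpha * - d2) * x by rewrite ler_wpM2r// ltW.
have g2 : x * (alpha * - d2) * x * 1 <= x * (alpha * - d2) * x * x.
  by rewrite ler_wpM2l// !mulr_ge0 ?ltW.
rewrite [leRHS](_ : _ = x * (alpha * - d2) * x * x / 2); last by ring.
lra.
Qed.

Lemma quad_step (t0 t1 d0 d1 d2 k x : R) :
  ((t1 * x + t0) ^+ 2 - (d2 * x ^+ 2 + d1 * x + d0)) / 4 <= (x + k) ^+ 2 ->
  (t1 ^+ 2 - d2) / 4 * x ^+ 2 <=
  1 * x ^+ 2 + (2 * k - (2 * t1 * t0 - d1) / 4) * x + (k ^+ 2 - (t0 ^+ 2 - d0) / 4).
Proof. lra. Qed.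

Lemma half_gap (a b c : R) : b * 2 <= a -> a - b <= c -> a <= 2 * c.
Proof. lra. Qed.

(** Division by alpha x; the 8 comes from (x + 2)^2 = x^2 + 4 x + 4 <= x^2 + 8 x for x >= 1. *)
Lemma slope_step (alpha c x m : R) : 0 < alpha -> 0 <= c -> 1 <= x ->
  alpha * (x * m) <= c + 1 + alpha * (x + 2) ^+ 2 -> m <= x + (8 + (c + 1) / alpha).
Proof.
move=> alpha0 c0 x1 h; have xp : 0 < x by lra.
rewrite -(ler_pM2l (mulr_gt0 alpha0 xp)) -mulrA; apply: (le_trans h).
rewrite [leRHS](_ : _ = alpha * x ^+ 2 + 8 * alpha * x + (c + 1) * x); last by field; rewrite gt_eqF.
have : (c + 1) * 1 <= (c + 1) * x by rewrite ler_wpM2l// addr_ge0.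
have : alpha * 1 <= alpha * x by rewrite ler_wpM2l ?(ltW alpha0).
rewrite (_ : alpha * (x + 2) ^+ 2 = alpha * x ^+ 2 + 4 * (alpha * x) + 4 * alpha); last by ring.
lra.
Qed.

End RealAsymptotics.

Section Directions.
Context {R : realType}.
Implicit Types (z w : R[i]).

(** Take w = r conj(t) / |t|; for t = 0 the witness is 0, hence an inequality for its modulus. *)
Lemma direction t (r : R) : 0 <= r ->
  exists w : R[i], cmod w <= r /\ w * t = (r * cmod t)%:C%C.
Proof.
move=> r0; have [->|t0] := eqVneq t 0; first by exists 0; rewrite cmod0 mul0r mulr0.
have m0 : 0 < cmod t by rewrite cmod_gt0.
exists ((r / cmod t)%:C%C * t^*); rewrite cmodM cmod_real cmod_conj ger0_norm ?divr_ge0 ?cmod_ge0//.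
split; first by rewrite divfK ?gt_eqF.
rewrite -mulrA [t^* * t]mulrC mul_conj -rmorphM/=; congr (_%:C%C).
by field; rewrite gt_eqF.
Qed.

Lemma cexp_pm (a b c d : R[i]) :
  cexp (a * b * ((c + d) / 2)) + cexp (a * b * ((c - d) / 2)) =
  cexp (a * b * (c / 2)) * (cexp (a * b * (d / 2)) + cexp (- (a * b * (d / 2)))).
Proof.
have -> : a * b * ((c + d) / 2) = a * b * (c / 2) + a * b * (d / 2) by ring.
have -> : a * b * ((c - d) / 2) = a * b * (c / 2) + - (a * b * (d / 2)) by ring.
by rewrite (cexpD (a * b * (c / 2)) (a * b * (d / 2))) (cexpD (a * b * (c / 2)) (- _)) -mulrDr.
Qed.

Lemma cmodDr z w : cmod z - cmod w <= cmod (z + w).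
Proof. by have := cmodBr z (- w); rewrite cmodN opprK. Qed.

Lemma imag_sqrt (nu : R) : exists rho : R[i],
  [/\ rho ^+ 2 = (- nu ^+ 2)%:C%C, rho^* = - rho & rho = Complex 0 nu].
Proof.
exists (Complex 0 nu); split=> //.
  by rewrite expr2; apply/eqP; rewrite eq_complex/=; apply/andP; split; apply/eqP; ring.
by rewrite conjE; apply/eqP; rewrite eq_complex/= oppr0 !eqxx.
Qed.

End Directions.

(** * Degrees and slopes from the growth estimate *)

Section Polynomiality.
Context {R : realType}.
Variables (tau Delta : R[i] -> R[i]) (alpha C : R).
Notation epair z w rho := (cmod (cexp (alpha%:C%C * w * ((tau z + rho) / 2)) +
  cexp (alpha%:C%C * w * ((tau z - rho) / 2)))).
Hypotheses (alpha0 : 0 < alpha) (C0 : 0 < C).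
Hypotheses (ctau : centire tau) (cDelta : centire Delta).
Hypothesis G : forall z w rho, rho ^+ 2 = Delta z ->
  epair z w rho <=
  C * expR (alpha / 2 * ((cmod z + 2) ^+ 2 + (cmod w + 2) ^+ 2)).
Implicit Types (z w : R[i]).

(** The logarithm of 1 + C rather than of C, so that [c0] is nonnegative and can be multiplied by
    powers of r >= 1. *)
Let c0 := ln (1 + C).

Lemma c0_ge0 : 0 <= c0.
Proof. by rewrite ln_ge0// lerDl ltW. Qed.

Lemma C_le : C <= expR c0.
Proof. by rewrite /c0 lnK ?posrE ?addr_gt0// lerDr. Qed.

Lemma growth_exp z w rho (r : R) : rho ^+ 2 = Delta z -> 1 <= r -> cmod z <= r -> cmod w <= r ->
  epair z w rho <=
  expR (c0 + alpha * (r + 2) ^+ 2).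
Proof.
move=> hr r1 zr wr; apply: (le_trans (G w hr)); rewrite expRD.
apply: ler_pM; rewrite ?expR_ge0 ?(ltW C0) ?C_le//.
rewrite ler_expR; have -> : alpha * (r + 2) ^+ 2 = alpha / 2 * ((r + 2) ^+ 2 + (r + 2) ^+ 2) by field.
rewrite ler_wpM2l ?divr_ge0 ?(ltW alpha0)//.
by apply: lerD; apply: lerXn2r; rewrite ?nnegrE ?addr_ge0 ?cmod_ge0 ?lerD2r//; lra.
Qed.

Lemma exists_sqrt z : exists rho : R[i], rho ^+ 2 = Delta z.
Proof. by exists (sqrtc (Delta z)); rewrite sqr_sqrtc. Qed.

(* For the two exponentials [X], [Y] one has [2XY = (X + Y)^2 - (X^2 + Y^2)], where [X^2 + Y^2] is the
   sum of the exponentials at [2w]; choose [w] such that [w * tau z >= 0]. *)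
Lemma trace_linear : exists2 K : R, 0 <= K & forall z, cmod (tau z) <= K * (cmod z + 1).
Proof.
(* The growth estimate is applied at radius 2 r because [w] is doubled; 2 r + 2 <= 4 r, and the
   exponent is doubled in bounding the product of the exponentials: 32 = 2 * 16. *)
exists (c0 * 2 / alpha + 32) => [|z].
  by rewrite addr_ge0// divr_ge0 ?mulr_ge0 ?c0_ge0// ltW.
pose r := cmod z + 1; have r1 : 1 <= r by rewrite lerDr cmod_ge0.
have r0 : 0 <= r by lra.
have ar : 0 < alpha * r by rewrite mulr_gt0//; lra.
have M2 : 2 * (c0 + alpha * (2 * r + 2) ^+ 2) <= (2 * c0 + 32 * alpha) * r ^+ 2.
  rewrite [leRHS]mulrDl [leLHS]mulrDr; apply: lerD.
    by rewrite ler_peMr ?mulr_ge0 ?c0_ge0// expr_ge1.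
  have r4 : 2 * r + 2 <= 4 * r by lra.
  rewrite [leRHS](_ : _ = 2 * (alpha * (4 * r) ^+ 2)); last by ring.
  rewrite ler_wpM2l// ler_wpM2l ?(ltW alpha0)//; apply: lerXn2r r4; rewrite nnegrE.
    by rewrite addr_ge0 ?mulr_ge0.
  by rewrite mulr_ge0.
have [rho hrho] := exists_sqrt z.
have [w [wr wt]] := direction (tau z) r0.
set X := fun w => cexp (alpha%:C%C * w * ((tau z + rho) / 2)).
set Y := fun w => cexp (alpha%:C%C * w * ((tau z - rho) / 2)).
have X2 : X (2 * w) = X w ^+ 2.
  by rewrite -cexpM2; congr cexp; ring.
have Y2 : Y (2 * w) = Y w ^+ 2.
  by rewrite -cexpM2; congr cexp; ring.
have XY : X w * Y w = cexp (alpha * (r * cmod (tau z)))%:C%C.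
  by rewrite -cexpD rmorphM/= -wt; congr cexp; field.
have h1 : cmod (X w + Y w) <= expR (c0 + alpha * (2 * r + 2) ^+ 2).
  by apply: growth_exp => //; rewrite ?/r; move: wr (cmod_ge0 z); rewrite /r; lra.
have h2 : cmod (X (2 * w) + Y (2 * w)) <= expR (c0 + alpha * (2 * r + 2) ^+ 2).
  apply: growth_exp => //; [lra|rewrite /r; have := cmod_ge0 z; lra|].
  by rewrite cmodM cmod_nat ler_wpM2l.
set M := c0 + alpha * (2 * r + 2) ^+ 2 in h1 h2.
have M0 : 0 <= M by rewrite addr_ge0 ?c0_ge0// mulr_ge0 ?(ltW alpha0)// sqr_ge0.
have : expR (alpha * (r * cmod (tau z))) <= expR (2 * M).
  have e : 2 * (X w * Y w) = (X w + Y w) ^+ 2 - (X (2 * w) + Y (2 * w)) by rewrite X2 Y2; ring.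
  have : cmod (2 * (X w * Y w)) <= expR M ^+ 2 + expR M.
    rewrite e; apply: (le_trans (cmodB _ _)); apply: lerD => //.
    by rewrite cmodX; apply: lerXn2r h1; rewrite nnegrE; [exact: cmod_ge0|exact: expR_ge0].
  rewrite cmodM cmod_nat XY cexp_real cmod_real ger0_norm ?expR_ge0//.
  rewrite -expRM_natl => h; rewrite -(@ler_pM2l _ 2)//; apply: (le_trans h).
  rewrite (_ : 2 * expR (2 * M) = expR (2 * M) + expR (2 * M)) ?lerD2l; last by ring.
  by rewrite ler_expR; apply: ler_peMl; rewrite ?ler1n.
rewrite ler_expR => h; rewrite -/r.
have rr : r <= r ^+ 2 by rewrite expr2 ler_peMr.
have := le_trans h M2.
rewrite [leLHS](_ : _ = (alpha * r) * cmod (tau z)); last by ring.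
rewrite [leRHS](_ : _ = (alpha * r) * ((c0 * 2 / alpha + 32) * r)); last by field; rewrite gt_eqF.
by rewrite (ler_pM2l ar).
Qed.

(* Factoring out [cexp (alpha * w * tau z / 2)] leaves [2 cosh (alpha * w * rho / 2)]; choose [w] such
   that [w * rho >= 0]. *)
Lemma discr_quadratic : exists2 K : R, 0 <= K & forall z, cmod (Delta z) <= K * (cmod z + 1) ^+ 2.
Proof.
have [K K0 hK] := trace_linear.
(* [K] pays for the factor exp(alpha w tau / 2), and 18 = 2 * 9 comes from (r + 2)^2 <= 9 r^2. *)
pose L := K + 2 * c0 / alpha + 18.
have L0 : 0 <= L by rewrite !addr_ge0// divr_ge0 ?mulr_ge0 ?c0_ge0// ltW.
exists (L ^+ 2) => [|z]; first exact: sqr_ge0.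
pose r := cmod z + 1; have r1 : 1 <= r by rewrite lerDr cmod_ge0.
have r0 : 0 <= r by lra.
have [rho hrho] := exists_sqrt z.
rewrite -hrho cmodX -exprMn -/r; apply: lerXn2r; rewrite ?nnegrE ?cmod_ge0 ?mulr_ge0//.
have [w [wr wt]] := direction rho r0.
have h1 : epair z w rho
    <= expR (c0 + alpha * (r + 2) ^+ 2).
  by apply: growth_exp => //; rewrite /r; have := cmod_ge0 z; lra.
pose s := alpha * (r * cmod rho) / 2.
have e1 : cexp (alpha%:C%C * w * ((tau z + rho) / 2)) + cexp (alpha%:C%C * w * ((tau z - rho) / 2)) =
   cexp (alpha%:C%C * w * (tau z / 2)) * (expR s + expR (- s))%:C%C.
  have sE : s%:C%C = alpha%:C%C * w * (rho / 2).
    rewrite -[RHS]mulrA [w * _]mulrA [RHS]mulrA.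
    by rewrite /s wt rmorphM fmorphV rmorphM/= rmorph_nat.
  have -> : (expR s + expR (- s))%:C%C = cexp s%:C%C + cexp (- s%:C%C) :> R[i].
    by rewrite rmorphD/= -rmorphN !cexp_real.
  by rewrite sE; exact: cexp_pm.
have h2 : expR (- (alpha * (r * (K * r)) / 2)) <= cmod (cexp (alpha%:C%C * w * (tau z / 2))).
  rewrite cmod_cexp ler_expR lerNl; apply: (@le_trans _ _ (cmod (alpha%:C%C * w * (tau z / 2)))).
    by apply: le_trans (ler_Re_cmod _); rewrite -normrN ler_norm.
  rewrite !cmodM cmod_real cmodV cmod_nat ger0_norm ?(ltW alpha0)//.
  rewrite mulrA ler_wpM2r// -mulrA ler_wpM2l ?(ltW alpha0)//.
  by apply: ler_pM; rewrite ?cmod_ge0// /r; exact: hK.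
have h3 : expR (- (alpha * (r * (K * r)) / 2)) * expR s <= expR (c0 + alpha * (r + 2) ^+ 2).
  apply: le_trans h1; rewrite e1 cmodM cmod_real ger0_norm ?addr_ge0 ?expR_ge0//.
  by apply: ler_pM; rewrite ?expR_ge0// lerDl expR_ge0.
move: h3; rewrite -expRD ler_expR => h3.
have h4 : c0 <= c0 * r ^+ 2 by rewrite ler_peMr ?c0_ge0// expr_ge1.
have h5 : alpha * (r + 2) ^+ 2 <= alpha * (9 * r ^+ 2).
  rewrite ler_wpM2l ?(ltW alpha0)// (_ : 9 * r ^+ 2 = (3 * r) ^+ 2); last by ring.
  by apply: lerXn2r; rewrite ?nnegrE; lra.
have h6 : s <= alpha * r / 2 * (L * r).
  rewrite /L (_ : alpha * r / 2 * _ = alpha * (r * (K * r)) / 2 + (c0 * r ^+ 2 + alpha * (9 * r ^+ 2))).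
    by lra.
  by field; rewrite gt_eqF.
move: h6; rewrite /s (_ : alpha * (r * cmod rho) / 2 = alpha * r / 2 * cmod rho); last by ring.
by rewrite ler_pM2l// !mulr_gt0//; lra.
Qed.

Hypothesis tau_real : forall x : R, exists y : R, tau x%:C%C = y%:C%C.
Hypothesis Delta_real : forall x : R, exists2 y : R, y <= 0 & Delta x%:C%C = y%:C%C.

Lemma trace_affine : exists t0 t1 : R, forall z, tau z = t1%:C%C * z + t0%:C%C.
Proof.
have [K K0 hK] := trace_linear.
have [a ha] := @liouville_poly _ tau K 1 ctau (fun z => hK z).
have [y0 e0] := tau_real 0; have [y1 e1] := tau_real 1.
have h z : tau z = a 0%N + a 1%N * z by rewrite ha big_ord_recr/= big_ord1 expr0 mulr1 expr1.
have a0 : a 0%N = y0%:C%C by rewrite -e0 h mulr0 addr0.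
have a1 : a 1%N = (y1 - y0)%:C%C by rewrite rmorphB/= -e1 -a0 h mulr1 addrC addKr.
by exists y0, (y1 - y0) => z; rewrite h a0 a1 addrC.
Qed.

Lemma discr_poly : exists d0 d1 d2 : R, forall z,
  Delta z = d2%:C%C * z ^+ 2 + d1%:C%C * z + d0%:C%C.
Proof.
have [K K0 hK] := discr_quadratic.
have [a ha] := @liouville_poly _ Delta K 2 cDelta (fun z => hK z).
have [y0 _ e0] := Delta_real 0; have [y1 _ e1] := Delta_real 1; have [y2 _ e2] := Delta_real (-1).
have h z : Delta z = a 0%N + a 1%N * z + a 2%N * z ^+ 2.
  by rewrite ha !big_ord_recr/= big_ord0 add0r expr0 mulr1 expr1.
have a0 : a 0%N = y0%:C%C by rewrite -e0 h expr0n/= !mulr0 !addr0.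
have a1 : a 1%N = ((y1 - y2) / 2)%:C%C.
  rewrite rmorphM fmorphV rmorphB rmorph_nat/= -e1 -e2 !h rmorphN/= -[(1 : R)%:C%C]/(1 : R[i]); by field.
have a2 : a 2%N = ((y1 + y2) / 2 - y0)%:C%C.
  rewrite rmorphB rmorphM fmorphV rmorphD rmorph_nat/= -e1 -e2 -a0 !h rmorphN/= -[(1 : R)%:C%C]/(1 : R[i]); by field.
exists y0, ((y1 - y2) / 2), ((y1 + y2) / 2 - y0) => z.
by rewrite h a0 a1 a2; ring.
Qed.

(* The sum of the exponentials is [c y = 2 cos (alpha * y * nu / 2)] up to its exponential factor, and
   [c (2y) = (c y)^2 - 2]; hence [|c| >= 1] at [y] or at [2y]. *)
Lemma slope_constant (t0 t1 nu : R) : (forall z, tau z = t1%:C%C * z + t0%:C%C) ->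
  (forall z, Delta z = (- nu ^+ 2)%:C%C) -> `|t1| <= 2.
Proof.
move=> ht hD; have [rho [rho2 rhoC _]] := imag_sqrt nu.
have hrho z : rho ^+ 2 = Delta z by rewrite hD.
suff : `|t1| / 2 <= 1 by lra.
(* Divided by alpha, the final estimate reads |t1| y^2 / 2 <= (y + 2)^2 + |t0| y / 2 + c0 /
   alpha. *)
apply: (@quadratic_dominates _ _ 1 (`|t0| / 2 + 4) (c0 / alpha + 4)) => x.
pose e (y : R) := cexp (alpha%:C%C * y%:C%C * (rho / 2)).
pose c y := cRe (e y) *+ 2.
have ec y : (e y)^* = cexp (alpha%:C%C * y%:C%C * (- rho / 2)).
  rewrite /e cexp_conj [in LHS]conjM [in LHS]conjM [X in _ * X]conjM conjV conjn rhoC.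
  by rewrite (conjR alpha) (conjR y).
have ce y : e y + (e y)^* = (c y)%:C%C.
  by rewrite conjE /c; case: (e y) => u v; apply/eqP; rewrite eq_complex/= mulr2n subrr !eqxx.
have e1 y : e y * (e y)^* = 1.
  by rewrite ec /e -cexpD -[RHS]cexp0; congr cexp; ring.
have c2 y : c (2 * y) = c y ^+ 2 - 2.
  apply: rcI; rewrite -ce rmorphB rmorphXn/= -ce rmorph_nat.
  have -> : e (2 * y) = e y ^+ 2 by rewrite /e -cexpM2 rmorphM rmorph_nat; congr cexp; ring.
  rewrite conjX; move: (e y) (e y)^* (e1 y) => a b ab.
  by rewrite (_ : (a + b) ^+ 2 = a ^+ 2 + b ^+ 2 + 2 * (a * b)); [rewrite ab mulr1 addrK|ring].
have dich (u : R) : 1 <= `|u| \/ 1 <= `|u ^+ 2 - 2|.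
  have [|h] := leP 1 `|u|; first by left.
  right; rewrite ler_normr; apply/orP; right.
  have : u ^+ 2 <= 1 by rewrite -real_normK ?num_real// expr_le1// ltW.
  lra.
have eE (y : R) : e y = cexp (alpha%:C%C * y%:C%C * (rho / 2)) by [].
clearbody c; clearbody e.
(* The direction is w = s y with s = 1 or -1, later chosen so that s t1 = |t1|; the cosine factor is
   even and does not see the sign. *)
have main y (s : R) : 1 <= y -> `|s| = 1 -> 1 <= `|c y| ->
    alpha * (s * (t1 * y + t0)) * y / 2 <= c0 + alpha * (y + 2) ^+ 2.
  move=> y1 s1 cy; rewrite -ler_expR.
  have ny : cmod (y%:C%C : R[i]) <= y by rewrite cmod_real ger0_norm//; lra.
  have nw : cmod ((s * y)%:C%C : R[i]) <= y by rewrite cmod_real normrM s1 mul1r ger0_norm//; lra.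
  apply: le_trans (growth_exp (hrho y%:C%C) y1 ny nw).
  have -> : cexp (alpha%:C%C * (s * y)%:C%C * ((tau y%:C%C + rho) / 2)) +
     cexp (alpha%:C%C * (s * y)%:C%C * ((tau y%:C%C - rho) / 2)) =
     cexp (alpha * (s * (t1 * y + t0)) * y / 2)%:C%C * (c y)%:C%C.
    have ss : s = 1 \/ s = -1.
      move: s1; have [s0|s0] := leP 0 s; first by rewrite ger0_norm//; left.
      by rewrite ltr0_norm// => h; right; lra.
    have p1 : alpha%:C%C * (s * y)%:C%C * ((t1%:C%C * y%:C%C + t0%:C%C) / 2) =
        (alpha * (s * (t1 * y + t0)) * y / 2)%:C%C :> R[i].
      by rewrite !rmorphM/= fmorphV rmorphD/= !rmorphM/= rmorph_nat; ring.
    have p2 : cexp (alpha%:C%C * (s * y)%:C%C * (rho / 2)) +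
        cexp (- (alpha%:C%C * (s * y)%:C%C * (rho / 2))) = (c y)%:C%C.
      rewrite -ce ec eE mulNr mulrN; case: ss => ->; first by rewrite mul1r.
      have -> : alpha%:C%C * (-1 * y)%:C%C * (rho / 2) = - (alpha%:C%C * y%:C%C * (rho / 2)).
        by rewrite mulN1r rmorphN/= mulrN mulNr.
      by rewrite opprK; exact: addrC.
    by rewrite ht cexp_pm p1 p2.
  rewrite cmodM cexp_real !cmod_real ger0_norm ?expR_ge0//.
  by rewrite ler_peMr ?expR_ge0.
have [y [yx y1 cy]] : exists y, [/\ x <= y, 1 <= y & 1 <= `|c y|].
  pose y := Num.max x 1.
  have yx : x <= y by rewrite le_max lexx.
  have y1 : 1 <= y by rewrite le_max lexx orbT.
  case: (dich (c y)) => h; first by exists y; split; [exact: yx|exact: y1|exact: h].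
  exists (2 * y); split; [lra|lra|].
  by rewrite c2.
exists y => //.
have [s s1 st] : exists2 s : R, `|s| = 1 & s * t1 = `|t1|.
  have [t10|t10] := leP 0 t1; first by exists 1; rewrite ?normr1// mul1r ger0_norm.
  by exists (-1); rewrite ?normrN1// mulN1r ltr0_norm.
have := main y s y1 s1 cy.
have hs : - `|t0| <= s * t0.
  by rewrite lerNl; apply: le_trans (ler_norm _) _; rewrite normrN normrM s1 mul1r.
rewrite (_ : s * (t1 * y + t0) = `|t1| * y + s * t0); last by rewrite -st; ring.
move=> h.
have h2 : alpha * (`|t1| * y - `|t0|) * y / 2 <= c0 + alpha * (y + 2) ^+ 2.
  apply: le_trans h; rewrite ler_wpM2r// ler_wpM2r//; first by lra.
  by rewrite ler_wpM2l ?(ltW alpha0)// lerD2l.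
rewrite -(ler_pM2l alpha0).
rewrite (_ : alpha * (1 * _ + _ + _) = c0 + alpha * (y + 2) ^+ 2 + alpha * `|t0| * y / 2); last by field; rewrite gt_eqF.
rewrite -lerBlDr; apply: le_trans h2; apply: eq_ler; by field.
Qed.

(* At real [x] the eigenvalues are conjugate, of modulus [m] with [4 m^2 = tau^2 - Delta]. Aligning [w]
   with one of them makes the other exponential smaller by a fixed factor. *)
Lemma slope_quadratic (t0 t1 d0 d1 d2 : R) : (forall z, tau z = t1%:C%C * z + t0%:C%C) ->
  (forall z, Delta z = d2%:C%C * z ^+ 2 + d1%:C%C * z + d0%:C%C) -> d2 < 0 ->
  t1 ^+ 2 - d2 <= 4.
Proof.
move=> ht hD d20; pose D x := d2 * x ^+ 2 + d1 * x + d0; pose T x := t1 * x + t0.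
suff : (t1 ^+ 2 - d2) / 4 <= 1 by lra.
pose k := 8 + (c0 + 1) / alpha.
apply: (@quadratic_dominates _ _ 1 (2 * k - (2 * t1 * t0 - d1) / 4) (k ^+ 2 - (t0 ^+ 2 - d0) / 4)) => x0.
have [x [xx0 x1 Dn gap]] := quadratic_gap t0 t1 d0 d1 x0 alpha0 d20.
exists x; first exact: xx0.
have xp : 0 < x by exact: lt_le_trans x1.
rewrite -/(D x) -/(T x) in Dn gap.
have [n n0 nn] : exists2 n : R, 0 < n & n ^+ 2 = - D x.
  by exists (Num.sqrt (- D x)); rewrite ?sqrtr_gt0// sqr_sqrtr// ltW.
have [rho [rho2 rhoC rhoE]] := imag_sqrt n.
have hrho : rho ^+ 2 = Delta x%:C%C.
  by rewrite rho2 nn opprK hD /D -rmorphXn -!rmorphM -!rmorphD.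
have tx : tau x%:C%C = (T x)%:C%C by rewrite ht /T rmorphD/= rmorphM.
have [l [lE l'E lR lI]] : exists l : R[i], [/\ (tau x%:C%C + rho) / 2 = l,
    (tau x%:C%C - rho) / 2 = l^*, cRe l = T x / 2 & cIm l = n / 2].
  exists (Complex (T x / 2) (n / 2)).
  have two : (2 : R[i]) = Complex 2 0 by rewrite -[RHS]/((2 : R)%:C%C) rmorph_nat.
  have half a b : (Complex a b : R[i]) / 2 = Complex (a / 2) (b / 2).
    apply: (@mulIf _ (2 : R[i])); rewrite ?pnatr_eq0// divfK ?pnatr_eq0// two.
    by apply/eqP; rewrite eq_complex/=; apply/andP; split; apply/eqP; field.
  rewrite tx rhoE; split=> //.
    by rewrite -half; congr (_ / _); apply/eqP; rewrite eq_complex/= addr0 add0r !eqxx.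
  rewrite conjE/= -mulNr -half; congr (_ / _).
  by apply/eqP; rewrite eq_complex/= subr0 add0r !eqxx.
pose m := cmod l.
have m2 : m ^+ 2 = (T x ^+ 2 - D x) / 4 by rewrite /m sqr_cmod lR lI !expr_div_n nn; field.
have l0 : l != 0.
  by apply/eqP => l0; move: lI; rewrite l0/= => /eqP; rewrite lt_eqF// divr_gt0.
have m0 : 0 < m by rewrite /m cmod_gt0.
have [w [wr wl]] := direction l (ltW xp).
have w_E : w = (x / m)%:C%C * l^*.
  apply: (mulIf l0); rewrite wl -mulrA [l^* * l]mulrC mul_conj -rmorphM/=; congr (_%:C%C).
  by rewrite -/m; field; rewrite gt_eqF.
have nx : cmod (x%:C%C : R[i]) <= x by rewrite cmod_real ger0_norm// ltW.
have := growth_exp hrho x1 nx wr; rewrite lE l'E.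
have X : cmod (cexp (alpha%:C%C * w * l)) = expR (alpha * (x * m)).
  by rewrite -mulrA wl -rmorphM/= cexp_real cmod_real ger0_norm ?expR_ge0.
(* The real part of conj(l)^2 is m^2 - 2 (Im l)^2 = m^2 - n^2 / 2, whence the loss alpha x n^2 / (2
   m), at least 1 by [gap]. *)
have Y : cmod (cexp (alpha%:C%C * w * l^*)) = expR (alpha * (x * m) - alpha * x * n ^+ 2 / (2 * m)).
  rewrite cmod_cexp w_E; congr expR.
  have -> : alpha%:C%C * ((x / m)%:C%C * l^*) * l^* = (alpha * (x / m))%:C%C * (l^* ^+ 2).
    by rewrite rmorphM; ring.
  rewrite cReM /= mul0r subr0 expr2 cReM conjE; move: lR lI; case: (l) => u v /= -> ->.
  have -> : alpha * (x * m) = alpha * x / m * m ^+ 2 by field; rewrite gt_eqF.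
  by rewrite m2 -[D x]opprK -nn; field; rewrite gt_eqF.
have {}gap := gap m m0 m2; rewrite -nn in gap; clearbody m.
move=> hg.
(* As e >= 2, the second exponential is at most half of the first, so the sum is at least half of
   the first; the resulting factor 2 is absorbed by c0 + 1. *)
have h1 : expR (alpha * (x * m)) <= expR (c0 + 1 + alpha * (x + 2) ^+ 2).
  have e2 : 2 <= expR 1 :> R by have := expR_ge1Dx (1 : R).
  have hY : expR (alpha * (x * m) - alpha * x * n ^+ 2 / (2 * m)) * expR 1 <= expR (alpha * (x * m)).
    by rewrite -expRD ler_expR -addrA gerDl addrC subr_le0.
  have hY2 : expR (alpha * (x * m) - alpha * x * n ^+ 2 / (2 * m)) * 2 <= expR (alpha * (x * m)).
    by apply: le_trans hY; rewrite ler_wpM2l ?expR_ge0.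
  have hs := cmodDr (cexp (alpha%:C%C * w * l)) (cexp (alpha%:C%C * w * l^*)).
  rewrite X Y in hs.
  have hh : expR (alpha * (x * m)) <= 2 * expR (c0 + alpha * (x + 2) ^+ 2).
    exact: half_gap hY2 (le_trans hs hg).
  apply: (le_trans hh); rewrite [c0 + 1 + _]addrAC [leRHS]expRD mulrC.
  by rewrite ler_wpM2l ?expR_ge0.
rewrite ler_expR in h1.
have mk : m <= x + k by exact: slope_step alpha0 c0_ge0 x1 h1.
have : m ^+ 2 <= (x + k) ^+ 2.
  by apply: lerXn2r; rewrite ?nnegrE ?(ltW m0)//; apply: le_trans mk; exact: ltW.
rewrite m2; exact: quad_step.
Qed.

End Polynomiality.

(** * A holomorphic square root of the discriminant *)

Section Convex.
Context {R : realType}.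
Implicit Types (U : set R[i]) (x y z v : R[i]) (t : R).

Lemma real_complex_continuous : continuous (fun t => t%:C%C : R[i]).
Proof.
move=> t; apply/cvgrPdist_le => e /complex_pos[r r0 ->].
apply/nbhs_ballP; exists r => //= s; rewrite /ball /= => h.
by rewrite -rmorphB cmodE cmod_real lecR ltW.
Qed.

Lemma line_continuous x v : continuous (fun t => x + t%:C%C * v).
Proof.
move=> t; apply: cvgD; first exact: cvg_cst.
by apply: cvgM; [exact: real_complex_continuous|exact: cvg_cst].
Qed.

Definition convex_set U := forall x y t, U x -> U y -> 0 <= t <= 1 -> U (x + t%:C%C * (y - x)).

Lemma convex_connected U : convex_set U -> U !=set0 -> connected U.
Proof.
move=> cU [x0 Ux0].
have -> : U = \bigcup_(y in U) [set x0 + t%:C%C * (y - x0) | t in `[0, 1]%classic].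
  apply/seteqP; split=> [y Uy|z [y Uy [t]]].
    by exists y => //; exists 1; rewrite /= ?in_itv/= ?ler01 ?lexx// mul1r addrC subrK.
  by rewrite /= in_itv/= => t01 <-; exact: cU.
apply: bigcup_connected.
  by exists x0 => y Uy; exists 0; rewrite /= ?in_itv/= ?ler01 ?lexx// mul0r addr0.
move=> y Uy; apply: connected_continuous_connected; first exact: segment_connected.
by apply: continuous_subspaceT; exact: line_continuous.
Qed.

(** Straight-line contraction onto the base point [g 0]; the ends of the loop stay fixed because
    [g 0 = g 1]. *)
Lemma convex_simply_connected U : convex_set U -> simply_connected U.
Proof.
move=> cU; split=> [x y Ux Uy|g [cg Ug] g01].
  exists (fun t => x + t%:C%C * (y - x)); split; last 2 first.
  - by rewrite mul0r addr0.
  - by rewrite mul1r addrC subrK.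
  split=> [|t t01]; last exact: cU.
  by apply: continuous_subspaceT; exact: line_continuous.
have U0 : U (g 0) by apply: Ug; rewrite lexx ler01.
exists (fun u : R * R => g u.2 + u.1%:C%C * (g 0 - g u.2)); split.
- apply/subspace_continuousP => -[s t] [/= s01 t01].
  have ct : g u.2 @[u --> within (`[0, 1]%classic `*` `[0, 1]%classic) (nbhs (s, t))] --> g t.
    move/subspace_continuousP : cg => /(_ t t01) cg.
    move=> A /cg hA.
    have h2 : nbhs (s, t) [set u : R * R | `[0, 1]%classic u.2 -> A (g u.2)].
      exact: (@cvg_snd _ _ (nbhs s) (nbhs t) _ _ hA).
    have : nbhs (s, t) [set u : R * R | (`[0, 1]%classic `*` `[0, 1]%classic) u -> A (g u.2)].
      by apply: filterS h2 => -[a b] /= h [_ /h].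
    exact.
  have cs : u.1%:C%C @[u --> within (`[0, 1]%classic `*` `[0, 1]%classic) (nbhs (s, t))] --> (s%:C%C : R[i]).
    move=> A hA; have h1 : nbhs s [set a : R | A a%:C%C] by exact: real_complex_continuous hA.
    have h2 : nbhs (s, t) [set u : R * R | A u.1%:C%C].
      exact: (@cvg_fst _ _ (nbhs s) (nbhs t) _ _ h1).
    have : nbhs (s, t) [set u : R * R | (`[0, 1]%classic `*` `[0, 1]%classic) u -> A u.1%:C%C].
      by apply: filterS h2 => -[a b] /= h _.
    exact.
  apply: cvgD; first exact: ct.
  apply: cvgM; first exact: cs.
  by apply: cvgB; [exact: cvg_cst|exact: ct].
- by move=> s t s01 t01; apply: cU => //; exact: Ug.
- by move=> t _; rewrite /= mul0r addr0.
- by move=> t _; rewrite /= mul1r addrC subrK.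
- by move=> s _; rewrite /= -g01 subrr mulr0 addr0.
Qed.

End Convex.

(** * A square root of (z + h)^2 + k on a right half-plane *)

Section HalfPlaneRoot.
Context {R : realType}.
Implicit Types (u z w : R[i]) (g S : R[i] -> R[i]).

(** The principal root a + i b has a >= 0, and a^2 = Re u + b^2 >= 3/4. *)
Lemma Re_sqrtc u : 3 / 4 <= cRe u -> 1 / 2 <= cRe (sqrtc u).
Proof.
move=> hu; have p0 : 0 <= cRe (sqrtc u) by case: u {hu} => a b; exact: sqrtr_ge0.
move: hu; rewrite -{1}(sqr_sqrtc u) expr2 cReM; move: p0; case: (sqrtc u) => a b /= a0 h.
have := sqr_ge0 b; nra.
Qed.

(** From (S w + S z)(S w - S z) = g w - g z, where the first factor has real part at least 1. This
    gives continuity of [S], and then the difference quotient of [g] divided by S w + S z is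
    continuous as well. *)
Lemma cdiff_sqrt g S z (d : R) : 0 < d -> cdiff g z ->
  (forall w, cmod (w - z) <= d -> S w ^+ 2 = g w /\ 1 / 2 <= cRe (S w)) -> cdiff S z.
Proof.
move=> d0 dg hS.
have [Sz Rz] : S z ^+ 2 = g z /\ 1 / 2 <= cRe (S z).
  by apply: hS; rewrite subrr cmod0 ltW.
have ge1 w : cmod (w - z) <= d -> 1 <= cmod (S w + S z).
  move=> /hS[_ Rw]; apply: le_trans (ler_Re_cmod _); apply: le_trans (ler_norm _).
  by rewrite cReD; lra.
have diff w : (S w + S z) * (S w - S z) = S w ^+ 2 - S z ^+ 2 by ring.
have cS : ccont S z.
  move=> e /(cdiff_ccont dg)[d1 d10 h1]; exists (Num.min d d1) => [|w].
    by rewrite lt_min d0.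
  rewrite le_min => /andP[wd wd1]; apply: le_trans (h1 _ wd1).
  rewrite -(hS _ wd).1 -Sz -diff cmodM ler_peMl ?cmod_ge0//; exact: ge1.
case: dg => phi [d1 [d10 cphi h1]].
exists (fun w => phi w * (S w + S z)^-1), (Num.min d d1); split.
- by rewrite lt_min d0.
- apply: ccontM => //; apply: (@ccontV _ (fun w => S w + S z)).
    by rewrite -cmod_gt0 (lt_le_trans _ (ge1 _ _))// subrr cmod0 ltW.
  by apply: ccontD => //; exact: ccont_cst.
- move=> w; rewrite le_min => /andP[wd wd1].
  have nz : S w + S z != 0 by rewrite -cmod_gt0 (lt_le_trans _ (ge1 _ wd)).
  apply: (mulfI nz); rewrite diff (hS _ wd).1 Sz h1//.
  by rewrite mulrA [_ * (phi w / _)]mulrCA divff// mulr1.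
Qed.

Variables (h k : R).

(* Here [|k / (z + h)^2| <= 1/4], so that [1 + k / (z + h)^2] has real part at least 3/4. *)
Definition half_plane : set R[i] := [set z | `|h| + 2 * (1 + `|k|) < cRe z].

Lemma half_plane_nbhs z : half_plane z ->
  exists2 d : R, 0 < d & forall w, cmod (w - z) <= d -> half_plane w.
Proof.
move=> Uz; have e0 : 0 < cRe z - (`|h| + 2 * (1 + `|k|)) by rewrite subr_gt0.
exists ((cRe z - (`|h| + 2 * (1 + `|k|))) / 2); first by rewrite divr_gt0.
move=> w /(le_trans (ler_Re_cmod _)); rewrite cReB ler_norml => /andP[h1 _].
by rewrite /half_plane /=; lra.
Qed.

Lemma half_plane_open : open half_plane.
Proof.
rewrite openE => z /half_plane_nbhs[d d0 hd]; rewrite /interior.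
apply/nbhs_ballP; exists d%:C%C; rewrite /= ?ltcR// => w.
by rewrite /ball /= cmodE ltcR cmodBC => /ltW; exact: hd.
Qed.

Lemma half_plane_convex : convex_set half_plane.
Proof.
move=> x y t; rewrite /half_plane /= cReD cReM cReB/= mul0r subr0 => hx hy /andP[t0 t1].
set m := (`|h| + _) in hx hy *.
have [->|t10] := eqVneq t 1; first by rewrite mul1r addrC subrK.
have : (1 - t) * m < (1 - t) * cRe x by rewrite ltr_pM2l// subr_gt0 lt_neqAle t10.
have : t * m <= t * cRe y by rewrite ler_wpM2l// ltW.
lra.
Qed.

Lemma half_plane_real (x : R) : `|h| + 2 * (1 + `|k|) < x -> half_plane x%:C%C.
Proof. by []. Qed.

Lemma half_plane_region : region half_plane.
Proof.
have ne : half_plane !=set0.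
  by exists (`|h| + 2 * (1 + `|k|) + 1)%:C%C; apply: half_plane_real; rewrite ltrDl.
by split => //; [exact: half_plane_open|exact: convex_connected half_plane_convex ne].
Qed.

Lemma half_plane_unbounded : ~ bounded_set half_plane.
Proof.
move=> [M [Mr hM]].
have Mx : M < (cmod M + 1)%:C%C.
  by apply: le_lt_trans (real_ler_norm Mr) _; rewrite cmodE ltcR ltrDl.
have y0 : 0 <= `|h| + 2 * (1 + `|k|) by rewrite !(addr_ge0, mulr_ge0).
have c0 := cmod_ge0 M.
have Uy : half_plane (`|h| + 2 * (1 + `|k|) + (cmod M + 2))%:C%C.
  by apply: half_plane_real; lra.
have := hM _ Mx _ Uy; rewrite /= cmodE lecR cmod_real ger0_norm; lra.
Qed.

Lemma half_plane_sharp : half_plane = sharp_set half_plane.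
Proof.
apply/seteqP; split=> [z Uz|_ [z Uz <-]].
  by exists z^*; rewrite ?conjCK// /half_plane /= conjE; case: z Uz.
by rewrite /half_plane /= conjE; case: z Uz.
Qed.

(** The factorisation (z + h)^2 + k = zeta^2 (1 + k / zeta^2) isolates a factor near 1, whose
    principal root is holomorphic on the half-plane. *)
Let zeta z := z + h%:C%C.
Let gr z := 1 + k%:C%C / zeta z ^+ 2.

Lemma zeta_ge z : half_plane z -> 2 * (1 + `|k|) <= cmod (zeta z).
Proof.
rewrite /half_plane /= => Uz.
apply: le_trans (ler_Re_cmod _); apply: le_trans (ler_norm _); rewrite cReD /=.
have := ler_norm (- h); rewrite normrN; lra.
Qed.

Lemma zeta_neq0 z : half_plane z -> zeta z != 0.
Proof.
by move=> /zeta_ge Uz; rewrite -cmod_gt0; apply: lt_le_trans Uz; rewrite mulr_gt0// ltr_pwDl.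
Qed.

Lemma Re_gr z : half_plane z -> 3 / 4 <= cRe (gr z).
Proof.
move=> Uz; have zg := zeta_ge Uz; have k0 := normr_ge0 k.
have : cmod (k%:C%C / zeta z ^+ 2) <= 1 / 4.
  rewrite cmodM cmodV cmodX cmod_real ler_pdivrMr ?exprn_gt0 ?cmod_gt0 ?zeta_neq0//.
  have : (2 * (1 + `|k|)) ^+ 2 <= cmod (zeta z) ^+ 2.
    by apply: lerXn2r zg; rewrite nnegrE ?cmod_ge0// mulr_ge0// addr_ge0.
  by have := sqr_ge0 k; rewrite -(real_normK (num_real k)); lra.
move=> /(le_trans (ler_Re_cmod _)); rewrite ler_norml => /andP[hn _].
by rewrite /gr cReD /=; lra.
Qed.

Definition root_factor z := zeta z * sqrtc (gr z).

Lemma sqr_root_factor z : half_plane z -> root_factor z ^+ 2 = zeta z ^+ 2 + k%:C%C.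
Proof.
move=> Uz; rewrite exprMn sqr_sqrtc /gr mulrDr mulr1 mulrCA divff ?mulr1//.
by rewrite expf_neq0// zeta_neq0.
Qed.

Lemma cdiff_root_factor z : half_plane z -> cdiff root_factor z.
Proof.
move=> Uz; have dz : cdiff zeta z by apply: cdiffD; [exact: cdiff_id|exact: cdiff_cst].
have [d d0 hd] := half_plane_nbhs Uz.
apply: cdiffM => //; apply: (cdiff_sqrt (g := gr) d0).
  apply: cdiffD; first exact: cdiff_cst.
  apply: cdiffM; first exact: cdiff_cst.
  apply: (@cdiffV _ (fun w => zeta w ^+ 2)); first by rewrite expf_neq0// zeta_neq0.
  exact: cdiffX.
move=> w /hd Uw; split; first exact: sqr_sqrtc.
by apply: Re_sqrtc; exact: Re_gr.
Qed.

(** With s the root of [gr z], (root - zeta)(s + 1) = zeta (s^2 - 1) = k / zeta, while |s + 1| >= 1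
    and |zeta| >= |z| / 2. *)
Lemma root_factor_asymptotic z : half_plane z -> 2 * `|h| <= cmod z -> 0 < cmod z ->
  cmod (root_factor z - zeta z) <= 2 * `|k| / cmod z.
Proof.
move=> Uz hz z0; have nz := zeta_neq0 Uz.
have Rs := Re_sqrtc (Re_gr Uz); set s := sqrtc (gr z) in Rs.
have s1 : 1 <= cmod (s + 1).
  by apply: le_trans (ler_Re_cmod _); apply: le_trans (ler_norm _); rewrite cReD /=; lra.
have e : (root_factor z - zeta z) * (s + 1) = k%:C%C / zeta z.
  have s2 : s ^+ 2 = gr z by exact: sqr_sqrtc.
  have -> : (root_factor z - zeta z) * (s + 1) = zeta z * (s ^+ 2 - 1).
    by rewrite /root_factor -/s; ring.
  by rewrite s2 /gr; field.
have zz : cmod z / 2 <= cmod (zeta z).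
  have := cmodBr z (- h%:C%C); rewrite cmodN cmod_real opprK -/(zeta z); lra.
apply: (@le_trans _ _ (cmod ((root_factor z - zeta z) * (s + 1)))).
  by rewrite cmodM ler_peMr ?cmod_ge0.
rewrite e cmodM cmodV cmod_real -mulrA [2 * _]mulrC -mulrA ler_wpM2l//.
by rewrite [leRHS]mulrC -invf_div lef_pV2 ?posrE ?cmod_gt0 ?divr_gt0.
Qed.

End HalfPlaneRoot.

(** * The discriminant on the real axis and its zeros *)

Section Symbol.
Context {R : realType}.
Implicit Types (P Q : R[i] -> R[i]) (z : R[i]) (x : R).

Lemma symbol_discrE P Q z : symbol_discr P Q z = tr P z ^+ 2 - 4 * dt P Q z.
Proof. by rewrite /symbol_discr /tr /dt; ring. Qed.

Lemma symbol_trace_real P x : exists y : R, symbol_trace P x%:C%C = y%:C%C.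
Proof.
rewrite /symbol_trace /sharp conjR conjE; case: (P _) => a b; exists (a + a).
by apply/eqP; rewrite eq_complex/= subrr !eqxx.
Qed.

Lemma symbol_discr_real P Q x : symbol_discr P Q x%:C%C =
  (- 4 * (cIm (P x%:C%C) ^+ 2 + cmod (Q x%:C%C) ^+ 2))%:C%C.
Proof.
rewrite /symbol_discr /sharp conjR -mulrA mul_conj conjE; case: (P _) => a b /=.
have -> : (Complex a b - Complex a (- b)) ^+ 2 = (- 4 * b ^+ 2)%:C%C :> R[i].
  by rewrite expr2; apply/eqP; rewrite eq_complex/=; apply/andP; split; apply/eqP; ring.
by rewrite -(rmorph_nat (real_complex R) 4) -rmorphM -rmorphB; congr (_%:C%C); ring.
Qed.

(** On the real axis the discriminant is -4 ((Im P)^2 + |Q|^2); were it zero there, [Q] would vanish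
    on the real axis, hence identically by the identity theorem. *)
Lemma symbol_discr_neq0 P Q : centire Q -> (exists z, Q z <> 0) ->
  exists x, symbol_discr P Q x%:C%C <> 0.
Proof.
move=> /taylor[a [_ ha _]] [z Qz]; apply: contrapT => /forallNP h; apply: Qz.
have a0 : forall n, a n = 0.
  apply: (@csums_real_eq0 _ a 1) => // x _.
  suff <- : Q x%:C%C = 0 by exact: ha.
  have := h x; rewrite notK symbol_discr_real => /eqP.
  rewrite -[X in _ == X]/((0 : R)%:C%C) (inj_eq (@rcI R)) mulf_eq0 oppr_eq0 pnatr_eq0/=.
  by rewrite paddr_eq0 ?sqr_ge0// => /andP[_]; rewrite expf_eq0/= cmod_eq0 => /eqP.
apply: (csums_unique (ha z)) => e e0; exists 0%N => n _.
by rewrite big1 ?subr0 ?cmod0 ?ltW// => k _; rewrite a0 mulr0.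
Qed.

(** Excludes a nonzero leading coefficient when the discriminant has no zeros. *)
Lemma quadratic_root (d0 d1 d2 : R) : d2 != 0 ->
  exists z, d2%:C%C * z ^+ 2 + d1%:C%C * z + d0%:C%C = 0.
Proof.
move=> d2n; have dn : d2%:C%C != 0 :> R[i] by rewrite -cmod_gt0 cmod_real normr_gt0.
pose s := sqrtc ((d1 ^+ 2 - 4 * d2 * d0)%:C%C); exists ((s - d1%:C%C) / (2 * d2%:C%C)).
have : s ^+ 2 = d1%:C%C ^+ 2 - 4 * d2%:C%C * d0%:C%C.
  by rewrite sqr_sqrtc rmorphB rmorphXn !rmorphM/= rmorph_nat.
move: s => s hs.
have -> : d2%:C%C * ((s - d1%:C%C) / (2 * d2%:C%C)) ^+ 2 + d1%:C%C * ((s - d1%:C%C) / (2 * d2%:C%C)) +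
   d0%:C%C = (s ^+ 2 - d1%:C%C ^+ 2 + 4 * d2%:C%C * d0%:C%C) / (4 * d2%:C%C) by field.
by rewrite hs; apply/eqP; rewrite mulf_eq0; apply/orP; left; apply/eqP; ring.
Qed.

Lemma slope_bounds (t delta : R) : 0 < delta -> t ^+ 2 + delta ^+ 2 <= 4 ->
  0 < cmod (Complex (t / 2) (delta / 2)) <= 1.
Proof.
move=> d0 h; apply/andP; split.
  by rewrite cmod_gt0 eq_complex/= negb_and; apply/orP; right; rewrite gt_eqF// divr_gt0.
rewrite -(@ler_pXn2r _ 2)// ?nnegrE ?cmod_ge0// sqr_cmod/= expr1n; lra.
Qed.

End Symbol.

(** * Eigenvalue branches at infinity *)

Section Branches.
Context {R : realType}.
Variables (tau Delta : R[i] -> R[i]) (t0 t1 d0 d1 d2 : R).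
Hypotheses (htau : forall z, tau z = t1%:C%C * z + t0%:C%C).
Hypotheses (hDelta : forall z, Delta z = d2%:C%C * z ^+ 2 + d1%:C%C * z + d0%:C%C).
Hypotheses (d2n : d2 < 0) (slope : t1 ^+ 2 - d2 <= 4).

(** Write d2 = -delta^2 and complete the square: [rho] is i delta times the root of (z + h)^2 + k,
    asymptotic to i delta (z + h). The slopes (t1 + i delta) / 2 and (t1 - i delta) / 2 are
    conjugate, which gives equal moduli, and their squared modulus is (t1^2 - d2) / 4 <= 1. *)
Lemma eigenvalue_branches : exists (U : set R[i]) (rho : R[i] -> R[i]),
  [/\ region U, ~ bounded_set U, simply_connected U & U = sharp_set U] /\
  [/\ holomorphic_on U rho, forall z, U z -> rho z ^+ 2 = Delta z &
      exists ap am bp bm : R[i],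
        [/\ affine_asymptotic U (fun z => (tau z + rho z) / 2) ap bp,
            affine_asymptotic U (fun z => (tau z - rho z) / 2) am bm,
            0 < `|ap| <= 1, 0 < `|am| <= 1 & `|ap| = `|am|]].
Proof.
have [h [k [e1 e2]]] : exists h k : R, 2 * d2 * h = d1 /\ d2 * (h ^+ 2 + k) = d0.
  exists (d1 / (2 * d2)), (d0 / d2 - (d1 / (2 * d2)) ^+ 2); split.
    by field; rewrite lt_eqF.
  by rewrite addrC subrK mulrC divfK// lt_eqF.
have [delta del0 del2] : exists2 delta : R, 0 < delta & delta ^+ 2 = - d2.
  by exists (Num.sqrt (- d2)); rewrite ?sqrtr_gt0 ?oppr_gt0// sqr_sqrtr// oppr_ge0 ltW.
have [i [i2 iC iE]] := imag_sqrt delta.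
have DE z : Delta z = i ^+ 2 * ((z + h%:C%C) ^+ 2 + k%:C%C).
  have f1 : d1%:C%C = 2 * d2%:C%C * h%:C%C :> R[i] by rewrite -e1 !rmorphM/= rmorph_nat.
  have f2 : d0%:C%C = d2%:C%C * (h%:C%C ^+ 2 + k%:C%C) :> R[i].
    by rewrite -e2 rmorphM rmorphD rmorphXn.
  by rewrite hDelta i2 del2 opprK f1 f2; ring.
have cmi : cmod i = delta by rewrite -[RHS]gtr0_norm// -sqrtr_sqr /cmod iE/= expr0n add0r.
have ci2 (u : R[i]) : cmod (i * u / 2) = delta / 2 * cmod u.
  by rewrite !cmodM cmodV cmod_nat cmi mulrAC.
exists (half_plane h k), (fun z => i * root_factor h k z); split.
  split; [exact: half_plane_region|exact: half_plane_unbounded| |exact: half_plane_sharp].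
  by apply: convex_simply_connected; exact: half_plane_convex.
split.
- move=> z Uz; apply: cdiff_derivable.
  by apply: cdiffM; [exact: cdiff_cst|exact: cdiff_root_factor].
- by move=> z Uz; rewrite exprMn sqr_root_factor// DE.
(* Both branches at once, with [e] equal to 1 or -1. *)
have asym (e : R[i]) F a b : cmod e = 1 ->
    (forall z, F z = (tau z + e * (i * root_factor h k z)) / 2) ->
    a = (t1%:C%C + e * i) / 2 -> b = (t0%:C%C + e * (i * h%:C%C)) / 2 ->
    affine_asymptotic (half_plane h k) F a b.
  move=> ce FE -> ->; exists (delta / 2 * (2 * `|k|)), (2 * `|h| + 1); split.
    by rewrite ltr_wpDl// mulr_ge0.
  move=> z Uz; rewrite cmodE lecR => rz.
  have hz : 2 * `|h| <= cmod z by lra.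
  have z0 : 0 < cmod z by have := normr_ge0 h; lra.
  have -> : F z -
     ((t1%:C%C + e * i) / 2 * z + (t0%:C%C + e * (i * h%:C%C)) / 2) =
     e * (i * (root_factor h k z - (z + h%:C%C)) / 2).
    by rewrite FE htau; field.
  rewrite cmodE -fmorphV -rmorphM lecR cmodM ce mul1r ci2 -[leRHS]mulrA.
  by rewrite ler_wpM2l ?divr_ge0 ?(ltW del0)//; exact: root_factor_asymptotic.
exists ((t1%:C%C + i) / 2), ((t1%:C%C - i) / 2), ((t0%:C%C + i * h%:C%C) / 2), ((t0%:C%C - i * h%:C%C) / 2).
have two : (2 : R[i])^-1 = (2^-1)%:C%C by rewrite fmorphV rmorph_nat.
have apE : (t1%:C%C + i) / 2 = Complex (t1 / 2) (delta / 2).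
  by rewrite two iE; apply/eqP; rewrite eq_complex/=; apply/andP; split; apply/eqP; ring.
have amE : (t1%:C%C - i) / 2 = (Complex (t1 / 2) (delta / 2))^*.
  by rewrite two iE conjE; apply/eqP; rewrite eq_complex/=; apply/andP; split; apply/eqP; ring.
have /andP[b0 b1] : 0 < cmod (Complex (t1 / 2) (delta / 2)) <= 1.
  by apply: slope_bounds => //; rewrite del2.
split.
- by apply: (asym 1); rewrite ?cmod1 ?mul1r// => z; rewrite mul1r.
- by apply: (asym (-1)); rewrite ?cmodN ?cmod1 ?mulN1r// => z; rewrite mulN1r.
- by rewrite apE cmodE ltcR b0 lecR.
- by rewrite amE cmodE cmod_conj ltcR b0 lecR.
- by rewrite apE amE !cmodE cmod_conj.
Qed.

End Branches.

(** * Deduction of the four assertions from the growth estimate *)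

Unset Implicit Arguments.
Set Strict Implicit.
Set Printing Implicit Defensive.
Theorem theorem1p3 (R : realType) (alpha p q : R) (psi : quat R -> quat R)
    (I J : quat R) (P Q : R[i] -> R[i])
    (tau := symbol_trace P) (Delta := symbol_discr P Q)
    (B := berezin alpha q psi I) :
  0 < alpha -> 0 < p -> 0 < q ->
  slice_regular psi ->
  imaginary_unit I -> imaginary_unit J -> quat_orthogonal J I ->
  entire P -> entire Q ->
  (forall z, psi (slice I z) = slice I (P z) + slice I (Q z) * J) ->
  (exists z, Q z <> 0) ->
  ((ereal_sup (range B) < +oo)%E \/
   (q < p /\
    (plane_integral (fun w => B w `^ (p / (p - q))) < +oo)%E)) ->
  [/\ exists d0 d1 d2 : R,
        (forall z, Delta z = (d2%:C)%C * z ^+ 2 + (d1%:C)%C * z + (d0%:C)%C) /\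
        ((exists2 c : R[i], c <> 0 & forall z, Delta z = c) \/ d2 < 0),
      exists t0 t1 : R, forall z, tau z = (t1%:C)%C * z + (t0%:C)%C,
      ~ is_constant Delta ->
        exists (U : set R[i]) (rho : R[i] -> R[i]),
          [/\ region U, ~ bounded_set U, simply_connected U & U = sharp_set U] /\
          [/\ holomorphic_on U rho, forall z, U z -> rho z ^+ 2 = Delta z &
              exists ap am bp bm : R[i],
                [/\ affine_asymptotic U (fun z => (tau z + rho z) / 2) ap bp,
                    affine_asymptotic U (fun z => (tau z - rho z) / 2) am bm,
                    0 < `|ap| <= 1, 0 < `|am| <= 1 & `|ap| = `|am|]] &
      (forall z, Delta z <> 0) ->
        exists Delta0 : R[i],
          [/\ Delta0 <> 0, forall z, Delta z = Delta0 &
              forall rho : R[i], rho ^+ 2 = Delta0 ->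
                exists a bp bm : R[i],
                  [/\ `|a| <= 1,
                      forall z, (tau z + rho) / 2 = a * z + bp &
                      forall z, (tau z - rho) / 2 = a * z + bm]]].
Proof.
move=> alpha0 p0 q0 hpsi hI hJ hJI /entire_centire cP /entire_centire cQ split Q0 hyp.
have [C C0 hC] := growth cP cQ hI hJ hJI hpsi split alpha0 q0 p0 hyp.
(* For either square root of Delta(z), the numbers (tau + rho) / 2 and (tau - rho) / 2 have sum tau
   and product (tau^2 - Delta) / 4, the determinant of the symbol. *)
have G z w rho : rho ^+ 2 = Delta z ->
    cmod (cexp (alpha%:C%C * w * ((tau z + rho) / 2)) + cexp (alpha%:C%C * w * ((tau z - rho) / 2))) <=
    C * expR (alpha / 2 * ((cmod z + 2) ^+ 2 + (cmod w + 2) ^+ 2)).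
  have half (a b : R[i]) : (a + b) / 2 + (a - b) / 2 = a by field.
  move=> hr; apply: hC; first exact: half.
  have -> : (tau z + rho) / 2 * ((tau z - rho) / 2) = (tau z ^+ 2 - rho ^+ 2) / 4 by field.
  have quarter (a b : R[i]) : (a ^+ 2 - (a ^+ 2 - 4 * b)) / 4 = b by field.
  by rewrite hr /Delta symbol_discrE; exact: quarter.
have ctau : centire tau by exact: centire_tr.
have cDelta : centire Delta.
  move=> z; have -> : Delta = fun z => tr P z ^+ 2 - 4 * dt P Q z.
    by apply/funext => x; exact: symbol_discrE.
  apply: cdiffB; first by apply: cdiffX; exact: ctau.
  by apply: cdiffM; [exact: cdiff_cst|exact: centire_dt].
have Dneg x : exists2 y : R, y <= 0 & Delta x%:C%C = y%:C%C.
  exists (- 4 * (cIm (P x%:C%C) ^+ 2 + cmod (Q x%:C%C) ^+ 2)); last exact: symbol_discr_real.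
  by rewrite mulNr oppr_le0 mulr_ge0// addr_ge0 ?sqr_ge0.
have [t0 [t1 htau]] := trace_affine alpha0 C0 ctau G (symbol_trace_real P).
have [d0 [d1 [d2 hD]]] := discr_poly alpha0 C0 cDelta G Dneg.
have DR x : Delta x%:C%C = (d2 * x ^+ 2 + d1 * x + d0)%:C%C.
  by rewrite hD -rmorphXn -!rmorphM -!rmorphD.
have [d2le d2lin d0le] : [/\ d2 <= 0, (d2 = 0 -> d1 = 0) & d0 <= 0].
  apply: quadratic_le0 => x; have [y y0] := Dneg x.
  by rewrite DR => /rcI ->.
have Dconst : d2 = 0 -> forall z, Delta z = d0%:C%C.
  by move=> d20 z; rewrite hD d20 d2lin// !mul0r !add0r.
(* Here the assumption that [Q] is not identically zero enters: it excludes Delta = 0. *)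
have Dcase : (d2 = 0 /\ d0 != 0) \/ d2 < 0.
  have [d20|] := eqVneq d2 0; last by right; rewrite lt_neqAle d2le andbT.
  left; split=> //; apply/eqP => d00; have [x] := symbol_discr_neq0 P cQ Q0.
  by rewrite -/(Delta _) Dconst// d00.
split.
- exists d0, d1, d2; split=> //; case: Dcase => [[d20 d00]|]; last by right.
  left; exists d0%:C%C; last exact: Dconst.
  by move/(@rcI R 0 d0 \o esym)/eqP; rewrite eq_sym (negPf d00).
- by exists t0, t1.
- move=> nc; case: Dcase => [[d20 _]|d2n]; first by case: nc; exists d0%:C%C; exact: Dconst.
  exact: eigenvalue_branches htau hD d2n (slope_quadratic alpha0 C0 G htau hD d2n).
- move=> Dn; case: Dcase => [[d20 d00]|d2n]; last first.
    by have [z /eqP] := quadratic_root d0 d1 (negbT (lt_eqF d2n)); rewrite -hD => /eqP/Dn.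
  exists d0%:C%C; split; [|exact: Dconst|].
    by rewrite -(Dconst d20 0); exact: Dn.
  (* Both eigenvalues have slope t1 / 2, and [rho] enters their constant terms; the slope is bounded
     by [slope_constant] with nu^2 = -d0. *)
  move=> rho _; exists (t1 / 2)%:C%C, ((t0%:C%C + rho) / 2), ((t0%:C%C - rho) / 2); split.
  - rewrite cmodE lecR cmod_real normrM [`|2^-1|]ger0_norm// ler_pdivrMr// mul1r.
    apply: (slope_constant alpha0 C0 G (nu := Num.sqrt (- d0)) htau) => z.
    by rewrite Dconst// sqr_sqrtr ?opprK// oppr_ge0.
  - by move=> z; rewrite htau rmorphM fmorphV rmorph_nat/=; field.
  - by move=> z; rewrite htau rmorphM fmorphV rmorph_nat/=; field.
Qed.
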